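(* Let $\alpha\in(1,2)$. There exists a constant $C_\alpha>0$ such that for the finite signed measure $$\mu(dx)=-C_\alpha\,\mathbf{1}_{[-1,1]}(x)\,\mathrm{sgn}(x)\,|x|^{1-\alpha}\,\mathbf{1}_{\{x\ne0\}}\,dx,$$ which belongs to $K_\eta$ for every $\eta\in(\alpha-1,1)$, the equation $$Y_t=\int_0^t\mu(Y_s)\,ds+L_t,\qquad t\ge0,$$ driven by a one-dimensional symmetric $\alpha$-stable process $L$, has no weak solution. (Hence the condition $\eta\le\alpha-1$ is sharp for weak existence of solutions of $X_t=x_0+L_t+\int_0^t\mu(X_s)ds$ with $\mu\in K_\eta^f$.)
   Context: Symmetric $\alpha$-stable process: a one-dimensional Lévy process $L$ with $L_0=0$ and $\mathbb{E}[e^{i\xi L_t}]=e^{-t|\xi|^\alpha}$. Kato class: for a signed measure $\nu$ on $\mathbb{R}$ with total variation measure $|\nu|$ and $\eta\in(0,1)$ put $M_\nu^\eta(r)=\sup_{x\in\mathbb{R}}\int_{B(x,r)}\frac{|\nu|(dy)}{|x-y|^{1-\eta}}$. $K_\eta$ is the set of signed measures $\nu$ with $\lim_{r\downarrow0}M_\nu^\eta(r)=0$, and $K_\eta^f$ is the set of finite measures in $K_\eta$. Mollification: fix a non-negative, radial (even) $\varphi\in\mathcal{C}^\infty(\mathbb{R})$ with $\mathrm{supp}(\varphi)=[-1,1]$, $\int\varphi=1$; put $\varphi_n(x)=2^n\varphi(2^nx)$ and $\mu_n(x)=\int_{\mathbb{R}}\varphi_n(x-y)\mu(dy)$. Solution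 of $X_t=x_0+L_t+\int_0^t\mu(X_s)ds$: a càdlàg process $X$ such that there is a continuous process $(A_t)_{t\ge0}$ with, a.s., $X_t=x_0+L_t+A_t$ for all $t\ge0$, where (1) $\int_0^t\mu_n(X_s)ds$ converges to $A_t$ in probability, uniformly in $t$ over finite intervals; (2) there is a subsequence $\{n_k\}$ such that $\sup_k\int_0^t|\mu_{n_k}(X_s)|ds<\infty$ a.s. for each $t>0$; (3) under $\mathbb{P}$, $L_0=0$ and $L$ is a symmetric $\alpha$-stable process on $(\Omega,(\mathcal{F}_t)_{t\ge0})$. A weak solution is a pair $(X,L)$ for which there is a stochastic basis $(\Omega,(\mathcal{F}_t)_{t\ge0},\mathbb{P})$ such that $L$ is a symmetric $\alpha$-stable process, $X$ is adapted and is a solution. In the claim, $x_0=0$. *)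

(* Defs.v *)
From HB Require Import structures.
From mathcomp Require Import all_boot all_order all_algebra.
From mathcomp Require Import all_classical all_reals all_analysis.
From mathcomp Require Import complex.
Set Implicit Arguments.
Unset Strict Implicit.
Unset Printing Implicit Defensive.
Import Order.TTheory GRing.Theory Num.Theory.
Import numFieldNormedType.Exports.
Local Open Scope classical_set_scope.
Local Open Scope ring_scope.

(** Signed measures on the real line. A [charge] is finite-valued, so these
    are the finite signed measures. *)

Section signed_measures.
Context {R : realType}.
Implicit Types nu : {charge set (measurableTypeR R) -> \bar R}.

Definition hahn_sets nu : {PN : set R * set R | hahn_decomposition nu PN.1 PN.2} :=
  cid (let: ex_intro P (ex_intro N h) := Hahn_decomposition nu in
       ex_intro (fun PN : set R * set R => hahn_decomposition nu PN.1 PN.2)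
                (P, N) h).

Definition positive_part nu : {measure set (measurableTypeR R) -> \bar R} :=
  jordan_pos (svalP (hahn_sets nu)).

Definition negative_part nu : {measure set (measurableTypeR R) -> \bar R} :=
  jordan_neg (svalP (hahn_sets nu)).

Definition total_variation nu : {measure set (measurableTypeR R) -> \bar R} :=
  charge_variation (svalP (hahn_sets nu)).

Definition charge_integral nu (f : R -> R) : R :=
  \int[positive_part nu]_y f y - \int[negative_part nu]_y f y.

(** [nu(dx) = f(x) dx] *)
Definition has_density nu (f : R -> R) : Prop :=
  forall A : set R, measurable A ->
    nu A = (\int[lebesgue_measure]_(x in A) (f x)%:E)%E.

(** The inverse is taken in the extended reals, where [0^-1 = +oo]: an atom of
    [nu] at [x] makes the integral infinite. *)
Definition kato_modulus (eta : R) nu (r : R) : \bar R :=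
  ereal_sup [set (\int[total_variation nu]_(y in ball x r)
                    ((`|x - y| `^ (1 - eta))%:E)^-1)%E | x in [set: R]].

(** Membership in [K_eta^f], finiteness being part of the type of [nu]. *)
Definition finite_kato_class (eta : R) nu : Prop :=
  kato_modulus eta nu r @[r --> 0^'+] --> 0%E.

End signed_measures.

Section mollification.
Context {R : realType}.

Record mollifier (phi : R -> R) : Prop := Mollifier {
  mollifier_smooth : forall (n : nat) (x : R), derivable (derive1n n phi) x 1;
  mollifier_ge0 : forall x, 0 <= phi x;
  mollifier_even : forall x, phi (- x) = phi x;
  mollifier_supp : closure [set x | phi x != 0] = `[-1, 1]%classic;
  mollifier_int : (\int[lebesgue_measure]_x (phi x)%:E = 1)%E }.

Definition rescaled (phi : R -> R) (n : nat) (x : R) : R :=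
  2 ^+ n * phi (2 ^+ n * x).

Definition mollified (phi : R -> R)
    (mu : {charge set (measurableTypeR R) -> \bar R}) (n : nat) (x : R) : R :=
  charge_integral mu (fun y => rescaled phi n (x - y)).

End mollification.

(** Processes are families of random variables indexed by [R], of which only
    the times [t >= 0] are constrained. *)

Section processes.
Context {R : realType} d (Omega : measurableType d) (P : probability Omega R).
Implicit Types (F : R -> set (set Omega)) (X L A : R -> {RV P >-> R}).

Record filtration F : Prop := Filtration {
  filtration_sigma : forall t : R, 0 <= t -> sigma_algebra [set: Omega] (F t);
  filtration_sub : forall t : R, 0 <= t -> F t `<=` measurable;
  filtration_mono : forall s t : R, 0 <= s -> s <= t -> F s `<=` F t }.

Definition adapted F X : Prop :=
  forall t : R, 0 <= t ->
    preimage_set_system [set: Omega] (X t) measurable `<=` F t.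

Definition cadlag_process X : Prop := forall w,
  (forall t : R, 0 <= t -> X s w @[s --> t^'+] --> X t w) /\
  (forall t : R, 0 < t -> cvg (X s w @[s --> t^'-])).

Definition continuous_process A : Prop := forall w,
  {within `[0, +oo[, continuous (fun t => A t w)}.

Definition increment L (s t : R) (w : Omega) : R := L t w - L s w.

(** Levy process relative to the filtration [F]. *)
Record levy_process F L : Prop := LevyProcess {
  levy_adapted : adapted F L;
  levy_cadlag : cadlag_process L;
  levy_start : {ae P, forall w, L 0 w = 0};
  levy_independent : forall s t : R, 0 <= s -> s <= t ->
    forall (E : set Omega) (B : set R), F s E -> measurable B ->
      P (E `&` increment L s t @^-1` B) =
      (P E * P (increment L s t @^-1` B))%E;
  levy_stationary : forall s t : R, 0 <= s -> s <= t ->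
    forall B : set R, measurable B ->
      P (increment L s t @^-1` B) = P (L (t - s) @^-1` B) }.

(** [E[exp(i xi Z)]] *)
Definition char_fun (Z : Omega -> R) (xi : R) : R[i] :=
  Complex (\int[P]_w cos (xi * Z w)) (\int[P]_w sin (xi * Z w)).

Definition symmetric_stable (alpha : R) F L : Prop :=
  levy_process F L /\
  forall t xi : R, 0 <= t ->
    char_fun (L t) xi = (expR (- (t * `|xi| `^ alpha)))%:C%C.

Definition uniform_dist (T : R) (f g : R -> R) : \bar R :=
  ereal_sup [set `|f t - g t|%:E | t in `[0, T]].

(** Convergence in probability, uniformly in [t] over finite intervals. *)
Definition ucp_cvg (U : nat -> R -> Omega -> R) (A : R -> {RV P >-> R}) : Prop :=
  forall T eps : R, 0 <= T -> 0 < eps ->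
    P [set w | (eps%:E < uniform_dist T (U n ^~ w) (A ^~ w))%E]
      @[n --> \oo] --> 0%E.

(** [\int_0^t mu_n(X_s) ds] *)
Definition mollified_drift (phi : R -> R)
    (mu : {charge set (measurableTypeR R) -> \bar R}) X
    (n : nat) (t : R) (w : Omega) : R :=
  \int[lebesgue_measure]_(s in `[0, t]) mollified phi mu n (X s w).

(** [\int_0^t |mu_n(X_s)| ds] *)
Definition mollified_abs_drift (phi : R -> R)
    (mu : {charge set (measurableTypeR R) -> \bar R}) X
    (n : nat) (t : R) (w : Omega) : \bar R :=
  (\int[lebesgue_measure]_(s in `[0%R, t]) `|mollified phi mu n (X s w)|%:E)%E.

(** [X] is a solution of [X_t = x0 + L_t + \int_0^t mu(X_s) ds]. *)
Definition is_solution (phi : R -> R) (alpha x0 : R)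
    (mu : {charge set (measurableTypeR R) -> \bar R}) F X L : Prop :=
  [/\ cadlag_process X, symmetric_stable alpha F L
    & exists A, [/\ continuous_process A,
        {ae P, forall w, forall t : R, 0 <= t -> X t w = x0 + L t w + A t w},
        ucp_cvg (mollified_drift phi mu X) A
      & exists2 k : nat -> nat, {homo k : m n / (m < n)%N} &
          forall t : R, 0 < t -> {ae P, forall w,
            (ereal_sup (range (fun m => mollified_abs_drift phi mu X (k m) t w))
             < +oo)%E} ]].

End processes.

Definition has_weak_solution (R : realType) (phi : R -> R) (alpha x0 : R)
    (mu : {charge set (measurableTypeR R) -> \bar R}) : Prop :=
  exists (d : measure_display) (Omega : measurableType d)
    (P : probability Omega R) (F : R -> set (set Omega))
    (X L : R -> {RV P >-> R}),
    [/\ filtration F, adapted F X & is_solution phi alpha x0 mu F X L].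

Definition singular_drift (R : realType) (alpha C x : R) : R :=
  - C * \1_(`[-1, 1] : set R) x * Num.sg x * `|x| `^ (1 - alpha)
    * \1_([set y | y != 0] : set R) x.

(* Main.v *)
Require Import Defs.
From HB Require Import structures.
From mathcomp Require Import all_boot all_order all_algebra.
From mathcomp Require Import all_classical all_reals all_analysis.
From mathcomp Require Import measurable_realfun ring lra.
Set Implicit Arguments.
Unset Strict Implicit.
Unset Printing Implicit Defensive.
Import Order.TTheory GRing.Theory Num.Theory.
Import numFieldNormedType.Exports.
Local Open Scope classical_set_scope.
Local Open Scope ring_scope.

(** A weak solution is tested against Dynkin's formula along [Z = L + \int mu_n(X)],
    with the discount [exp (- kap t - \int |mu_n(X)|)], which keeps the total
    effect of the drift bounded uniformly in [n]. Only cosines are needed, hence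
    only the characteristic function of [L]; averaging over the frequency with
    the weight [exp (- t)] turns them into [bump x = x^2 / (1 + x^2)] and the
    stable generator into a bounded decaying function, positive at [0]. At high
    frequencies this shows that [X] spends no time at [0]. On the other hand,
    let [r = 2^((alpha - 1) / 2)]: the sum over dyadic scales of
    [(2 r)^-j bump (2^j x)] grows like [|x|^((alpha + 1) / 2)] near [0], so that
    its generator and its derivative times the drift are both of order
    [|x|^((1 - alpha) / 2)]; when [C] is large the drift wins and forces [X] to
    vanish almost everywhere in space-time, a contradiction. *)

(** * Integrals of bounded measurable functions *)

(** The total drift [\int |mu_n(X)|] is only known to be almost surely bounded along a subsequence:
    no moment is available and [sup |mu_n|] blows up. The discount repairs this pathwise, because
    [\int weight * |mu_n(X)|] is at most [1] on every path, hence at most [P E] after restriction to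
    an event [E]. Replacing [Z] by [X] inside a bounded Lipschitz function therefore costs an error
    that only sees uniform closeness in probability. The price is a term [- |mu_n| f] in the
    generator, of the good sign for [f >= 0].

    Within distance [2^-n] of [0] the mollified drift has no sign, so the dyadic argument carries an
    error proportional to the time spent there; this is why occupation of [0] is excluded
    beforehand. That step rests on [al > 1]: the drift is of first order in the frequency, the
    generator of order [al]. The discounts are not known to converge in [n], so conclusions are
    stated with a cutoff of level [N] lying below all of them. The limits come in a fixed order:
    mollification, then frequency or number of scales, then [N]. *)

Section bmeasurable.
Context d (T : measurableType d) (R : realType).
Implicit Types f g : T -> R.

(** Stable under sums, products and composition, and integrable for every finite measure:
    integrability conditions on expectations reduce to this one predicate. *)
Definition bmeasurable f :=
  measurable_fun setT f /\ exists M : R, forall x, `|f x| <= M.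

Lemma bmeasurable_integrable (m : {finite_measure set T -> \bar R}) f :
  bmeasurable f -> m.-integrable setT (EFin \o f).
Proof.
move=> [mf [M fM]].
apply: (@le_integrable _ _ _ m setT measurableT _ (EFin \o cst M)).
- exact/measurable_EFinP.
- by move=> x _ /=; rewrite lee_fin (le_trans (fM x)) ?ler_norm.
- exact: finite_measure_integrable_cst.
Qed.

Lemma bmeasurable_cst (c : R) : bmeasurable (fun=> c).
Proof. by split=> //; exists `|c|. Qed.

Lemma bmeasurableD f g : bmeasurable f -> bmeasurable g ->
  bmeasurable (fun x => f x + g x).
Proof.
move=> [mf [M fM]] [mg [N gN]]; split; first exact: measurable_funD.
by exists (M + N) => x; rewrite (le_trans (ler_normD _ _))// lerD.
Qed.

Lemma bmeasurableN f : bmeasurable f ->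
  bmeasurable (fun x => - f x).
Proof.
by move=> [mf [M fM]]; split; [exact: measurableT_comp|exists M => x; rewrite normrN].
Qed.

Lemma bmeasurableB f g : bmeasurable f -> bmeasurable g ->
  bmeasurable (fun x => f x - g x).
Proof. by move=> ? /bmeasurableN; exact: bmeasurableD. Qed.

Lemma bmeasurableM f g : bmeasurable f -> bmeasurable g ->
  bmeasurable (fun x => f x * g x).
Proof.
move=> [mf [M fM]] [mg [N gN]]; split; first exact: measurable_funM.
by exists (M * N) => x; rewrite normrM ler_pM.
Qed.

Lemma bmeasurable_norm f : bmeasurable f ->
  bmeasurable (fun x => `|f x|).
Proof.
by move=> [mf [M fM]]; split; [exact: measurableT_comp|exists M => x; rewrite normr_id].
Qed.

Lemma bmeasurable_sum I (s : seq I) (F : I -> T -> R) :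
  (forall i, bmeasurable (F i)) ->
  bmeasurable (fun x => \sum_(i <- s) F i x).
Proof.
move=> bF; elim: s => [|i s IH].
  under eq_fun do rewrite big_nil; exact: bmeasurable_cst.
by under eq_fun do rewrite big_cons; exact: bmeasurableD.
Qed.

Lemma bmeasurable_indic (A : set T) : measurable A ->
  bmeasurable (\1_A : T -> R).
Proof.
move=> mA; split; first exact: measurable_indic.
by exists 1 => x; rewrite indicE; case: (x \in A); rewrite ?normr1 ?normr0.
Qed.

Section integral.
Variable m : {finite_measure set T -> \bar R}.
Local Notation "\E f" := (\int[m]_x f x) (at level 10, f at level 9).

Lemma bRintegralD f g : bmeasurable f -> bmeasurable g ->
  \int[m]_x (f x + g x) = \int[m]_x f x + \int[m]_x g x.
Proof. by move=> bf bg; apply: RintegralD => //; exact: bmeasurable_integrable. Qed.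

Lemma bRintegralB f g : bmeasurable f -> bmeasurable g ->
  \int[m]_x (f x - g x) = \int[m]_x f x - \int[m]_x g x.
Proof. by move=> bf bg; apply: RintegralB => //; exact: bmeasurable_integrable. Qed.

Lemma bRintegralZl (c : R) f : bmeasurable f ->
  \int[m]_x (c * f x) = c * \int[m]_x f x.
Proof. by move=> bf; apply: RintegralZl => //; exact: bmeasurable_integrable. Qed.

Lemma bRintegralN f : bmeasurable f ->
  \int[m]_x (- f x) = - \int[m]_x f x.
Proof.
move=> bf; under eq_Rintegral do rewrite -mulN1r.
by rewrite bRintegralZl// mulN1r.
Qed.

Lemma bRintegral_sum I (s : seq I) (F : I -> T -> R) :
  (forall i, bmeasurable (F i)) ->
  \int[m]_x (\sum_(i <- s) F i x) = \sum_(i <- s) \int[m]_x F i x.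
Proof.
move=> bF; elim: s => [|i s IH].
  rewrite big_nil; under eq_Rintegral do rewrite big_nil.
  by rewrite Rintegral_cst// mul0r.
under eq_Rintegral do rewrite big_cons.
by rewrite big_cons bRintegralD ?IH//; exact: bmeasurable_sum.
Qed.

Lemma le_bRintegral f g : bmeasurable f -> bmeasurable g ->
  (forall x, f x <= g x) -> \int[m]_x f x <= \int[m]_x g x.
Proof.
by move=> bf bg fg; apply: le_Rintegral => //; exact: bmeasurable_integrable.
Qed.

Lemma ae_le_bRintegral f g : bmeasurable f -> bmeasurable g ->
  {ae m, forall x, f x <= g x} -> \int[m]_x f x <= \int[m]_x g x.
Proof.
move=> bf bg fg.
(* [min f g] equals [f] almost everywhere and lies below [g] everywhere, so the pointwise comparison
   applies. *)
have -> : \int[m]_x f x = \int[m]_x (Num.min (f x) (g x)).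
  congr fine; apply: ae_eq_integral => //.
  - by apply/measurable_EFinP; case: bf.
  - by apply/measurable_EFinP/measurable_minr; [case: bf|case: bg].
  - by apply: filterS fg => x /= fgx _; rewrite min_l.
apply: le_bRintegral => //; last by move=> x; rewrite ge_min lexx orbT.
split; first by apply: measurable_minr; [case: bf|case: bg].
case: bf bg => _ [M fM] [_ [N gN]]; exists (M + N) => x.
have ? := le_trans (normr_ge0 _) (fM x); have ? := le_trans (normr_ge0 _) (gN x).
by rewrite minEle; case: ifP => _; rewrite (le_trans (fM x), le_trans (gN x)) ?lerDl ?lerDr.
Qed.

Lemma bRintegral_eq0_ae f : bmeasurable f -> (forall x, 0 <= f x) ->
  \int[m]_x f x <= 0 -> {ae m, forall x, f x = 0}.
Proof.
move=> bf f0 If0.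
have mf : measurable_fun setT (EFin \o f) by apply/measurable_EFinP; case: bf.
have : (\int[m]_x `|(EFin \o f) x| = 0)%E.
  have If := bmeasurable_integrable m bf.
  under eq_integral do rewrite /= ger0_norm//.
  rewrite -[LHS]fineK; last exact: integrable_fin_num.
  by congr EFin; apply/eqP; rewrite eq_le If0 Rintegral_ge0.

move/(ae_eq_integral_abs m measurableT mf) => h.
by apply: filterS h => x /= /(_ I) [].
Qed.

End integral.
End bmeasurable.

Lemma bmeasurable_comp d d' (T : measurableType d) (T' : measurableType d')
  (R : realType) (f : T' -> R) (h : T -> T') :
  bmeasurable f -> measurable_fun setT h -> bmeasurable (f \o h).
Proof.
by move=> [mf [M fM]] mh; split; [exact: measurableT_comp|exists M => x /=].
Qed.

(** * Fubini's theorem under a bound in one variable *)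

Section dominated_fubini.
Context d1 d2 (T1 : measurableType d1) (T2 : measurableType d2) (R : realType).
Variables (m1 : {finite_measure set T1 -> \bar R})
  (m2 : {sigma_finite_measure set T2 -> \bar R}).
Variables (k : T2 -> R) (h : T1 * T2 -> R).
Hypothesis k0 : forall y, 0 <= k y.
Hypothesis ik : m2.-integrable setT (EFin \o k).
Hypothesis mh : measurable_fun setT h.
Hypothesis hk : forall x y, `|h (x, y)| <= k y.

Lemma dominated_section_integrable x :
  m2.-integrable setT (EFin \o (fun y => h (x, y))).
Proof.
apply: (le_integrable measurableT _ _ ik) => /=.
- by apply/measurable_EFinP/measurableT_comp.
- by move=> y _; rewrite lee_fin (le_trans (hk x y)) ?ler_norm.
Qed.

Lemma dominated_section_bounded y : bmeasurable (fun x => h (x, y)).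
Proof.
by split; [exact: measurableT_comp|exists (k y) => x].
Qed.

(** The bound [k] does not depend on the first variable, so the iterated integral of [|h|] is at
    most [m1 setT] times the integral of [k]. *)
Lemma dominated_integrable : (m1 \x m2)%E.-integrable setT (EFin \o h).
Proof.
apply/integrable12ltyP; first exact/measurable_EFinP.
apply: (@le_lt_trans _ _ (\int[m1]_x (\int[m2]_y (k y))%:E)%E).
  apply: ge0_le_integral => //.
  - by move=> x _; exact: integral_ge0.
  - apply: (measurable_fun_fubini_tonelli_F (abse \o (EFin \o h))) => //=.
    by apply: measurableT_comp => //; exact/measurable_EFinP.
  - move=> x _; rewrite fineK; last exact: integrable_fin_num.
    apply: ge0_le_integral => //.
    + apply: measurableT_comp => //.
      by apply: measurable_int; exact: dominated_section_integrable.
    + exact: measurable_int ik.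
    + by move=> y _; rewrite lee_fin.
rewrite integral_cst//= lte_mul_pinfty//.
- by rewrite lee_fin; apply: Rintegral_ge0.
- by rewrite ltey_eq fin_num_measure.
Qed.

Lemma Rintegral_prod1 :
  \int[m1]_x \int[m2]_y h (x, y) = \int[(m1 \x m2)%E]_z h z.
Proof.
rewrite /Rintegral -(integral12_prod_meas1 dominated_integrable).
congr fine; apply: eq_integral => x _; rewrite fineK//.
by apply: integrable_fin_num => //; exact: dominated_section_integrable.
Qed.

Lemma Rintegral_prod2 :
  \int[m2]_y \int[m1]_x h (x, y) = \int[(m1 \x m2)%E]_z h z.
Proof.
rewrite /Rintegral -(integral21_prod_meas1 dominated_integrable).
congr fine; apply: eq_integral => y _; rewrite fineK//.
apply: integrable_fin_num => //; apply: bmeasurable_integrable.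
exact: dominated_section_bounded.
Qed.

Lemma Rintegral_exchange :
  \int[m1]_x \int[m2]_y h (x, y) = \int[m2]_y \int[m1]_x h (x, y).
Proof. by rewrite Rintegral_prod1 Rintegral_prod2. Qed.

Lemma bmeasurable_section1 :
  bmeasurable (fun x => \int[m2]_y h (x, y)).
Proof.
split.
  apply: measurableT_comp => //.
  exact: (measurable_fubini_F dominated_integrable).
exists (\int[m2]_y k y) => x.
have ix := dominated_section_integrable x.
apply: (le_trans (le_normr_Rintegral _ ix)) => //.
by apply: le_Rintegral => //; exact: integrable_norm.
Qed.

Lemma measurable_section2 : measurable_fun setT (fun y => \int[m1]_x h (x, y)).
Proof.
apply: measurableT_comp => //.
exact: (measurable_fubini_G dominated_integrable).
Qed.

End dominated_fubini.

(** * Laplace averages of trigonometric functions *)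

Section half_line.
Context {R : realType}.
Local Notation leb := (@lebesgue_measure R).
Implicit Types (f F u : R -> R) (x y t : R).

Lemma sin_lipschitz x y : `|sin x - sin y| <= `|x - y|.
Proof.
wlog xy : x y / y < x.
  move=> H; case: (ltgtP x y) => [h|h|->]; last by rewrite !subrr.
    by rewrite distrC (distrC x); exact: H.
  exact: H.
have [|c _ ->] := @MVT _ (@sin R) (@cos R) y x xy.
  by apply: continuous_subspaceT; exact: continuous_sin.
- by rewrite normrM ler_piMl// cos_max.
Qed.

Lemma cos_lipschitz x y : `|cos x - cos y| <= `|x - y|.
Proof.
have E z : cos z = sin (z + pi / 2) by rewrite sinDpihalf.
by rewrite !E (le_trans (sin_lipschitz _ _))// opprD addrACA subrr addr0.
Qed.

(** Common majorant of the Laplace integrands: half of the decay of [exp (- t)] is spent on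
    absorbing powers of [t]. *)
Definition half_exp t : R := expR (- (t / 2)) * \1_(`[0, +oo[ : set R) t.

Lemma half_exp_ge0 t : 0 <= half_exp t.
Proof. by rewrite mulr_ge0 ?expR_ge0. Qed.

Lemma mulr_indic_restrict f (D : set R) :
  (fun t => f t * \1_D t) = f \_ D.
Proof.
by apply/funext => t; rewrite patchE indicE; case: ifP; rewrite ?mulr1 ?mulr0.
Qed.

Lemma integral_half_line f :
  \int[leb]_t (f t * \1_(`[0, +oo[ : set R) t) = \int[leb]_(t in `[0, +oo[) f t.
Proof. by rewrite [RHS]Rintegral_mkcond mulr_indic_restrict. Qed.

Lemma continuous_expRN2 : continuous (fun t => expR (- (t / 2)) : R).
Proof.
move=> t; apply: continuous_comp; last exact: continuous_expR.
by apply: continuousN; apply: cvgMl.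
Qed.

Lemma is_derive_expRN2 (c x : R) :
  is_derive x 1 (fun t => - (2 * c) * expR (- (t / 2))) (c * expR (- (x / 2))).
Proof. by apply: is_derive_eq; rewrite /GRing.scale/=; lra. Qed.

Lemma cvg_expRN2 : (fun t => expR (- (t / 2)) : R) @ +oo --> (0 : R).
Proof.
have : (fun t : R => 2^-1 * t) @ +oo --> +oo by apply: gt0_cvgMry.
move=> h; have := cvg_comp _ _ h (@cvgr_expR R); apply: cvg_trans.
by apply: near_eq_cvg; near=> t => /=; rewrite mulrC.
Unshelve. all: by end_near. Qed.

Lemma integral_half_exp :
  (\int[leb]_(t in `[0%R, +oo[) (expR (- (t / 2)))%:E = 2%:E)%E.
Proof.
rewrite (@ge0_continuous_FTC2y _ _ (fun t => - (2 * 1) * expR (- (t / 2))) 0 0).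
- by rewrite mul0r oppr0 expR0 mulr1 sub0e; congr EFin; lra.
- by move=> x _; exact: expR_ge0.
- by apply: continuous_subspaceT; exact: continuous_expRN2.
- by rewrite -[X in _ --> X](mulr0 (- (2 * 1))); apply: cvgMr; exact: cvg_expRN2.
- by move=> x _; have [] := is_derive_expRN2 1 x.
- apply: cvg_at_right_filter; apply: cvgMr; exact: continuous_expRN2.
- by move=> x _; rewrite derive1E; have [_ ->] := is_derive_expRN2 1 x; rewrite mul1r.
Qed.

Lemma measurable_expRN2 : measurable_fun setT (fun t : R => expR (- (t / 2))).
Proof. by apply: continuous_measurable_fun; exact: continuous_expRN2. Qed.

Lemma integrable_expRN2 :
  leb.-integrable `[0%R, +oo[ (EFin \o (fun t : R => expR (- (t / 2)))).
Proof.
apply/integrableP; split.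
  by apply/measurable_EFinP/measurable_funTS; exact: measurable_expRN2.
under eq_integral do rewrite /= ger0_norm ?expR_ge0//.
by rewrite integral_half_exp ltry.
Qed.

Lemma integrable_half_exp : leb.-integrable setT (EFin \o half_exp).
Proof.
rewrite /half_exp mulr_indic_restrict.
rewrite -restrict_EFin; apply/integrable_restrict => //.
by rewrite setTI; exact: integrable_expRN2.
Qed.

Definition exp_dominated u :=
  measurable_fun setT u /\ exists c, forall t, `|u t| <= c * half_exp t.

Lemma exp_dominated_integrable u : exp_dominated u ->
  leb.-integrable setT (EFin \o u).
Proof.
move=> [mu [c uc]].
apply: (le_integrable measurableT _ _ (_ : leb.-integrable setT (EFin \o (fun t => c * half_exp t)))).
- exact/measurable_EFinP.
- by move=> t _ /=; rewrite lee_fin (le_trans (uc t))// ler_norm.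
- by apply: (integrableZl measurableT c integrable_half_exp).
Qed.

Lemma exp_dominatedM u f : exp_dominated u -> bmeasurable f ->
  exp_dominated (fun t => u t * f t).
Proof.
move=> [mu [c uc]] [mf [M fM]]; split; first exact: measurable_funM.
exists (c * M) => t; rewrite normrM mulrAC ler_pM//.
Qed.

Lemma exp_dominatedB u f : exp_dominated u -> exp_dominated f ->
  exp_dominated (fun t => u t - f t).
Proof.
move=> [mu [c uc]] [mf [M fM]]; split; first exact: measurable_funB.
by exists (c + M) => t; rewrite mulrDl (le_trans (ler_normB _ _))// lerD.
Qed.

Lemma exp_dominatedZ (a : R) u : exp_dominated u -> exp_dominated (fun t => a * u t).
Proof.
move=> [mu [c uc]]; split; first exact: measurable_funM.
by exists (`|a| * c) => t; rewrite normrM -mulrA ler_wpM2l.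
Qed.

(** [f] has the antiderivative [F + 2 c exp (- x / 2)] up to the nonnegative
    correction that makes the one-signed FTC of the library applicable. *)
Lemma exp_dominated_FTC2y f F (c : R) :
  (forall x, 0 <= x -> `|f x| <= c * expR (- (x / 2))) ->
  {within `[0, +oo[, continuous f} ->
  F @ +oo --> (0 : R) ->
  (forall x, 0 < x -> derivable F x 1 /\ 'D_1 F x = f x) ->
  F @ 0^'+ --> F 0 ->
  \int[leb]_(t in `[0, +oo[) f t = - F 0.
Proof.
move=> fc cf F0 dF cF0.
have cE : {within `[0, +oo[, continuous (fun t => c * expR (- (t / 2)) : R)}.
  apply: continuous_subspaceT => t; apply: cvgMr; exact: continuous_expRN2.
have mcE : leb.-integrable `[0%R, +oo[ (EFin \o (fun t => c * expR (- (t / 2)))).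
  exact: integrableZl integrable_expRN2.
have mf : measurable_fun (`[0, +oo[ : set R) f.
  by apply: subspace_continuous_measurable_fun.
have If : leb.-integrable `[0%R, +oo[ (EFin \o f).
  apply: le_integrable mcE => //; first exact/measurable_EFinP.
  move=> x /=; rewrite in_itv/= andbT => x0.
  by rewrite lee_fin (le_trans (fc _ x0))// ler_norm.
have : \int[leb]_(t in `[0, +oo[) (f t + c * expR (- (t / 2))) = 0 - (F 0 - 2 * c).
  rewrite (@Rintegral_ge0_continuous_FTC2y _ _
    (fun t => F t + - (2 * c) * expR (- (t / 2))) 0 0).
  - by rewrite mul0r oppr0 expR0; lra.
  - by move=> x /fc; rewrite ler_norml => /andP[]; lra.
  - by move=> x; apply: cvgD; [exact: cf|exact: cE].
  - rewrite -[X in _ --> X](addr0 0); apply: cvgD => //.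
    by rewrite -[X in _ --> X](mulr0 (- (2 * c))); apply: cvgMr; exact: cvg_expRN2.
  - move=> x x0; apply: derivableD; first by have [] := dF _ x0.
    by have [] := is_derive_expRN2 c x.
  - apply: cvgD => //.
    apply: cvg_at_right_filter; apply: cvgMr; exact: continuous_expRN2.
  - move=> x; rewrite in_itv/= andbT => x0; rewrite derive1E.
    have [? ?] := dF _ x0; have [? ?] := is_derive_expRN2 c x.
    by rewrite deriveD//; congr (_ + _).
rewrite RintegralD// RintegralZl//; last exact: integrable_expRN2.
by rewrite [X in _ + c * X]/Rintegral integral_half_exp/=; lra.
Qed.

Definition laplace_weight t : R := expR (- t) * \1_(`[0, +oo[ : set R) t.
Local Notation lw := laplace_weight.

Lemma laplace_weight_ge0 t : 0 <= lw t.
Proof. by rewrite mulr_ge0 ?expR_ge0. Qed.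

Lemma laplace_weight_lt0 t : t < 0 -> lw t = 0.
Proof.
move=> t0; rewrite /lw indicE memNset ?mulr0//= in_itv/= andbT.
by apply/negP; rewrite -ltNge.
Qed.

Lemma laplace_weightE t : 0 <= t -> lw t = expR (- t).
Proof. by move=> t0; rewrite /lw indicE mem_set ?mulr1//= in_itv/= t0. Qed.

Lemma measurable_laplace_weight : measurable_fun setT lw.
Proof.
apply: measurable_funM; last exact: measurable_indic.
by apply: measurableT_comp => //; exact: measurable_expR.
Qed.

(** [217 = 1 + 6^3], from [t^b <= 1 + t^3] and [t / 6 <= exp (t / 6)]. *)
Lemma powR_expRN_le (b t : R) : 0 <= b <= 3 -> 0 <= t ->
  t `^ b * expR (- t) <= 217 * expR (- (t / 2)).
Proof.
move=> /andP[b0 b3] t0.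
have tb : t `^ b <= 1 + t ^+ 3.
  have [t1|/ltW t1] := leP t 1.
    rewrite (@le_trans _ _ 1) ?lerDl ?exprn_ge0//.
    by have := ge0_ler_powR b0 t0 ler01 t1; rewrite powR1.
  by rewrite (le_trans (ler_powR t1 b3))// powR_mulrn// lerDr.
have t3 : t ^+ 3 <= 216 * expR (t / 2).
  have h : t / 6 <= expR (t / 6) by have := expR_ge1Dx (t / 6); lra.
  have := lerXn2r 3 (divr_ge0 t0 (ler0n _ 6)) (expR_ge0 _) h.
  rewrite -expRM_natl expr_div_n.
  have -> : 3%:R * (t / 6) = t / 2 :> R by field.
  by rewrite ler_pdivrMr ?exprn_gt0// => /le_trans; apply; lra.
have e1 : 1 <= expR (t / 2) by rewrite -[leLHS]expR0 ler_expR; lra.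
have -> : expR (- t) = expR (- (t / 2)) * expR (- (t / 2)).
  by rewrite -expRD; congr expR; lra.
rewrite mulrA ler_wpM2r ?expR_ge0// expRN ler_pdivrMr ?expR_gt0//.
lra.
Qed.

Lemma exp_dominated_powR (b : R) : 0 <= b <= 3 ->
  exp_dominated (fun t => t `^ b * lw t).
Proof.
move=> b03; split.
  apply: measurable_funM; last exact: measurable_laplace_weight.
  exact: measurable_powR.
exists 217 => t; have [t0|t0] := leP 0 t.
  rewrite ger0_norm ?mulr_ge0 ?powR_ge0 ?laplace_weight_ge0//.
  rewrite laplace_weightE// /half_exp indicE mem_set ?mulr1/= ?in_itv/= ?t0//.
  exact: powR_expRN_le.
by rewrite laplace_weight_lt0// mulr0 normr0 mulr_ge0// half_exp_ge0.
Qed.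

Lemma mulr_powR_laplace (b t : R) : 0 <= b ->
  t * (t `^ b * lw t) = t `^ (b + 1) * lw t.
Proof.
move=> b0; have [t0|t0] := leP 0 t; last by rewrite laplace_weight_lt0// !mulr0.
by rewrite mulrA -{1}(powRr1 t0) [b + 1]addrC powRD// (gt_eqF (ltr_wpDr _ _)).
Qed.

(** * Cosine and sine transforms of exponentially dominated weights *)

Section transform.
Variables (u psi : R -> R).
Hypotheses (du : exp_dominated u) (dtu : exp_dominated (fun t => t * u t)).
Hypotheses (psi1 : forall x, `|psi x| <= 1)
  (psiL : forall x y, `|psi x - psi y| <= `|x - y|)
  (mpsi : measurable_fun setT psi).

Lemma bmeasurable_psi x : bmeasurable (fun t => psi (t * x)).
Proof.
split; last by exists 1 => t.
by apply: measurableT_comp => //; exact: measurable_funM.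
Qed.

Lemma transform_bounded : exists c, forall x, `|\int[leb]_t (u t * psi (t * x))| <= c.
Proof.
exists (\int[leb]_t `|u t|) => x.
have h := exp_dominated_integrable (exp_dominatedM du (bmeasurable_psi x)).
apply: (le_trans (le_normr_Rintegral _ h)) => //.
apply: le_Rintegral => //; first exact: integrable_norm.
  exact/integrable_norm/exp_dominated_integrable.
by move=> t _; rewrite normrM ler_piMr.
Qed.

(** A change of [x] is multiplied by [t] inside [psi], so the Lipschitz constant is the first
    absolute moment of [u]; this is what [dtu] is for. *)
Lemma transform_lipschitz : exists c, forall x y,
  `|\int[leb]_t (u t * psi (t * x)) - \int[leb]_t (u t * psi (t * y))|
    <= c * `|x - y|.
Proof.
exists (\int[leb]_t `|t * u t|) => x y.
have hx := exp_dominated_integrable (exp_dominatedM du (bmeasurable_psi x)).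
have hy := exp_dominated_integrable (exp_dominatedM du (bmeasurable_psi y)).
have htu := exp_dominated_integrable dtu.
have h := integrableB measurableT hx hy.
rewrite -RintegralB//.
apply: (le_trans (le_normr_Rintegral _ _)) => //.
rewrite -RintegralZr//; last exact: integrable_norm.
apply: le_Rintegral => //; first exact: integrable_norm.
  exact: (integrableZr measurableT `|x - y| (integrable_norm htu)).
move=> t _; rewrite -mulrBr !normrM [`|t| * _]mulrC -mulrA ler_wpM2l//.
by rewrite (le_trans (psiL _ _))// -mulrBr normrM.
Qed.

End transform.

Definition bump x : R := x ^+ 2 / (1 + x ^+ 2).
(** The derivative of [bump]. It enters through its sine transform [dbumpE], which is how the drift
    term of Dynkin's formula produces it. *)
Definition dbump x : R := 2 * x / (1 + x ^+ 2) ^+ 2.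

Lemma onePsqr_gt0 x : 0 < 1 + x ^+ 2.
Proof. by rewrite ltr_wpDr ?sqr_ge0. Qed.

Lemma laplace_powR0 t : lw t = t `^ 0 * lw t.
Proof. by rewrite powRr0 mul1r. Qed.

Lemma laplace_powR1 t : t * lw t = t `^ 1 * lw t.
Proof. by rewrite {1}laplace_powR0 mulr_powR_laplace// add0r. Qed.

Lemma laplace_powR2 t : t * (t * lw t) = t `^ 2 * lw t.
Proof. by rewrite laplace_powR1 mulr_powR_laplace// -natr1. Qed.

Lemma exp_dominated_laplace : exp_dominated lw.
Proof.
by rewrite (funext laplace_powR0); apply: exp_dominated_powR; rewrite lexx ler0n.
Qed.

Lemma exp_dominated_laplace1 : exp_dominated (fun t => t * lw t).
Proof. by rewrite (funext laplace_powR1); apply: exp_dominated_powR; lra. Qed.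

Lemma exp_dominated_laplace2 : exp_dominated (fun t => t * (t * lw t)).
Proof. by rewrite (funext laplace_powR2); apply: exp_dominated_powR; lra. Qed.

Lemma cvg_dominated_pinfty F (c : R) :
  (forall t, 0 <= t -> `|F t| <= c * expR (- (t / 2))) -> F @ +oo --> (0 : R).
Proof.
move=> Fc.
have h : (fun t => c * expR (- (t / 2)) : R) @ +oo --> (0 : R).
  by rewrite -[X in _ --> X](mulr0 c); apply: cvgMr; exact: cvg_expRN2.
apply/norm_cvg0P; apply: squeeze_cvgr (h) => //; last first.
  exact: (@cvg_cst _ (0:R)).
by near=> t; rewrite normr_ge0 Fc.
Unshelve. all: by end_near. Qed.

Lemma powR_expRN_norm_le (b t a : R) : 0 <= b <= 3 -> 0 <= t -> `|a| <= 1 ->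
  `|t `^ b * expR (- t) * a| <= 217 * expR (- (t / 2)).
Proof.
move=> b03 t0 a1; rewrite normrM ger0_norm ?mulr_ge0 ?powR_ge0 ?expR_ge0//.
by rewrite (le_trans _ (powR_expRN_le b03 t0))// ler_piMr// mulr_ge0 ?powR_ge0 ?expR_ge0.
Qed.

Lemma trig_laplace_le (x t a1 a2 a3 a4 : R) : 0 <= t ->
  let F t := a1 * (expR (- t) * sin (t * x)) + a2 * (expR (- t) * cos (t * x)) +
      a3 * (t * expR (- t) * sin (t * x)) + a4 * (t * expR (- t) * cos (t * x)) in
  `|F t| <= 217 * (`|a1| + `|a2| + `|a3| + `|a4|) * expR (- (t / 2)).
Proof.
move=> t0 /=.
have h0 a : `|a| <= 1 -> `|expR (- t) * a| <= 217 * expR (- (t / 2)).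
  move=> ha; have := @powR_expRN_norm_le 0 t a; rewrite powRr0 mul1r.
  by apply => //; rewrite lexx ler0n.
have h1 a : `|a| <= 1 -> `|t * expR (- t) * a| <= 217 * expR (- (t / 2)).
  by rewrite -{1}(powRr1 t0) => ?; apply: powR_expRN_norm_le => //; lra.
have H c b : `|b| <= 217 * expR (- (t / 2)) ->
    `|c * b| <= `|c| * (217 * expR (- (t / 2))).
  by move=> hb; rewrite normrM ler_wpM2l.
have := H a1 _ (h0 _ (sin_max (t * x))).
have := H a2 _ (h0 _ (cos_max (t * x))).
have := H a3 _ (h1 _ (sin_max (t * x))).
have := H a4 _ (h1 _ (cos_max (t * x))).
move=> H4 H3 H2 H1.
rewrite (le_trans (ler_normD _ _))// (le_trans (lerD (ler_normD _ _) H4))//.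
rewrite (le_trans (lerD (lerD (ler_normD _ _) H3) (lexx _)))//.
by rewrite (le_trans (lerD (lerD (lerD H1 H2) (lexx _)) (lexx _)))//; lra.
Qed.

(** The span of [exp (- t)] and [t exp (- t)] times sine and cosine is stable under differentiation.
    A Laplace integral is thus computed by solving a linear system for [a1], ..., [a4]; the
    primitive vanishes at infinity and equals [a2] at [0]. *)
Lemma trig_laplace_FTC (x a1 a2 a3 a4 : R) :
  \int[leb]_(t in `[0, +oo[)
    ((- a1 - x * a2 + a3) * (expR (- t) * sin (t * x)) +
     (x * a1 - a2 + a4) * (expR (- t) * cos (t * x)) +
     (- a3 - x * a4) * (t * expR (- t) * sin (t * x)) +
     (x * a3 - a4) * (t * expR (- t) * cos (t * x))) = - a2.
Proof.
pose F t := a1 * (expR (- t) * sin (t * x)) + a2 * (expR (- t) * cos (t * x)) +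
      a3 * (t * expR (- t) * sin (t * x)) + a4 * (t * expR (- t) * cos (t * x)).
rewrite (@exp_dominated_FTC2y _ F (217 * (`|- a1 - x * a2 + a3| +
   `|x * a1 - a2 + a4| + `|- a3 - x * a4| + `|x * a3 - a4|))).
- by rewrite /F oppr0 expR0 !mul0r sin0 cos0; ring.
- by move=> t t0; exact: trig_laplace_le.
- apply: continuous_subspaceT => t.
  by apply/differentiable_continuous/derivable1_diffP; exact: ex_derive.
- apply: (@cvg_dominated_pinfty _ (217 * (`|a1| + `|a2| + `|a3| + `|a4|))) => t t0.
  exact: trig_laplace_le.
- move=> t _; suff [? ->] : is_derive t 1 F ((- a1 - x * a2 + a3) * (expR (- t) * sin (t * x)) +
     (x * a1 - a2 + a4) * (expR (- t) * cos (t * x)) +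
     (- a3 - x * a4) * (t * expR (- t) * sin (t * x)) +
     (x * a3 - a4) * (t * expR (- t) * cos (t * x))) by [].
  by rewrite /F; apply: is_derive_eq; rewrite /GRing.scale/=; ring.
- apply: cvg_at_right_filter; suff : {for 0, continuous F} by [].
  by apply/differentiable_continuous/derivable1_diffP; exact: ex_derive.
Qed.

Lemma integral_cos_laplace x :
  \int[leb]_t (lw t * cos (t * x)) = 1 / (1 + x ^+ 2).
Proof.
have D1 : 1 + x ^+ 2 != 0 by rewrite gt_eqF// onePsqr_gt0.
under eq_Rintegral do rewrite mulrAC.
rewrite (integral_half_line (fun t => expR (- t) * cos (t * x))).
(* These coefficients solve [- a1 - x a2 = 0] and [x a1 - a2 = 1]. *)
have := trig_laplace_FTC x (x / (1 + x ^+ 2)) (- (1 / (1 + x ^+ 2))) 0 0.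
rewrite opprK => <-; apply: eq_Rintegral => t _; by field.
Qed.

Lemma dbumpE x : dbump x = \int[leb]_t (t * lw t * sin (t * x)).
Proof.
have D1 : 1 + x ^+ 2 != 0 by rewrite gt_eqF// onePsqr_gt0.
under eq_Rintegral do rewrite mulrA mulrAC.
rewrite (integral_half_line (fun t => t * expR (- t) * sin (t * x))).
(* [a3] and [a4] solve [- a3 - x a4 = 1] and [x a3 - a4 = 0]; then [a1] and [a2] cancel the two
   terms without the factor [t], and [- a2] is [dbump x]. *)
have := trig_laplace_FTC x (- (1 / (1 + x ^+ 2)) + x * (2 * x / (1 + x ^+ 2) ^+ 2))
  (- (2 * x / (1 + x ^+ 2) ^+ 2)) (- (1 / (1 + x ^+ 2))) (- (x / (1 + x ^+ 2))).
rewrite opprK /dbump => <-; apply: eq_Rintegral => t _; by field.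
Qed.

Lemma integral_laplace : \int[leb]_t lw t = 1.
Proof.
have := integral_cos_laplace 0; rewrite expr0n/= addr0 divr1 => <-.
by apply: eq_Rintegral => t _; rewrite mulr0 cos0 mulr1.
Qed.

Lemma bumpE x : bump x = 1 - \int[leb]_t (lw t * cos (t * x)).
Proof.
have D1 : 1 + x ^+ 2 != 0 by rewrite gt_eqF// onePsqr_gt0.
by rewrite integral_cos_laplace /bump; field.
Qed.

Lemma measurable_sin : measurable_fun setT (@sin R).
Proof. by apply: continuous_measurable_fun; exact: continuous_sin. Qed.

Lemma measurable_cos : measurable_fun setT (@cos R).
Proof. by apply: continuous_measurable_fun; exact: continuous_cos. Qed.

Lemma bump_lipschitz : exists c, forall x y, `|bump x - bump y| <= c * `|x - y|.
Proof.
have [c hc] := transform_lipschitz exp_dominated_laplace exp_dominated_laplace1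
  (@cos_max R) cos_lipschitz measurable_cos.
by exists c => x y; rewrite !bumpE opprB addrC addrA subrK distrC.
Qed.

Lemma dbump_lipschitz : exists c, forall x y, `|dbump x - dbump y| <= c * `|x - y|.
Proof.
have [c hc] := transform_lipschitz exp_dominated_laplace1 exp_dominated_laplace2
  (@sin_max R) sin_lipschitz measurable_sin.
by exists c => x y; rewrite !dbumpE.
Qed.

Lemma bump_ge0 x : 0 <= bump x.
Proof. by rewrite divr_ge0 ?sqr_ge0// ltW// onePsqr_gt0. Qed.

Lemma bump_le1 x : bump x <= 1.
Proof. by rewrite ler_pdivrMr ?onePsqr_gt0// mul1r lerDr. Qed.

Lemma bump_eq0 x : bump x = 0 -> x = 0.
Proof.
move/eqP; rewrite mulf_eq0 invr_eq0 [_ + _ == 0]gt_eqF ?onePsqr_gt0// orbF.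
by rewrite sqrf_eq0 => /eqP.
Qed.

(** [1 / 5] is the value at [|x| = 1 / 2]; its inverse is the [5] in the discount rate [kap]. *)
Lemma bump_ge x : 1 / 2 <= `|x| -> 1 / 5 <= bump x.
Proof.
move=> x12; rewrite ler_pdivlMr ?onePsqr_gt0// -real_normK ?num_real//; nra.
Qed.

Lemma dbump_norm x : `|dbump x| = 2 * `|x| / (1 + x ^+ 2) ^+ 2.
Proof.
rewrite /dbump normrM normfV normrM.
by rewrite [`|(1 + _) ^+ 2|]ger0_norm ?exprn_ge0 ?ltW ?onePsqr_gt0// ger0_norm.
Qed.

Lemma dbump_sgn x : dbump x = Num.sg x * `|dbump x|.
Proof. by rewrite dbump_norm !mulrA [Num.sg x * 2]mulrC -[2 * _ * `|x|]mulrA -numEsg. Qed.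

(** The numerator [2 |x|] is at least [1] and the denominator at most [(1 + 1)^2 = 4]. *)
Lemma dbump_ge x : 1 / 2 <= `|x| <= 1 -> 1 / 4 <= `|dbump x|.
Proof.
move=> /andP[x1 x2]; rewrite dbump_norm.
rewrite ler_pdivlMr ?exprn_gt0 ?onePsqr_gt0//.
have -> : x ^+ 2 = `|x| ^+ 2 by rewrite real_normK ?num_real.
have : `|x| ^+ 2 <= 1 by rewrite expr_le1.
have : 0 <= `|x| ^+ 2 by rewrite exprn_ge0.
by move: (`|x| ^+ 2) => b *; nra.
Qed.

Lemma dbump_le x : `|dbump x| <= 2 * `|x|.
Proof.
rewrite dbump_norm ler_pdivrMr ?exprn_gt0 ?onePsqr_gt0// ler_peMr//.
by rewrite exprn_ege1// lerDl sqr_ge0.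
Qed.

Lemma dbump_le1 x : `|dbump x| <= 1.
Proof.
rewrite dbump_norm ler_pdivrMr ?exprn_gt0 ?onePsqr_gt0// mul1r.
rewrite (@le_trans _ _ (1 + x ^+ 2))//.
  have := sqr_ge0 (1 - `|x|); rewrite sqrrB expr1n real_normK ?num_real//; lra.
by rewrite ler_eXnr// lerDl sqr_ge0.
Qed.

(** * The stable generator applied to [bump] *)

Section fractional.
Variables (al : R) (al12 : 1 < al < 2).

(** The symmetric stable generator of order [al] applied to [bump]. *)
Definition frac_bump x := \int[leb]_t (t `^ al * lw t * cos (t * x)).

Let du : exp_dominated (fun t => t `^ al * lw t).
Proof. by apply: exp_dominated_powR; move: al12; lra. Qed.

Let dtu : exp_dominated (fun t => t * (t `^ al * lw t)).
Proof.
have -> : (fun t => t * (t `^ al * lw t)) = (fun t => t `^ (al + 1) * lw t).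
  by apply/funext => t; rewrite mulr_powR_laplace//; move: al12; lra.
by apply: exp_dominated_powR; move: al12; lra.
Qed.

Lemma frac_bump_lipschitz :
  exists c, forall x y, `|frac_bump x - frac_bump y| <= c * `|x - y|.
Proof.
exact: (transform_lipschitz du dtu (@cos_max R) cos_lipschitz measurable_cos).
Qed.

Lemma frac_bump_bounded : exists c, forall x, `|frac_bump x| <= c.
Proof. exact: (transform_bounded du (@cos_max R) measurable_cos). Qed.

(** The value is [Gamma (al + 1)]; comparison with [exp (- 2)] on [[1, 2]] is enough for
    positivity. *)
Lemma frac_bump0_gt0 : 0 < frac_bump 0.
Proof.
have -> : frac_bump 0 = \int[leb]_t (t `^ al * lw t).
  by apply: eq_Rintegral => t _; rewrite mulr0 cos0 mulr1.
apply: (@lt_le_trans _ _ (\int[leb]_t (expR (- 2) * \1_(`[1, 2] : set R) t))).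
  rewrite RintegralZl//; last first.
    exact: integrable_indic_itv.
  rewrite mulr_gt0 ?expR_gt0// /Rintegral integral_indic// setIT.
  have E : lebesgue_measure (`[1, 2]%classic : set R) = 1%E.
    by rewrite lebesgue_measure_itv/= lte_fin ltr1n -EFinB; congr EFin; lra.
  by apply: (@lt_le_trans _ _ (fine (1%E : \bar R))) => //; rewrite -E.
apply: le_Rintegral => //.
- exact: (integrableZl measurableT (expR (- 2)) (integrable_indic_itv 1 2 true false)).
- exact: exp_dominated_integrable du.
- move=> t _; rewrite indicE; have [/set_mem/=|_] := boolP (t \in _); last first.
    by rewrite mulr0 mulr_ge0 ?powR_ge0 ?laplace_weight_ge0.
  rewrite in_itv/= => /andP[t1 t2]; rewrite laplace_weightE ?mulr1; last by lra.
  rewrite -[leLHS]mul1r ler_pM ?expR_ge0//; last by rewrite ler_expR; lra.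
  have a0 : 0 <= al by move: al12; lra.
  by have := @ge0_ler_powR _ _ a0 1 t ler01 _ t1; rewrite powR1; apply; rewrite nnegrE; lra.
Qed.

(** Integration by parts: [x cos (t x)] is the derivative of [sin (t x)], and the derivative moved
    onto [t^al exp (- t)] leaves sine transforms of [t^(al - 1) exp (- t)] and [t^al exp (- t)],
    both bounded. The rate [1 / |x|] is enough because the scales are later weighted by powers of
    [r < 2]. *)
Lemma frac_bump_decay : exists c, forall x, `|x * frac_bump x| <= c.
Proof.
have a0 : 0 < al by move: al12; lra.
have a10 : 0 < al - 1 by move: al12; lra.
have dv1 : exp_dominated (fun t => t `^ (al - 1) * lw t).
  by apply: exp_dominated_powR; move: al12; lra.
have [c1 hc1] := transform_bounded dv1 (@sin_max R) measurable_sin.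
have [c2 hc2] := transform_bounded du (@sin_max R) measurable_sin.
have I1 x := (exp_dominatedM dv1 (bmeasurable_psi (@sin_max R) measurable_sin x)).
have I2 x := (exp_dominatedM du (bmeasurable_psi (@sin_max R) measurable_sin x)).
have I3 x := (exp_dominatedM du (bmeasurable_psi (@cos_max R) measurable_cos x)).
exists (al * c1 + c2) => x.
suff -> : x * frac_bump x = - (al * \int[leb]_t (t `^ (al - 1) * lw t * sin (t * x))) +
    \int[leb]_t (t `^ al * lw t * sin (t * x)).
  rewrite (le_trans (ler_normD _ _))// normrN normrM lerD// gtr0_norm ?ler_wpM2l//; move: al12; lra.
pose f t := al * (t `^ (al - 1) * expR (- t) * sin (t * x)) -
   t `^ al * expR (- t) * sin (t * x) + x * (t `^ al * expR (- t) * cos (t * x)).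
pose F t := t `^ al * expR (- t) * sin (t * x).
have If : \int[leb]_(t in `[0, +oo[) f t = - F 0.
  apply: (@exp_dominated_FTC2y _ _ (217 * (al + 1 + `|x|))).
  - move=> t t0; rewrite /f.
    have H b a c : 0 <= b <= 3 -> `|a| <= 1 ->
        `|c * (t `^ b * expR (- t) * a)| <= `|c| * (217 * expR (- (t / 2))).
      by move=> b03 a1; rewrite normrM ler_wpM2l// powR_expRN_norm_le.
    have a13 : 0 <= al - 1 <= 3 by move: al12; lra.
    have a23 : 0 <= al <= 3 by move: al12; lra.
    have H1 := H _ _ al a13 (sin_max (t * x)).
    have := H _ _ (-1) a23 (sin_max (t * x)); rewrite mulN1r => H2.
    have H3 := H _ _ x a23 (cos_max (t * x)).
    rewrite (le_trans (ler_normD _ _))// (le_trans (lerD (ler_normD _ _) H3))//.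
    rewrite (le_trans (lerD (lerD H1 H2) (lexx _)))// normrN normr1.
    by rewrite (gtr0_norm (_ : 0 < al)); move: al12; lra.
  - apply/continuous_within_itvcyP; split.
      move=> t; rewrite in_itv/= andbT => t0.
      have h1 := is_derive1_powR al t0; have h2 := is_derive1_powR (al - 1) t0.
      by apply/differentiable_continuous/derivable1_diffP; exact: ex_derive.
    have ccos : (fun t => expR (- t) * cos (t * x)) @ 0^'+ --> expR (- 0) * cos (0 * x).
      apply: cvg_at_right_filter.
      suff : {for 0, continuous (fun t => expR (- t) * cos (t * x))} by [].
      by apply/differentiable_continuous/derivable1_diffP; exact: ex_derive.
    have csin : (fun t => expR (- t) * sin (t * x)) @ 0^'+ --> expR (- 0) * sin (0 * x).
      apply: cvg_at_right_filter.
      suff : {for 0, continuous (fun t => expR (- t) * sin (t * x))} by [].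
      by apply/differentiable_continuous/derivable1_diffP; exact: ex_derive.
    have p1 : (fun t => t `^ (al - 1)) @ 0^'+ --> 0 `^ (al - 1).
      rewrite powR0 ?gt_eqF//; exact: powR_cvg0.
    have p2 : (fun t => t `^ al) @ 0^'+ --> 0 `^ al.
      rewrite powR0 ?gt_eqF//; exact: powR_cvg0.
    have -> : f = (fun t => al * (t `^ (al - 1) * (expR (- t) * sin (t * x))) -
        t `^ al * (expR (- t) * sin (t * x)) + x * (t `^ al * (expR (- t) * cos (t * x)))).
      by apply/funext => t; rewrite /f; ring.
    apply: cvgD; last by apply: cvgMr; exact: cvgM.
    by apply: cvgB; [apply: cvgMr; exact: cvgM|exact: cvgM].
  - apply: (@cvg_dominated_pinfty _ 217) => t t0.
    by apply: powR_expRN_norm_le => //; [move: al12; lra|exact: sin_max].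
  - move=> t t0; have h := is_derive1_powR al t0.
    suff [? ->] : is_derive t 1 F (f t) by [].
    by rewrite /F /f; apply: is_derive_eq; rewrite /GRing.scale/=; ring.
  - have -> : F = (fun t => t `^ al * (expR (- t) * sin (t * x))).
      by apply/funext => t; rewrite /F; ring.
    apply: cvgM; first by rewrite powR0 ?gt_eqF//; exact: powR_cvg0.
    apply: cvg_at_right_filter.
    suff : {for 0, continuous (fun t => expR (- t) * sin (t * x))} by [].
    by apply/differentiable_continuous/derivable1_diffP; exact: ex_derive.
move: If; rewrite /F mul0r sin0 mulr0 oppr0 -integral_half_line.
have -> : (fun t => f t * \1_(`[0, +oo[ : set R) t) =
    (fun t => al * (t `^ (al - 1) * lw t * sin (t * x)) -
     t `^ al * lw t * sin (t * x) + x * (t `^ al * lw t * cos (t * x))).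
  by apply/funext => t; rewrite /f /lw; ring.
have J1 := exp_dominatedZ al (I1 x); have J3 := exp_dominatedZ x (I3 x).
rewrite RintegralD//; last 2 first.
- exact: exp_dominated_integrable (exp_dominatedB J1 (I2 x)).
- exact: exp_dominated_integrable J3.
rewrite RintegralB//; last 2 first.
- exact: exp_dominated_integrable J1.
- exact: exp_dominated_integrable (I2 x).
rewrite RintegralZl//; last exact: exp_dominated_integrable (I1 x).
rewrite RintegralZl//; last exact: exp_dominated_integrable (I3 x).
by rewrite /frac_bump; lra.
Qed.

End fractional.
End half_line.

(** * The singular drift and its mollifications *)

Section finite_copy.
Context d (T : measurableType d) (R : realType) (m : {measure set T -> \bar R}).

(** A second name for [m], indexed by a proof of finiteness, on which the structure of finite
    measure can be declared; the Radon-Nikodym theorem is then applied to it. *)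
Definition finite_copy of fin_num_fun m : set T -> \bar R := m.

Variable fin_m : fin_num_fun m.
HB.instance Definition _ := Measure.on (finite_copy fin_m).
HB.instance Definition _ := Measure_isFinite.Build _ _ _ (finite_copy fin_m) fin_m.

End finite_copy.

Section density.
Local Open Scope ereal_scope.
Context d (T : measurableType d) (R : realType).
Variables (m : {measure set T -> \bar R}) (mu : {sigma_finite_measure set T -> \bar R}).
Variable k : T -> R.
Hypothesis (ik : mu.-integrable setT (EFin \o k)).
Hypothesis mE : forall A, measurable A -> m A = \int[mu]_(x in A) (k x)%:E.

Let fin_m : fin_num_fun m.
Proof.
move=> A mA; rewrite mE//.
by apply: integrable_fin_num => //; exact: (integrableS measurableT).
Qed.

Local Notation mfin := (finite_copy fin_m).

Let m_mu : mfin `<< mu.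
Proof.
apply/null_content_dominatesP => A mA A0; rewrite [LHS]mE//.
apply: null_set_integral => //; apply: measurable_funTS; exact: measurable_int ik.
Qed.

(** [m] is absolutely continuous with respect to [mu], and its Radon-Nikodym derivative agrees
    almost everywhere with [k], since both have the same integral over every measurable set. *)
Lemma integral_density_in (f : T -> \bar R) D : measurable D ->
  measurable_fun setT f -> (forall x, 0 <= f x) ->
  \int[m]_(x in D) f x = \int[mu]_(x in D) (f x * (k x)%:E).
Proof.
move=> mD mf f0; have mk := measurable_int _ ik.
have mg := measurable_int _ (Radon_Nikodym_SigmaFinite.f_integrable m_mu).
have mfD : measurable_fun D f := measurable_funTS mf.
rewrite -[LHS](Radon_Nikodym_SigmaFinite.change_of_variables m_mu f0 mD mfD).
apply: ae_eq_integral => //.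
- by apply: measurable_funTS; exact: emeasurable_funM.
- by apply: measurable_funTS; exact: emeasurable_funM.
have := @integral_ae_eq _ _ _ mu setT measurableT (EFin \o k) _
  (Radon_Nikodym_SigmaFinite.f_integrable m_mu) mk.
move=> /(_ _)/filterS; apply.
- by move=> x /= h _; rewrite h.
- by move=> A _ mA; rewrite -Radon_Nikodym_SigmaFinite.f_integral// -mE.
Qed.

End density.

(** * Riesz kernels on balls *)

Section riesz.
Context {R : realType}.
Local Notation leb := (@lebesgue_measure R).
Variables (p : R) (p01 : 0 < p < 1).

Lemma measurable_riesz (c : R) : measurable_fun setT (fun y : R => `|y - c| `^ (- p)).
Proof.
apply: (measurableT_comp (f := fun z : R => z `^ (- p))); first exact: measurable_powR.
by apply: measurableT_comp => //; exact: measurable_funB.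
Qed.

Lemma measurable_riesz_restrict (c : R) (D : set R) : measurable D ->
  measurable_fun setT ((fun y : R => (`|y - c| `^ (- p))%:E) \_ D).
Proof.
move=> mD; apply/(measurable_restrictT _ mD).
by apply/measurable_EFinP/measurable_funTS; exact: measurable_riesz.
Qed.

(** [s] is [1] or [-1], the sign of [y - c] on [[a, b]]: one primitive then serves both sides of the
    singularity. *)
Lemma integral_riesz_away (c r s a b : R) : s ^+ 2 = 1 -> a < b ->
  (forall y, a <= y <= b -> 0 < s * (y - c) <= r) ->
  (\int[leb]_(y in `[a, b]) (`|y - c| `^ (- p))%:E
    <= (r `^ (1 - p) / (1 - p))%:E)%E.
Proof.
move=> s2 ab sr; have p1 : 0 < 1 - p by move: p01; lra.
have s1 : `|s| = 1 by apply/eqP; rewrite -sqrp_eq1// real_normK ?num_real// s2.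
pose F y := s * (s * (y - c)) `^ (1 - p) / (1 - p).
pose f y := (s * (y - c)) `^ (- p).
have -> : (\int[leb]_(y in `[a, b]) (`|y - c| `^ (- p))%:E =
    \int[leb]_(y in `[a, b]) (f y)%:E)%E.
  apply: eq_integral => y /set_mem/=; rewrite in_itv/= => /sr/andP[y0 _].
  by rewrite /f -[in RHS](gtr0_norm y0) normrM s1 mul1r.
have is_d q y : a <= y <= b -> is_derive y 1 (fun y => (s * (y - c)) `^ q)
     (q * (s * (y - c)) `^ (q - 1) * s).
  move=> /sr/andP[y0 _].
  have h : is_derive (s * (y - c)) 1 (fun z : R => z `^ q)
     (q * (s * (y - c)) `^ (q - 1)).
    exact: is_derive1_powR.
  have h2 : is_derive y 1 (fun y => s * (y - c)) s.
    by apply: is_derive_eq; rewrite /GRing.scale/= subr0 mulr1.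
  exact: (@is_derive1_comp _ (fun z : R => z `^ q) (fun y => s * (y - c)) y _ _ h h2).
have dF y : a <= y <= b -> is_derive y 1 F (f y).
  move=> yab; have h3 := is_d (1 - p) _ yab.
  rewrite /F; apply: is_derive_eq; rewrite /GRing.scale/=.
  rewrite (_ : 1 - p - 1 = - p); last by ring.
  have p0 : 1 - p != 0 by rewrite gt_eqF.
  set A := (_ `^ (- p)).
  have -> : s * (s * (y - c)) `^ (1 - p) * 0 + (1 - p)^-1 * (s * ((1 - p) * A * s)) =
      s ^+ 2 * A * ((1 - p)^-1 * (1 - p)) by ring.
  by rewrite s2 mulVf// mulr1 mul1r.
have cF y : a <= y <= b -> {for y, continuous F}.
  by move=> /dF ?; apply/differentiable_continuous/derivable1_diffP; exact: ex_derive.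
rewrite (@continuous_FTC2 _ _ F) => //; last 3 first.
- apply: derivable_within_continuous => y; rewrite in_itv/= => yab.
  by have [] := is_d (- p) y yab.
- split.
  + by move=> y; rewrite in_itv/= => /andP[/ltW y1 /ltW y2]; have [] := dF y _; rewrite ?y1.
  + by apply/cvg_at_right_filter/cF; rewrite lexx ltW.
  + by apply/cvg_at_left_filter/cF; rewrite lexx ltW.
- move=> y; rewrite in_itv/= => /andP[/ltW y1 /ltW y2]; rewrite derive1E.
  have yab : a <= y <= b by rewrite y1.
  by have [_ ->] := dF y yab.
rewrite -EFinB lee_fin /F -mulrBl ler_wpM2r ?invr_ge0 ?(ltW p1)//.
have /andP[a0 ra] : 0 < s * (a - c) <= r by apply: sr; rewrite lexx ltW.
have /andP[b0 rb] : 0 < s * (b - c) <= r by apply: sr; rewrite lexx ltW.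
have := powR_ge0 (s * (a - c)) (1 - p); have := powR_ge0 (s * (b - c)) (1 - p).
have h x : 0 < x -> x <= r -> x `^ (1 - p) <= r `^ (1 - p).
  by move=> x0 xr; exact: (ge0_ler_powR (ltW p1) (ltW x0) (ltW (lt_le_trans x0 xr)) xr).
have := h _ a0 ra; have := h _ b0 rb.
move: s2 => /eqP; rewrite sqrf_eq1 => /orP[/eqP->|/eqP->]; rewrite ?mul1r ?mulN1r; lra.
Qed.

Lemma integral_riesz_ball (c r : R) : 0 < r ->
  (\int[leb]_(y in ball c r) (`|y - c| `^ (- p))%:E
    <= (2 * (r `^ (1 - p) / (1 - p)))%:E)%E.
Proof.
move=> r0; have p1 : 0 < 1 - p by move: p01; lra.
have key (z t : R) : `|z - c| < r -> t <= `|z - c| ->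
    c - r <= z <= c - t \/ c + t <= z <= c + r.
  have [h|h] := leP 0 (z - c).
    by rewrite (ger0_norm h) => *; right; apply/andP; split; lra.
  by rewrite (ltr0_norm h) => *; left; apply/andP; split; lra.
(* [n + 2] rather than [n + 1] keeps [e n < r], so that both intervals of [F n] are
   non-degenerate. *)
pose e n : R := r / n.+2%:R.
have e0 n : 0 < e n by rewrite divr_gt0.
have er n : e n < r by rewrite ltr_pdivrMr// ltr_pMr// ltr1n.
pose F n : set R := `[c - r, c - e n] `|` `[c + e n, c + r].
have mF n : measurable (F n) by apply: measurableU.
have ndF : nondecreasing_seq F.
  move=> m n mn; apply/subsetPset => y.
  have emn : e n <= e m by rewrite ler_pM2l// lef_pV2 ?posrE// ler_nat.
  by rewrite /F/= !in_itv/= => -[/andP[y1 y2]|/andP[y1 y2]]; [left|right]; lra.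
have mf (D : set R) : measurable_fun D (fun y : R => (`|y - c| `^ (- p))%:E).
  by apply/measurable_EFinP/measurable_funTS; exact: measurable_riesz.
have g0 (y : R) : (0 <= (`|y - c| `^ (- p))%:E)%E by rewrite lee_fin powR_ge0.
have cvF := ge0_nondecreasing_set_cvg_integral (mu := leb) ndF mF (fun i => mf (F i))
  (fun _ y _ => g0 y).
apply: (@le_trans _ _ (\int[leb]_(y in \bigcup_n F n) (`|y - c| `^ (- p))%:E)%E).
  rewrite integral_mkcond [leRHS]integral_mkcond.
  apply: ge0_le_integral => //.
  - by move=> y _; rewrite patchE; case: ifP => // _; rewrite lee_fin powR_ge0.
  - by apply: measurable_riesz_restrict; exact: measurable_ball.
  - by apply: measurable_riesz_restrict; exact: bigcup_measurable.
  - move=> y _; rewrite !patchE; case: ifP => [/set_mem yr|]; last first.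
      by case: ifP => // _ _; rewrite lee_fin powR_ge0.
    (* At the centre [powR] returns [0], so the one point of the ball missed by every [F n]
       contributes nothing. *)
    have [->|yc] := eqVneq y c.
      rewrite subrr normr0 powR0 ?oppr_eq0 ?gt_eqF//; last by case/andP: p01.
      by case: ifP.
    rewrite mem_set//.
    have d0 : 0 < `|y - c| by rewrite normr_gt0 subr_eq0.
    pose n := Num.truncn (r / `|y - c|); exists n => //.
    have : e n <= `|y - c|.
      rewrite ler_pdivrMr// mulrC -ler_pdivrMr//.
      by rewrite (le_trans (ltW (truncnS_gt _)))// ler_nat ltnS leqnSn.
    move: yr; rewrite /ball/= distrC => yr en; rewrite /F/= !in_itv/=.
    exact: key.
rewrite -(cvg_lim _ cvF)//; apply: lime_le.
  by apply/cvg_ex; exists (\int[leb]_(y in \bigcup_n F n) (`|y - c| `^ (- p))%:E)%E.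
apply: nearW => n; rewrite /F ge0_integral_setU//; [|exact: (mf (F n))|].
  2: by rewrite disj_set2E; apply/eqP; rewrite -subset0 => y/=; rewrite !in_itv/=; have := e0 n; lra.
have -> : (2 * (r `^ (1 - p) / (1 - p)) = r `^ (1 - p) / (1 - p) + r `^ (1 - p) / (1 - p))%R.
  by rewrite mulr_natl mulr2n.
have ? := er n; have ? := e0 n.
rewrite EFinD; apply: leeD.
  by apply: (@integral_riesz_away c r (-1)); [rewrite sqrrN expr1n|lra|move=> y; lra].
by apply: (@integral_riesz_away c r 1); [rewrite expr1n|lra|move=> y; lra].
Qed.

(** The singularity sits at [0], not at the centre [x]. Points within [r] of [0] are covered by the
    centred bound; at the others the kernel is at most [r^-p], on a set of length at most [2 r]. *)
Lemma integral_riesz_other_ball (x r : R) : 0 < r ->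
  (\int[leb]_(y in ball x r) (`|y| `^ (- p))%:E
    <= (2 * (r `^ (1 - p) / (1 - p)) + 2 * r `^ (1 - p))%:E)%E.
Proof.
move=> r0.
have mf (D : set R) : measurable_fun D (fun y : R => (`|y - 0| `^ (- p))%:E).
  by apply/measurable_EFinP/measurable_funTS; exact: measurable_riesz.
have h := integral_riesz_ball 0 r0.
under eq_integral do rewrite -[X in `|X|]subr0.
apply: (@le_trans _ _ (\int[leb]_(y in ball 0%R r) (`|y - 0| `^ (- p))%:E +
    \int[leb]_(y in ball x r) (r `^ (- p))%:E)%E); last first.
  rewrite EFinD; apply: leeD => //.
  rewrite integral_cst; last exact: measurable_ball.
  rewrite [X in (_ * X)%E](_ : _ = (r *+ 2)%:E); last by apply: lebesgue_measure_ball; rewrite ltW.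
  rewrite -EFinM lee_fin; have -> : (1 - p = - p + 1)%R by ring.
  rewrite powRD; last by rewrite (gt_eqF r0) implybT.
  by rewrite powRr1 ?(ltW r0)// mulrnAr mulr_natl.
rewrite integral_mkcond [X in (_ <= X + _)%E]integral_mkcond
  [X in (_ <= _ + X)%E]integral_mkcond -ge0_integralD//; last 4 first.
- by move=> y _; rewrite patchE; case: ifP => // _; rewrite lee_fin powR_ge0.
- by apply: measurable_riesz_restrict; exact: measurable_ball.
- by move=> y _; rewrite patchE; case: ifP => // _; rewrite lee_fin powR_ge0.
- apply/(measurable_restrictT _ (measurable_ball _ _)).
  exact: measurable_cst.
apply: ge0_le_integral => //.
- by move=> y _; rewrite patchE; case: ifP => // _; rewrite lee_fin powR_ge0.
- by apply: measurable_riesz_restrict; exact: measurable_ball.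
- apply: emeasurable_funD; first by apply: measurable_riesz_restrict; exact: measurable_ball.
  apply/(measurable_restrictT _ (measurable_ball _ _)).
  exact: measurable_cst.
move=> y _; rewrite !patchE; case: (y \in (ball x r : set R)); last first.
  by rewrite adde0; case: ifP => // _; rewrite lee_fin powR_ge0.
case: (boolP (y \in (ball 0 r : set R))) => [_|].
  by rewrite leeDl// lee_fin powR_ge0.
move=> /negP ny; rewrite add0e lee_fin subr0.
have ry : r <= `|y|.
  by rewrite leNgt; apply/negP => yr; apply: ny; rewrite inE/= /ball/= sub0r normrN.
rewrite !powRN lef_pV2 ?posrE ?powR_gt0 ?(lt_le_trans r0)//.
by rewrite ge0_ler_powR ?nnegrE//; move: p01 r0; lra.
Qed.

End riesz.

(** * The drift as a charge: Jordan decomposition and Kato class *)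

Section drift.
Context {R : realType}.
Local Notation leb := (@lebesgue_measure R).
Variables (al C : R) (al12 : 1 < al < 2) (C0 : 0 < C).
Local Notation sd := (singular_drift al C).

Lemma indic_itvE (i : interval R) y : \1_([set` i]) y = (y \in i)%:R :> R.
Proof. by rewrite indicE mem_setE. Qed.

Lemma indic_neq0 y : \1_([set y : R | y != 0]) y = (y != 0)%:R :> R.
Proof. by rewrite indicE mem_setE. Qed.

Lemma singular_drift_sgE y : sd y = - Num.sg y * `|sd y|.
Proof.
rewrite /singular_drift indic_itvE indic_neq0; case: (y \in _); last first.
  by rewrite !(mulr0, mul0r) normr0 mulr0.
case: (y != 0); last by rewrite !(mulr0, mul0r) normr0 mulr0.
rewrite !mulr1 !normrM normrN (gtr0_norm C0) normr_sg.
have -> : `| `|y| `^ (1 - al)| = `|y| `^ (1 - al) by rewrite ger0_norm// powR_ge0.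
have [->|y0] := eqVneq y 0; first by rewrite sgr0 !(mulr0, mul0r, oppr0).
by rewrite mulr1; ring.
Qed.

Lemma singular_drift_norm_le y :
  `|sd y| <= C * `|y| `^ (- (al - 1)) * \1_(`[-1, 1] : set R) y.
Proof.
rewrite /singular_drift indic_itvE indic_neq0 opprB.
case: (y \in _); last by rewrite !(mulr0, mul0r) normr0.
rewrite !mulr1 !normrM normrN (gtr0_norm C0) normr_sg.
rewrite (ger0_norm (powR_ge0 _ _)) -!mulrA ler_pM2l//.
by case: (y != 0); rewrite ?normr1 ?mulr1 ?mul1r// normr0 mulr0 mulr0 powR_ge0.
Qed.

Lemma singular_drift_norm y : 0 < `|y| <= 1 -> `|sd y| = C * `|y| `^ (1 - al).
Proof.
move=> /andP[y0 y1]; rewrite /singular_drift indic_itvE indic_neq0 in_itv/= -ler_norml y1.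
rewrite -normr_gt0 y0 !mulr1 !normrM normrN (gtr0_norm C0) normr_sg -normr_gt0 y0 mulr1.
by rewrite (ger0_norm (powR_ge0 _ _)).
Qed.

Lemma measurable_singular_drift : measurable_fun setT sd.
Proof.
rewrite /singular_drift.
apply: measurable_funM; last first.
  apply: measurable_indic.
  have -> : [set y : R | y != 0] = ~` [set 0].
    by apply/seteqP; split=> y /= /eqP.
  exact: measurableC.
apply: measurable_funM; last first.
  by apply: (measurableT_comp (f := fun z : R => z `^ (1 - al))) => //; exact: measurable_powR.
apply: measurable_funM; last first.
  have -> : @Num.sg R = (fun y => \1_(`]0, +oo[ : set R) y - \1_(`]-oo, 0[ : set R) y).
    apply/funext => y; rewrite !indic_itvE !in_itv/= andbT.
    by case: (sgrP y); rewrite ?subr0 ?sub0r ?subrr.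
  by apply: measurable_funB; exact: measurable_indic.
by apply: measurable_funM => //; exact: measurable_indic.
Qed.

Let p01 : 0 < al - 1 < 1. Proof. by move: al12; lra. Qed.

Lemma integrable_singular_drift : leb.-integrable setT (EFin \o sd).
Proof.
apply/integrableP; split; first by apply/measurable_EFinP; exact: measurable_singular_drift.
apply: (@le_lt_trans _ _ (\int[leb]_y
   (C%:E * ((fun y : R => (`|y - 0%R| `^ (- (al - 1)))%:E) \_ (ball 0%R 2%R)) y))%E).
  apply: ge0_le_integral => //.
  - by apply: measurableT_comp => //; apply/measurable_EFinP; exact: measurable_singular_drift.
  - apply: measurable_funeM; apply: measurable_riesz_restrict; exact: measurable_ball.
  - move=> y _ /=; rewrite (le_trans (_ : _ <= (C * `|y| `^ (- (al - 1)) * \1_(`[(-1)%R, 1%R] : set R) y)%:E)%E)//.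
      by rewrite lee_fin singular_drift_norm_le.
    rewrite indic_itvE in_itv/= patchE subr0.
    have [y1|_] := boolP (_ <= y <= _); last first.
      rewrite mulr0; apply: mule_ge0; first by rewrite lee_fin ltW.
      by case: ifP => // _; rewrite lee_fin powR_ge0.
    rewrite mem_set; first by rewrite mulr1 EFinM.
    by rewrite /ball/= sub0r normrN; move: y1; rewrite -ler_norml; lra.
rewrite ge0_integralZl//; last 3 first.
- by apply: measurable_riesz_restrict; exact: measurable_ball.
- by move=> y _; rewrite patchE; case: ifP => // _; rewrite lee_fin powR_ge0.
- by rewrite lee_fin ltW.
rewrite -integral_mkcond lte_mul_pinfty// ?lee_fin ?ltW//.
by rewrite (le_lt_trans (integral_riesz_ball p01 0 (ltr0n _ 2)))// ltry.
Qed.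

Definition drift_charge : {charge set (measurableTypeR R) -> \bar R} :=
  induced_charge integrable_singular_drift.

Local Notation mu := drift_charge.

Lemma drift_charge_density : has_density mu sd.
Proof. by []. Qed.

(** The drift points towards [0], so its positive part lives on the negative half-line. *)
Lemma drift_hahn : hahn_decomposition mu (`]-oo, 0[ : set R) (`[0, +oo[ : set R).
Proof.
split.
- split=> // A mA A0; apply: integral_ge0 => y /A0/=; rewrite in_itv/= => y0.
  by rewrite /= singular_drift_sgE ltr0_sg// opprK mul1r lee_fin.
- split=> // A mA A0.
  have -> : mu A = (- \int[leb]_(y in A) (- sd y)%:E)%E.
    rewrite -integralN/=.
      by apply: eq_integral => y _; rewrite /= opprK.
    apply: integrable_add_def => //.
    exact: (integrableS measurableT mA (@subsetT _ _) (integrableN integrable_singular_drift)).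
  rewrite oppe_le0; apply: integral_ge0 => y /A0/=; rewrite in_itv/= andbT => y0.
  rewrite lee_fin singular_drift_sgE mulNr opprK mulr_ge0//.
  by rewrite sgr_ge0.
- by rewrite -setCitvr setvU.
- by apply/seteqP; split=> y //=; rewrite !in_itv/= andbT => -[]; rewrite ltNge => /negP.
Qed.

Definition drift_pos y := sd y * \1_(`]-oo, 0[ : set R) y.
Definition drift_neg y := - sd y * \1_(`[0, +oo[ : set R) y.

Lemma drift_pos_ge0 y : 0 <= drift_pos y.
Proof.
rewrite /drift_pos indic_itvE in_itv/=; have [y0|_] := boolP (y < 0); last by rewrite mulr0.
by rewrite mulr1 singular_drift_sgE ltr0_sg// opprK mul1r.
Qed.

Lemma drift_neg_ge0 y : 0 <= drift_neg y.
Proof.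
rewrite /drift_neg indic_itvE in_itv/= andbT; have [y0|_] := boolP (0 <= y); last by rewrite mulr0.
by rewrite mulr1 singular_drift_sgE mulNr opprK mulr_ge0// sgr_ge0.
Qed.

Lemma drift_posB y : drift_pos y - drift_neg y = sd y.
Proof.
rewrite /drift_pos /drift_neg !indic_itvE !in_itv/= andbT ltNge.
by case: (0 <= y); rewrite /= ?mulr0 ?mulr1 ?sub0r ?subr0 ?opprK.
Qed.

Lemma drift_posD y : drift_pos y + drift_neg y = `|sd y|.
Proof.
have := drift_posB y; have := drift_pos_ge0 y; have := drift_neg_ge0 y.
rewrite /drift_pos /drift_neg !indic_itvE !in_itv/= andbT ltNge.
case: (0 <= y); rewrite /= ?mulr0 ?mulr1 ?add0r ?addr0 ?sub0r ?subr0 ?opprK.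
  by move=> + _ _; rewrite oppr_ge0 => /ler0_norm ->.
by move=> _ /ger0_norm ->.
Qed.

Lemma measurable_drift_pos : measurable_fun setT drift_pos.
Proof. by apply: measurable_funM; [exact: measurable_singular_drift|exact: measurable_indic]. Qed.

Lemma measurable_drift_neg : measurable_fun setT drift_neg.
Proof.
apply: measurable_funM; last exact: measurable_indic.
by apply: measurableT_comp => //; exact: measurable_singular_drift.
Qed.

(** [hahn_sets] is an arbitrary choice; uniqueness of the Hahn decomposition up to null sets
    replaces it by the two half-lines. *)
Lemma positive_part_drift (A : set R) : measurable A ->
  positive_part mu A = (\int[leb]_(y in A) (drift_pos y)%:E)%E.
Proof.
move=> mA; rewrite /positive_part.
move: (svalP (hahn_sets mu)) => hP'.
apply: (eq_trans (jordan_posE hP' A)); rewrite cjordan_posE /crestr0 mem_set// /crestr/=.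
have [-> _] := Hahn_decomposition_uniq hP' drift_hahn mA.
rewrite /drift_charge/= /induced_charge integral_mkcondr.
apply: eq_integral => y _; rewrite patchE /drift_pos indicE.
by case: (y \in _); rewrite /= ?mulr1 ?mulr0.
Qed.

Lemma negative_part_drift (A : set R) : measurable A ->
  negative_part mu A = (\int[leb]_(y in A) (drift_neg y)%:E)%E.
Proof.
move=> mA; rewrite /negative_part.
move: (svalP (hahn_sets mu)) => hP'.
apply: (eq_trans (jordan_negE hP' A)); rewrite cjordan_negE /crestr0 mem_set// /crestr/=.
have [_ ->] := Hahn_decomposition_uniq hP' drift_hahn mA.
rewrite /drift_charge/= /induced_charge.
rewrite -integralN/=.
  rewrite integral_mkcondr; apply: eq_integral => y _; rewrite patchE /drift_neg indicE.
  by case: (y \in _); rewrite /= ?mulr1 ?mulr0.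
apply: integrable_add_def => //.
  exact: measurableI.
apply: (integrableS measurableT _ (@subsetT _ _) integrable_singular_drift).
exact: measurableI.
Qed.

Lemma total_variation_drift (A : set R) : measurable A ->
  Defs.total_variation mu A = (\int[leb]_(y in A) (`|sd y|)%:E)%E.
Proof.
move=> mA; transitivity (positive_part mu A + negative_part mu A)%E; first by [].
rewrite positive_part_drift// negative_part_drift// -ge0_integralD//.
- by apply: eq_integral => y _; rewrite -EFinD drift_posD.
- by move=> y _; rewrite lee_fin drift_pos_ge0.
- by apply/measurable_EFinP/measurable_funTS; exact: measurable_drift_pos.
- by move=> y _; rewrite lee_fin drift_neg_ge0.
- by apply/measurable_EFinP/measurable_funTS; exact: measurable_drift_neg.
Qed.

Lemma charge_integral_drift (h : R -> R) : bmeasurable h ->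
  (forall y, 0 <= h y) ->
  charge_integral mu h = \int[leb]_y (h y * sd y).
Proof.
move=> bh h0; have [mh [M hM]] := bh.
have meh : measurable_fun setT (EFin \o h) by exact/measurable_EFinP.
have eh0 y : (0 <= (EFin \o h) y)%E by rewrite lee_fin.
have M0 : 0 <= M by apply: le_trans (hM 0).
have ihk (k : R -> R) : measurable_fun setT k -> (forall y, `|k y| <= `|sd y|) ->
    leb.-integrable setT (EFin \o (fun y => h y * k y)).
  move=> mk ksd.
  apply: (le_integrable measurableT _ _
    (integrableZl measurableT M (integrable_norm integrable_singular_drift))).
    exact/measurable_EFinP/measurable_funM.
  move=> y _ /=; rewrite lee_fin normrM [leRHS]ger0_norm ?mulr_ge0//.
  by rewrite ler_pM.
have pos_le y : `|drift_pos y| <= `|sd y|.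
  by rewrite ger0_norm ?drift_pos_ge0// -drift_posD lerDl drift_neg_ge0.
have neg_le y : `|drift_neg y| <= `|sd y|.
  by rewrite ger0_norm ?drift_neg_ge0// -drift_posD lerDr drift_pos_ge0.
have idrift (k : R -> R) : measurable_fun setT k -> (forall y, `|k y| <= `|sd y|) ->
    leb.-integrable setT (EFin \o k).
  move=> mk ksd; apply: (le_integrable measurableT _ _ integrable_singular_drift).
    exact/measurable_EFinP.
  by move=> y _ /=; rewrite lee_fin.
rewrite /charge_integral /Rintegral.
rewrite (@integral_density_in _ _ R (positive_part mu) leb drift_pos
  (idrift _ measurable_drift_pos pos_le) positive_part_drift _ setT measurableT meh eh0).
rewrite (@integral_density_in _ _ R (negative_part mu) leb drift_neg
  (idrift _ measurable_drift_neg neg_le) negative_part_drift _ setT measurableT meh eh0).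
transitivity (\int[leb]_y (h y * drift_pos y) - \int[leb]_y (h y * drift_neg y)); first by [].
rewrite -RintegralB//; last 2 first.
- exact: (ihk _ measurable_drift_pos pos_le).
- exact: (ihk _ measurable_drift_neg neg_le).
by apply: eq_Rintegral => y _; rewrite -mulrBr drift_posB.
Qed.

(** With [p = (1 - eta) + (al - 1)], the product of the kernel [|x - y|^-(1 - eta)] and the density
    [|y|^-(al - 1)] is at most the smaller of the two distances to the power [- p], hence at most
    the sum of both such powers. The condition [eta > al - 1] is exactly [p < 1], and the bound is
    of order [r^(1 - p)], uniformly in [x]. *)
Lemma drift_kato (eta : R) : al - 1 < eta < 1 -> finite_kato_class eta mu.
Proof.
move=> /andP[eta1 eta2].
pose p := al - eta.
have p01' : 0 < p < 1 by rewrite /p; move: al12; lra.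
have q0 : 0 < 1 - p by move: p01'; lra.
pose B (r : R) := C * (2 * (r `^ (1 - p) / (1 - p)) + (2 * (r `^ (1 - p) / (1 - p)) + 2 * r `^ (1 - p))).
pose psi (x y : R) : \bar R := ((`|x - y| `^ (1 - eta))%:E)^-1%E.
have psiE x y : psi x y = if y == x then +oo%E else (`|y - x| `^ (- (1 - eta)))%:E.
  rewrite /psi inver; have [->|yx] := eqVneq y x.
    by rewrite subrr normr0 powR0 ?eqxx// gt_eqF// subr_gt0.
  have ? : 0 < `|x - y| by rewrite normr_gt0 subr_eq0 eq_sym.
  by rewrite gt_eqF ?powR_gt0// distrC powRN.
have mpsi x : measurable_fun setT (psi x).
  rewrite (funext (psiE x)); apply: measurable_fun_ifT => //.
    exact: measurable_fun_eqr.
  by apply/measurable_EFinP; exact: measurable_riesz.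
have psi0 x y : (0 <= psi x y)%E by rewrite inve_ge0 lee_fin powR_ge0.
have bound x r : 0 < r ->
    (\int[Defs.total_variation mu]_(y in ball x r) psi x y <= (B r)%:E)%E.
  move=> r0.
  rewrite (@integral_density_in _ _ R (Defs.total_variation mu) leb (fun y => `|sd y|))//; first last.
  - exact: mpsi.
  - exact: measurable_ball.
  - by move=> A mA; exact: total_variation_drift.
  - exact: integrable_norm integrable_singular_drift.
  (* At [y = x] the kernel is [+oo]; this Lebesgue-null point is removed before the pointwise
     comparison. *)
  rewrite -(@integral_setD1 _ _ x); last 2 first.
  - by apply: measurableD => //; exact: measurable_ball.
  - apply: measurable_funTS; apply: emeasurable_funM => //.
    by apply/measurable_EFinP; apply: measurableT_comp => //; exact: measurable_singular_drift.
  have mc : measurable_fun setT (fun y : R => (C * (`|y - x| `^ (- p) + `|y - 0| `^ (- p)))%:E).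
    by apply/measurable_EFinP; apply: measurable_funM => //; apply: measurable_funD; exact: measurable_riesz.
  apply: (@le_trans _ _ (\int[leb]_(y in ball x r `\ x)
     (C * (`|y - x| `^ (- p) + `|y - 0| `^ (- p)))%:E)%E).
    apply: ge0_le_integral => //.
    - by apply: measurableD => //; exact: measurable_ball.
    - by move=> y _; rewrite mule_ge0// lee_fin.
    - apply: measurable_funTS; apply: emeasurable_funM; first exact: mpsi.
      by apply/measurable_EFinP; apply: measurableT_comp => //; exact: measurable_singular_drift.
    - exact: measurable_funTS.
    - move=> y [_ /eqP yx]; rewrite psiE (negbTE yx) -EFinM lee_fin subr0.
      have [->|y0] := eqVneq y 0.
        rewrite singular_drift_sgE sgr0 oppr0 mul0r normr0 mulr0.
        by rewrite mulr_ge0 ?(ltW C0)// addr_ge0// powR_ge0.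
      apply: (@le_trans _ _ (`|y - x| `^ (- (1 - eta)) * (C * `|y| `^ (- (al - 1))))).
        rewrite ler_wpM2l ?powR_ge0// (le_trans (singular_drift_norm_le y))//.
        have Cy : 0 <= C * `|y| `^ (- (al - 1)) by rewrite mulr_ge0 ?powR_ge0// ltW.
        by rewrite ler_piMr// indic_itvE lern1 leq_b1.
      rewrite mulrCA ler_pM2l//.
      have a0 : 0 < `|y - x| by rewrite normr_gt0 subr_eq0.
      have b0 : 0 < `|y| by rewrite normr_gt0.
      have pE : - p = - (1 - eta) + - (al - 1) by rewrite /p; ring.
      have mono (u v e : R) : 0 < u -> u <= v -> 0 <= e -> v `^ (- e) <= u `^ (- e).
        move=> u0 uv e0; have v0 := lt_le_trans u0 uv.
        rewrite !powRN lef_pV2 ?posrE ?powR_gt0//.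
        exact: (ge0_ler_powR e0 (ltW u0) (ltW v0) uv).
      have [ab|/ltW ba] := leP `|y - x| `|y|.
        rewrite -[leLHS]addr0 lerD ?powR_ge0// pE powRD; last by rewrite (gt_eqF a0) implybT.
        by rewrite ler_wpM2l ?powR_ge0// mono//; move: al12; lra.
      rewrite -[leLHS]add0r lerD ?powR_ge0// pE powRD; last by rewrite (gt_eqF b0) implybT.
      by rewrite ler_wpM2r ?powR_ge0// mono//; lra.
  rewrite integral_setD1; last 2 first.
  - by apply: measurableD => //; exact: measurable_ball.
  - exact: measurable_funTS.
  under eq_integral do rewrite EFinM.
  have mr c : measurable_fun (ball x r) (fun y : R => (`|y - c| `^ (- p))%:E).
    by apply/measurable_EFinP/measurable_funTS; exact: measurable_riesz.
  rewrite ge0_integralZl//; last 3 first.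
  - exact: measurable_ball.
  - by apply/measurable_EFinP/measurable_funTS/measurable_funD; exact: measurable_riesz.
  - by rewrite lee_fin ltW.
  rewrite EFinM lee_pmul2l//.
  under eq_integral do rewrite EFinD.
  rewrite ge0_integralD//; last 3 first.
  - exact: measurable_ball.
  - exact: mr.
  - exact: mr.
  rewrite EFinD; apply: leeD; first exact: integral_riesz_ball.
  under eq_integral do rewrite subr0.
  exact: integral_riesz_other_ball.
have cB : (B r)%:E @[r --> 0^'+] --> (0%:E : \bar R).
  have h : (fun r : R => r `^ (1 - p)) @ 0^'+ --> (0 : R) by exact: powR_cvg0.
  have h1 : (fun r : R => 2 * (r `^ (1 - p) / (1 - p))) @ 0^'+ --> 2 * (0 / (1 - p) : R).
    by apply: cvgMr; apply: cvgMl.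
  have hB : B @ 0^'+ --> C * (2 * (0 / (1 - p)) + (2 * (0 / (1 - p)) + 2 * 0)).
    by apply: cvgMr; apply: cvgD => //; apply: cvgD => //; apply: cvgMr.
  have E0 : C * (2 * (0 / (1 - p)) + (2 * (0 / (1 - p)) + 2 * 0)) = 0.
    by rewrite mul0r !mulr0 !addr0 mulr0.
  rewrite E0 in hB.
  by apply: cvg_EFin; [exact: nearW|exact: hB].
rewrite /finite_kato_class.
apply: (@squeeze_cvge _ _ _ _ (fun=> 0%E) _ (fun r => (B r)%:E)) => //.
  near=> r; apply/andP; split.
    apply: le_trans (ereal_sup_ubound _); last by exists 0.
    by apply: integral_ge0 => y _; exact: psi0.
  apply: ge_ereal_sup => _ [x _ <-]; apply: bound.
  by near: r; exact: nbhs_right_gt.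
exact: cvg_cst.
Unshelve. all: by end_near. Qed.

(** * Sign and size of the mollified drift *)

Section mollified_drift_bounds.
Variables (phi : R -> R) (hphi : mollifier phi).

Lemma mollifier_continuous : continuous phi.
Proof.
move=> x; apply/differentiable_continuous/derivable1_diffP.
by have := @mollifier_smooth _ _ hphi 0%N x; rewrite derive1n0.
Qed.

Lemma mollifier_out x : 1 < `|x| -> phi x = 0.
Proof.
move=> x1; apply/eqP; apply: contraLR x1 => px; rewrite -leNgt.
have : (`[-1, 1]%classic : set R) x.
  by rewrite -(mollifier_supp hphi); apply: subset_closure.
by rewrite /= in_itv/= ler_norml.
Qed.

Lemma mollifier_bounded : exists M, forall x, `|phi x| <= M.
Proof.
have [c _ hc] := @EVT_max R phi (-1) 1 ltac:(lra)
  (continuous_subspaceT mollifier_continuous).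
exists (phi c) => x; rewrite ger0_norm; last exact: (mollifier_ge0 hphi).
have [x1|x1] := leP `|x| 1; first by apply: hc; rewrite in_itv/= -ler_norml.
by rewrite mollifier_out// (mollifier_ge0 hphi).
Qed.

Lemma rescaled_ge0 n x : 0 <= rescaled phi n x.
Proof. by rewrite mulr_ge0 ?exprn_ge0// (mollifier_ge0 hphi). Qed.

Lemma bmeasurable_rescaled n : bmeasurable (rescaled phi n).
Proof.
apply: bmeasurableM; first exact: bmeasurable_cst.
have [M hM] := mollifier_bounded; split; last by exists M => x.
apply: measurableT_comp; last exact: measurable_funM.
by apply: continuous_measurable_fun; exact: mollifier_continuous.
Qed.

Lemma bmeasurable_rescaledB n (x : R) :
  bmeasurable (fun y : R => rescaled phi n (x - y)).
Proof.
have [mr [M hM]] := bmeasurable_rescaled n; split; last by exists M => y.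
by apply: (measurableT_comp mr); exact: measurable_funB.
Qed.

Lemma rescaled_out n x : 2 ^- n < `|x| -> rescaled phi n x = 0.
Proof.
move=> nx; rewrite /rescaled mollifier_out ?mulr0// normrM ger0_norm ?exprn_ge0//.
by rewrite mulrC -ltr_pdivrMr ?exprn_gt0// div1r.
Qed.

(** Evenness of [phi] turns [x - y] into [y - x], so that an increasing substitution applies. *)
Lemma integral_rescaled n x : (\int[leb]_y (rescaled phi n (x - y))%:E = 1)%E.
Proof.
rewrite -(mollifier_int hphi).
have c0 : 0 < 2 ^+ n :> R by rewrite exprn_gt0.
pose F (y : R) := 2 ^+ n * (y - x).
have dF (y : R) : is_derive y 1 F (2 ^+ n).
  by apply: is_derive_eq; rewrite /GRing.scale/= subr0 mulr1.
have F'E : derive1 F = (fun=> 2 ^+ n).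
  by apply/funext => y; rewrite derive1E; have [_ ->] := dF y.
rewrite (@increasing_ge0_integration_by_substitutionT _ F phi).
- apply: eq_integral => y _; rewrite /rescaled F'E /= /F.
  by rewrite -(mollifier_even hphi) -mulrN opprB mulrC.
- by move=> y z yz; rewrite /F ltr_pM2l// ltrD2r.
- by rewrite F'E; exact: cst_continuous.
- by rewrite F'E; exact: is_cvg_cst.
- by rewrite F'E; exact: is_cvg_cst.
- by move=> y; have [] := dF y.
- by apply: gt0_cvgMrNy => //; exact: cvg_addrr_Ny.
- by apply: gt0_cvgMry => //; exact: cvg_addrr.
- exact: mollifier_continuous.
- exact: (mollifier_ge0 hphi).
Qed.

Lemma mollified_driftE n x :
  mollified phi mu n x = \int[leb]_y (rescaled phi n (x - y) * sd y).
Proof.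
apply: charge_integral_drift; last by move=> y; exact: rescaled_ge0.
exact: bmeasurable_rescaledB.
Qed.

Let integrable_conv n x : leb.-integrable setT (EFin \o (fun y => rescaled phi n (x - y) * sd y)).
Proof.
have [mr [M hM]] := bmeasurable_rescaled n.
have M0 : 0 <= M by apply: le_trans (hM 0).
apply: (le_integrable measurableT _ _
    (integrableZl measurableT M (integrable_norm integrable_singular_drift))).
  apply/measurable_EFinP/measurable_funM; last exact: measurable_singular_drift.
  by apply: (measurableT_comp mr); exact: measurable_funB.
move=> y _ /=; rewrite lee_fin normrM [leRHS]ger0_norm ?mulr_ge0//.
by rewrite ler_pM.
Qed.

Lemma bmeasurable_mollified n : bmeasurable (mollified phi mu n).
Proof.
have [mr [M hM]] := bmeasurable_rescaled n.
have M0 : 0 <= M by apply: le_trans (hM 0).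
rewrite (funext (mollified_driftE n)).
(* The section lemma asks for a finite measure on the space of [x]; the uniform law is an arbitrary
   choice. *)
apply: (@bmeasurable_section1 _ _ _ _ R (uniform_prob (@ltr01 R)) leb
  (fun y => M * `|sd y|) (fun z => rescaled phi n (z.1 - z.2) * sd z.2)).
- by move=> y; rewrite mulr_ge0.
- exact: (integrableZl measurableT M (integrable_norm integrable_singular_drift)).
- apply: measurable_funM.
    by apply: (measurableT_comp mr); exact: measurable_funB.
  by apply: measurableT_comp => //; exact: measurable_singular_drift.
- by move=> x y /=; rewrite normrM ler_pM.
Qed.

(** At distance more than [2^-n] from [0] the mollification window around [x] does not reach [0]; as
    [y] is closer to [x] than [0] is, its modulus is at most [2 |x|]. *)
Let same_sign n x y : 2 ^- n < `|x| -> rescaled phi n (x - y) != 0 ->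
  Num.sg y = Num.sg x /\ 0 < `|y| <= 2 * `|x|.
Proof.
move=> nx; have [xy|xy] := leP `|x - y| (2 ^- n); last first.
  by rewrite rescaled_out ?eqxx.
move=> _; have xy' := le_lt_trans xy nx.
have y0 : 0 < `|y| by rewrite normr_gt0; apply: contraTneq xy' => ->; rewrite subr0 ltxx.
split; last first.
  rewrite y0/= mulr_natl mulr2n -{1}[y](subrK x) (le_trans (ler_normD _ _))// lerD2r.
  by rewrite distrC ltW.
have x0 : x != 0 by rewrite -normr_gt0 (le_lt_trans _ xy').
move: xy'; have [/[dup]h /ltr0_norm->|/[dup]h /gtr0_norm->|h] := ltgtP x 0; last by rewrite h eqxx in x0.
  rewrite ltr_norml => /andP[? ?]; rewrite (ltr0_sg h) ltr0_sg//; lra.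
rewrite ltr_norml => /andP[? ?]; rewrite (gtr0_sg h) gtr0_sg//; lra.
Qed.

Lemma mollified_drift_sgn n x : 2 ^- n < `|x| ->
  Num.sg x * mollified phi mu n x <= 0.
Proof.
move=> nx; rewrite mollified_driftE -RintegralZl//.
apply: (@le_trans _ _ (\int[leb]_(y in [set: R]) 0)); last by rewrite Rintegral_cst// mul0r.
apply: le_Rintegral => //.
  exact: (integrableZl measurableT (Num.sg x) (integrable_conv n x)).
  exact: integrable0.
move=> y _; rewrite -oppr_ge0.
have [->|/(same_sign nx)[sxy _]] := eqVneq (rescaled phi n (x - y)) 0.
  by rewrite mul0r !mulr0 oppr0.
have -> : - (Num.sg x * (rescaled phi n (x - y) * sd y)) =
    Num.sg x ^+ 2 * (rescaled phi n (x - y) * `|sd y|).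
  by rewrite {1}singular_drift_sgE sxy; ring.
by apply: mulr_ge0; [exact: sqr_ge0|apply: mulr_ge0 => //; exact: rescaled_ge0].
Qed.

(** An average over the window is at least the smallest modulus of the drift there, attained at the
    far end, no further than [2 |x|] from [0]. The condition [|x| <= 1 / 2] keeps the window inside
    the support [[-1, 1]]. *)
Lemma mollified_drift_le n x : 2 ^- n < `|x| -> `|x| <= 1 / 2 ->
  Num.sg x * mollified phi mu n x <= - (C * (2 * `|x|) `^ (1 - al)).
Proof.
move=> nx x2; rewrite mollified_driftE -RintegralZl//.
set K := C * _.
have ir : leb.-integrable setT (EFin \o (fun y => rescaled phi n (x - y))).
  apply/integrableP; split.
    apply/measurable_EFinP; apply: (measurableT_comp (bmeasurable_rescaled n).1).
    exact: measurable_funB.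
  under eq_integral do rewrite /= ger0_norm ?rescaled_ge0//.
  by rewrite integral_rescaled ltry.
have -> : - K = \int[leb]_y (- K * rescaled phi n (x - y)).
  by rewrite RintegralZl// [X in _ = _ * X]/Rintegral integral_rescaled/= mulr1.
have x0 : 0 < `|x| by rewrite (le_lt_trans _ nx)// invr_ge0 exprn_ge0.
apply: le_Rintegral => //.
- exact: (integrableZl measurableT (Num.sg x) (integrable_conv n x)).
- exact: (integrableZl measurableT (- K) ir).
- move=> y _; have [->|/(same_sign nx)[sxy /andP[y0 yx]]] := eqVneq (rescaled phi n (x - y)) 0.
    by rewrite mul0r !mulr0.
  rewrite mulrCA [leRHS]mulrC ler_wpM2l ?rescaled_ge0//.
  rewrite singular_drift_sgE sxy mulNr mulrN mulrA -expr2 sqr_sg.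
  rewrite -normr_gt0 x0 mul1r lerN2 singular_drift_norm ?y0/=; last by lra.
  rewrite /K ler_pM2l// -opprB !powRN lef_pV2 ?posrE ?powR_gt0 ?mulr_gt0//.
  have a0 : 0 <= al - 1 by move: al12; lra.
  have x20 : 0 <= 2 * `|x| by rewrite mulr_ge0.
  exact: (ge0_ler_powR a0 (ltW y0) x20 yx).
Qed.

End mollified_drift_bounds.
End drift.

(** * Adapted paths and independent increments *)

Section joint_measurability.
Context d (T : measurableType d) (R : realType).
Variables (t : R) (Y : R -> T -> R).
Hypothesis t0 : 0 <= t.
Hypothesis mY : forall s, 0 <= s <= t -> measurable_fun setT (Y s).
Hypothesis rY : forall w s, 0 <= s < t -> Y u w @[u --> s^'+] --> Y s w.

(** Folds all times into [[0, t]]: joint maps become defined on the whole line and sample [Y] only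
    at times where it is controlled. *)
Definition clamp (s : R) := Num.max 0 (Num.min s t).

Lemma clamp_itv s : 0 <= clamp s <= t.
Proof. by rewrite /clamp; rewrite le_max lexx/= ge_max t0/= ge_min lexx orbT. Qed.

Lemma clamp_id s : 0 <= s <= t -> clamp s = s.
Proof. by move=> /andP[s0 st]; rewrite /clamp (min_idPl st) (max_idPr s0). Qed.

Lemma measurable_clamp : measurable_fun setT clamp.
Proof. by apply: measurable_maxr => //; exact: measurable_minr. Qed.

(** The right end of a grid cell, capped at [t]: strictly above the approximated time when that time
    is below [t], as right-continuity requires, and never beyond [t], as adaptedness requires. *)
Definition grid_point (N k : nat) : R := Num.min t (k.+1%:R / N.+1%:R).
Local Notation up := grid_point.

Lemma grid_point_itv N k : 0 <= up N k <= t.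
Proof. by rewrite /grid_point le_min t0 divr_ge0//= ge_min lexx. Qed.

Definition grid_index (N : nat) (s : R) : nat := Num.truncn (clamp s * N.+1%:R).
Local Notation idx := grid_index.

Let measurable_idx N k : measurable [set s | idx N s = k].
Proof.
have -> : [set s | idx N s = k] =
    setT `&` (fun s => clamp s * N.+1%:R) @^-1` [set` `[k%:R, k.+1%:R[%R].
  apply/seteqP; split=> s /=; rewrite in_itv/=.
    by move=> <-; split => //; apply: truncn_itv; rewrite mulr_ge0//; case/andP: (clamp_itv s).
  by move=> [_ h]; exact/truncn_def.
have := measurable_clamp.
move=> mc; have : measurable_fun setT (fun s => clamp s * N.+1%:R) by exact: measurable_funM.
by apply.
Qed.

Lemma cvg_grid w s : Y (up N (idx N s)) w @[N --> \oo] --> Y (clamp s) w.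
Proof.
set s' := clamp s.
have /andP[s0] := clamp_itv s; rewrite -/s' le_eqVlt => /predU1P[st|st].
  have E N : up N (idx N s) = s'.
    rewrite /grid_point st; apply/min_idPl.
    rewrite ler_pdivlMr// -st /grid_index -/s' ltW//; exact: truncnS_gt.
  by under eq_fun do rewrite E; exact: cvg_cst.
have := @rY w s'; rewrite s0 st => /(_ isT)/cvg_at_rightP; apply; split.
  move=> N; rewrite /grid_point lt_min st/= ltr_pdivlMr//; exact: truncnS_gt.
apply/cvgrPdist_le => e e0; near=> N.
have h1 : s' < up N (idx N s).
  by rewrite /grid_point lt_min st/= ltr_pdivlMr//; exact: truncnS_gt.
rewrite distrC gtr0_norm ?subr_gt0// lerBlDl.
rewrite (@le_trans _ _ ((idx N s).+1%:R / N.+1%:R))//; first by rewrite /grid_point ge_min lexx orbT.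
rewrite ler_pdivrMr// mulrDl -natr1 lerD//.
  by rewrite /grid_index truncn_le// mulr_ge0.
rewrite -ler_pdivrMl// mulr1.
near: N; exists (Num.truncn e^-1) => // N /= hN.
by rewrite (le_trans (ltW (truncnS_gt _)))// ler_nat ltnS.
Unshelve. all: by end_near. Qed.

(** When [T] carries the sigma-algebra of the past up to time [t], this is progressive
    measurability. *)
Lemma measurable_joint : measurable_fun setT (fun z : T * R => Y (clamp z.2) z.1).
Proof.
apply: (@measurable_fun_cvg _ _ _ _ (fun N z => Y (up N (idx N z.2)) z.1)).
  move=> N _ B mB; rewrite setTI.
  have -> : (fun z : T * R => Y (up N (idx N z.2)) z.1) @^-1` B =
      \bigcup_k ((Y (up N k) @^-1` B) `*` [set s | idx N s = k]).
    apply/seteqP; split=> [z/= Bz|z [k _ [/= + E]]].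
      by exists (idx N z.2).
    by rewrite -E.
  apply: bigcup_measurable => k _; apply: measurableX => //.
  by rewrite -[X in measurable X]setTI; apply: mY => //; exact: grid_point_itv.
by move=> [w s] _ /=; exact: cvg_grid.
Qed.

End joint_measurability.

(** * Random variables independent of the past *)

Section independence.
Context d (Omega : measurableType d) (R : realType) (P : probability Omega R).
Variables (G : set (set Omega)) (hG : sigma_algebra setT G) (GP : G `<=` measurable).
Variables (D : {RV P >-> R}).
Hypothesis ind : forall (E : set Omega) (B : set R), G E -> measurable B ->
  P (E `&` D @^-1` B) = (P E * P (D @^-1` B))%E.

Local Notation OG := (g_sigma_algebraType G).

Lemma sub_sigma_measurable (E : set OG) : measurable E -> G E.
Proof. by rewrite /measurable/= sigma_algebra_id. Qed.

Lemma measurable_sub_sigma d' (T' : measurableType d') (f : OG -> T') :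
  measurable_fun setT f -> measurable_fun setT (f : Omega -> T').
Proof.
by move=> mf _ B mB; apply: GP; apply: sub_sigma_measurable; exact: mf.
Qed.

(** The whole past as one random element: the identity into [Omega] with the coarser
    sigma-algebra. *)
Let idG : Omega -> OG := id.
Let mid : measurable_fun setT idG.
Proof. by move=> _ B mB; rewrite setTI; apply: GP; exact: sub_sigma_measurable. Qed.

Let pairG (w : Omega) : OG * R := (idG w, D w).
Let mpair : measurable_fun setT pairG.
Proof. by apply: measurable_fun_pair. Qed.

(** The joint law of the past and [D] agrees with the product law on rectangles, hence everywhere;
    Fubini's theorem does the rest. *)
Lemma independent_integral (h : OG * R -> R) : bmeasurable h ->
  \int[P]_w h (w, D w) = \int[P]_w \int[distribution P D]_x h (w, x).
Proof.
move=> bh; have [mh [M hM]] := bh.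
pose idm : {RV P >-> OG} := HB.pack idG (isMeasurableFun.Build _ _ _ _ idG mid).
pose pairm : {RV P >-> (OG * R)%type} :=
  HB.pack pairG (isMeasurableFun.Build _ _ _ _ pairG mpair).
have push d' (T' : measurableType d') (X : {RV P >-> T'}) (f : T' -> R) :
    bmeasurable f -> \int[distribution P X]_y f y = \int[P]_w f (X w).
  move=> bf; congr fine.
  apply: integral_distribution.
    by apply/measurable_EFinP; case: bf.
  apply: bmeasurable_integrable; case: bf => mf [N fN].
  by split; [exact: measurableT_comp|exists N => w].
transitivity (\int[distribution P pairm]_z h z).
  by rewrite push.
transitivity (\int[(distribution P idm \x distribution P D)%E]_z h z).
  congr fine; apply: eq_measure_integral => A mA _.
  apply/esym; apply: product_measure_unique => // E B mE mB.
  by have := ind (sub_sigma_measurable mE) mB.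
rewrite -(@Rintegral_prod1 _ _ _ _ R (distribution P idm) (distribution P D) (fun=> M))//.
- rewrite (push _ _ idm (fun w => \int[distribution P D]_x h (w, x)))//.
  apply: (@bmeasurable_section1 _ _ _ _ R (distribution P idm) (distribution P D) (fun=> M)) => //.
  + by move=> _; apply: le_trans (hM point).
  + by apply: bmeasurable_integrable; exact: bmeasurable_cst.
- by move=> _; apply: le_trans (hM point).
- by apply: bmeasurable_integrable; exact: bmeasurable_cst.
Qed.

Variables (xi phi : R).
Hypotheses (Ecos : \int[P]_w cos (xi * D w) = phi) (Esin : \int[P]_w sin (xi * D w) = 0).

(** A bounded weight and a phase measurable with respect to the past only see
    the real characteristic function of the increment. *)
Lemma independent_phase (U V : OG -> R) : bmeasurable U ->
  measurable_fun setT V ->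
  \int[P]_w (U w * cos (V w + xi * D w)) = phi * \int[P]_w (U w * cos (V w)) /\
  \int[P]_w (U w * sin (V w + xi * D w)) = phi * \int[P]_w (U w * sin (V w)).
Proof.
move=> bU mV; have [mU [M UM]] := bU.
have mP (psi : R -> R) : measurable_fun setT psi -> (forall x, `|psi x| <= 1) ->
    bmeasurable (fun z : OG * R => U z.1 * psi (V z.1 + xi * z.2)).
  move=> mpsi psi1; apply: bmeasurableM.
    by split; [exact: measurableT_comp|exists M => z].
  split; last by exists 1 => z.
  apply: (measurableT_comp mpsi); apply: measurable_funD; first exact: measurableT_comp.
  exact: measurable_funM.
have bpsi (psi : R -> R) : measurable_fun setT psi -> (forall x, `|psi x| <= 1) ->
    bmeasurable (fun x => psi (xi * x)).
  move=> mpsi psi1; split; last by exists 1 => z.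
  by apply: (measurableT_comp mpsi); exact: measurable_funM.
have bV (psi : R -> R) : measurable_fun setT psi -> (forall x, `|psi x| <= 1) ->
    bmeasurable (fun w : Omega => U w * psi (V w)).
  move=> mpsi psi1; apply: bmeasurableM.
    by split; [exact: measurable_sub_sigma|exists M].
  split; last by exists 1 => w.
  by apply: (measurableT_comp mpsi); exact: measurable_sub_sigma.
have push (psi : R -> R) : measurable_fun setT psi -> (forall x, `|psi x| <= 1) ->
    \int[distribution P D]_x psi (xi * x) = \int[P]_w psi (xi * D w).
  move=> mpsi psi1; have [bm bb] := bpsi _ mpsi psi1.
  congr fine; apply: integral_distribution; first exact/measurable_EFinP.
  apply: (@bmeasurable_integrable _ _ _ P (fun w => psi (xi * D w))).
  by split; [exact: (measurableT_comp bm)|exists 1 => w].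
have bc := bpsi _ measurable_cos (@cos_max R).
have bs := bpsi _ measurable_sin (@sin_max R).
have bcst (c : R) := bmeasurable_cst R c.
split.
- rewrite (independent_integral (mP _ measurable_cos (@cos_max R))) /=.
  rewrite -bRintegralZl; last exact: (bV _ measurable_cos (@cos_max R)).
  apply: eq_Rintegral => w _.
  transitivity (\int[distribution P D]_x (U w * cos (V w) * cos (xi * x) - U w * sin (V w) * sin (xi * x))).
    by apply: eq_Rintegral => x _; rewrite cosD; ring.
  rewrite bRintegralB; [|exact: bmeasurableM|exact: bmeasurableM].
  rewrite !bRintegralZl//; rewrite push; [|exact: measurable_cos|exact: cos_max].
  rewrite push; [|exact: measurable_sin|exact: sin_max].
  by rewrite Ecos Esin mulr0 subr0 mulrC.
- rewrite (independent_integral (mP _ measurable_sin (@sin_max R))) /=.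
  rewrite -bRintegralZl; last exact: (bV _ measurable_sin (@sin_max R)).
  apply: eq_Rintegral => w _.
  transitivity (\int[distribution P D]_x (U w * sin (V w) * cos (xi * x) + U w * cos (V w) * sin (xi * x))).
    by apply: eq_Rintegral => x _; rewrite sinD; ring.
  rewrite bRintegralD; [|exact: bmeasurableM|exact: bmeasurableM].
  rewrite !bRintegralZl//; rewrite push; [|exact: measurable_cos|exact: cos_max].
  rewrite push; [|exact: measurable_sin|exact: sin_max].
  by rewrite Ecos Esin mulr0 addr0 mulrC.
Qed.

End independence.

(** * Chain rule for primitives of bounded measurable functions *)

Section primitive.
Context {R : realType}.
Local Notation leb := (@lebesgue_measure R).
Implicit Types (f D : R -> R).

(** Replaces the vanishing of a derivative for functions whose rates are only measurable: cutting
    [[0, T]] into [N + 1] equal steps bounds the total increment by [c T^2 / (N + 1)]. *)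
Lemma quadratic_increment_cst (E : R -> R) (c T : R) : 0 <= T ->
  (forall s t, 0 <= s -> s <= t -> t <= T -> `|E t - E s| <= c * (t - s) ^+ 2) ->
  E T = E 0.
Proof.
move=> T0 H.
have step N i : (i <= N.+1)%N ->
    `|E (i%:R * (T / N.+1%:R)) - E 0| <= i%:R * (c * (T / N.+1%:R) ^+ 2).
  set h := T / N.+1%:R; have h0 : 0 <= h by rewrite divr_ge0.
  elim: i => [_|i IH iN]; first by rewrite !mul0r subrr normr0.
  rewrite -(subrK (E (i%:R * h)) (E (i.+1%:R * h))) -addrA (le_trans (ler_normD _ _))//.
  rewrite -natr1 [leRHS]mulrDl mul1r [leRHS]addrC; apply: lerD; last exact/IH/ltnW.
  have -> : c * h ^+ 2 = c * ((i%:R + 1) * h - i%:R * h) ^+ 2 by ring.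
  apply: H; rewrite ?mulr_ge0//; first by rewrite ler_wpM2r// lerDl.
  by rewrite natr1 /h mulrCA ler_piMr// ler_pdivrMr// mul1r ler_nat.
apply/eqP; rewrite -subr_eq0 -normr_le0; apply/ler_addgt0Pr => e e0; rewrite add0r.
have [N] : exists N : nat, c * T ^+ 2 / e <= N.+1%:R.
  exists (Num.truncn (c * T ^+ 2 / e)); exact/ltW/truncnS_gt.
rewrite ler_pdivrMr// => hN.
have := step N N.+1 (leqnn _).
have N0 : N.+1%:R != 0 :> R by rewrite pnatr_eq0.
have -> : N.+1%:R * (T / N.+1%:R) = T by rewrite mulrC divfK.
move=> /le_trans; apply.
have -> : N.+1%:R * (c * (T / N.+1%:R) ^+ 2) = c * T ^+ 2 / N.+1%:R.
  by move: N0; move: (N.+1%:R : R) => n n0; field.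
by rewrite ler_pdivrMr ?ltr0n// [e * _]mulrC.
Qed.

Lemma bmeasurable_integrable_itv f (s t : R) : bmeasurable f ->
  leb.-integrable `[s, t] (EFin \o f).
Proof.
move=> [mf [M fM]].
apply: measurable_bounded_integrable => //.
- have := lebesgue_measure_itv (`[s, t] : interval R); rewrite /= => ->.
  by case: ifP => _; rewrite ?ltry// -EFinD ltry.
- exact: measurable_funTS.
- exists M; split; first exact: num_real.
  by move=> x Mx y _ /=; rewrite (le_trans (fM y))// ltW.
Qed.

Lemma Rintegral_itv_chasles f (r s t : R) : bmeasurable f ->
  r <= s -> s <= t ->
  \int[leb]_(u in `[r, t]) f u =
  \int[leb]_(u in `[r, s]) f u + \int[leb]_(u in `[s, t]) f u.
Proof.
move=> bf rs st.
have := @Rintegral_itvB R f (BLeft r) (BRight t) s.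
rewrite !bnd_simp => /(_ (bmeasurable_integrable_itv r t bf) rs st).
rewrite Rintegral_itv_obnd_cbnd; last first.
  apply: (integrableS _ _ _ (bmeasurable_integrable_itv s t bf)) => //.
  exact: subset_itv_oc_cc.
by move=> <-; rewrite addrC subrK.
Qed.

Lemma lebesgue_measure_itvcc (s t : R) : s <= t -> leb `[s, t] = (t - s)%:E.
Proof.
have := lebesgue_measure_itv (`[s, t] : interval R); rewrite /= => ->.
by rewrite lte_fin le_eqVlt => /predU1P[->|->]; rewrite ?ltxx ?subrr ?EFinD.
Qed.

Lemma le_norm_Rintegral_itv f (M s t : R) : bmeasurable f -> s <= t ->
  (forall u, s <= u <= t -> `|f u| <= M) -> `|\int[leb]_(u in `[s, t]) f u| <= M * (t - s).
Proof.
move=> bf st fM.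
have If := bmeasurable_integrable_itv s t bf.
apply: (le_trans (le_normr_Rintegral _ If)) => //.
have <- : \int[leb]_(u in `[s, t]) (M : R) = M * (t - s).
  rewrite Rintegral_cst//; congr (_ * _).
  by rewrite [X in fine X](lebesgue_measure_itvcc st).
apply: le_Rintegral => //; first exact: integrable_norm.
  by apply: bmeasurable_integrable_itv; exact: bmeasurable_cst.
Qed.

Lemma expRN_taylor (x : R) : 0 <= x -> `|expR (- x) - 1 + x| <= x ^+ 2.
Proof.
move=> x0; have h1 := expR_ge1Dx (- x); have h2 := expR_ge1Dx x.
rewrite ger0_norm; last by lra.
have e0 := expR_gt0 (- x).
have e1 : expR (- x) * expR x = 1 by rewrite -expRD addNr expR0.
have h3 : expR (- x) * (1 + x) <= expR (- x) * expR x by apply: ler_wpM2l => //; exact: ltW.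
by rewrite e1 in h3; move: (expR (- x)) h1 e0 h3 => a *; nra.
Qed.

(** Reflecting both variables reduces to [y > 0]; the mean value theorem then gives
    [y (sin x - sin (x + z))] with [0 < z < y]. *)
Lemma cosD_taylor (x y : R) : `|cos (x + y) - cos x + y * sin x| <= y ^+ 2.
Proof.
wlog y0 : x y / 0 < y.
  move=> H; case: (ltgtP 0 y) => [h|h|<-]; first exact: H.
    have := H (- x) (- y); rewrite oppr_gt0 -opprD !cosN sinN sqrrN mulrNN; exact.
  by rewrite addr0 mul0r subrr addr0 normr0 sqr_ge0.
pose f z := cos (x + z) + z * sin x.
have df (z : R) : is_derive z 1 f (- sin (x + z) + sin x).
  rewrite /f; apply: is_derive_eq; rewrite /GRing.scale/=; ring.
have [|z] := @MVT _ f (fun z => - sin (x + z) + sin x) 0 y y0.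
  apply: derivable_within_continuous => z _; exact: ex_derive.
rewrite in_itv/= => /andP[z0 zy].
rewrite /f addr0 mul0r addr0 subr0 => E.
have -> : cos (x + y) - cos x + y * sin x = cos (x + y) + y * sin x - cos x by ring.
rewrite E normrM (gtr0_norm y0) expr2 ler_wpM2r ?(ltW y0)//.
rewrite addrC (le_trans (sin_lipschitz _ _))// opprD addrA subrr add0r normrN.
by rewrite (gtr0_norm z0) ltW.
Qed.

Lemma expRN_lipschitz (x y : R) : 0 <= x -> 0 <= y -> `|expR (- x) - expR (- y)| <= `|x - y|.
Proof.
wlog xy : x y / x <= y.
  move=> H x0 y0; case: (leP x y) => [h|/ltW h]; first exact: H.
  by rewrite distrC (distrC x); exact: H.
move=> x0 y0.
have h : expR (- y) <= expR (- x) by rewrite ler_expR lerN2.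
rewrite ger0_norm ?subr_ge0// distrC ger0_norm ?subr_ge0//.
have := expR_ge1Dx (- (y - x)).
have -> : expR (- y) = expR (- x) * expR (- (y - x)) by rewrite -expRD; congr expR; ring.
have := expR_gt0 (- x).
have : expR (- x) <= 1 by rewrite -expR0 ler_expR oppr_le0.
by move: (expR (- x)) (expR (- (y - x))) => a b; nra.
Qed.

(** First-order expansion in both variables. The factor [3] counts the errors of the exponential, of
    the cosine and of their cross term, each at most [L^2]. *)
Lemma damped_oscillation_taylor (w w' x et L : R) : 0 <= w -> w <= w' ->
  w' - w <= L -> `|et| <= L ->
  `|expR (- w') * cos (x + et) - expR (- w) * cos x
    - (- (w' - w) * (expR (- w) * cos x) - et * (expR (- w) * sin x))| <= 3 * L ^+ 2.
Proof.
move=> w0 ww'; set de := w' - w => deL etL.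
have de0 : 0 <= de by rewrite subr_ge0.
have ew1 : `|expR (- w)| <= 1.
  by rewrite ger0_norm ?expR_ge0// -expR0 ler_expR oppr_le0.
have -> : expR (- w') = expR (- w) * expR (- de).
  by rewrite -expRD; congr expR; rewrite /de; ring.
have L0 : 0 <= L by apply: le_trans deL.
have h1 := expRN_taylor de0.
have h2 := cosD_taylor x et.
have h3 : `|cos (x + et) - cos x| <= L.
  by rewrite (le_trans (cos_lipschitz _ _))// addrC addKr.
have de2 : de ^+ 2 <= L ^+ 2 by rewrite lerXn2r// nnegrE.
have et2 : et ^+ 2 <= L ^+ 2 by rewrite -real_normK ?num_real// lerXn2r// nnegrE.
have k1 : `|(expR (- de) - 1 + de) * cos (x + et)| <= L ^+ 2.
  by rewrite normrM (le_trans (ler_piMr _ (cos_max _)))// (le_trans h1).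
have k3 : `|de * (cos (x + et) - cos x)| <= L ^+ 2.
  by rewrite normrM (ger0_norm de0) expr2 ler_pM.
have k2 := le_trans h2 et2.
move: (expR (- w)) ew1 (expR (- de)) (cos (x + et)) (cos x) (sin x) k1 k2 k3
  => e e1 f c' c s k1 k2 k3.
have -> : e * f * c' - e * c - (- de * (e * c) - et * (e * s)) =
   e * ((f - 1 + de) * c' + (c' - c + et * s) - de * (c' - c)) by ring.
rewrite normrM (le_trans (ler_piMl _ e1))//.
rewrite (le_trans (ler_normB _ _))// (le_trans (lerD (ler_normD _ _) (lexx _)))//; lra.
Qed.

Lemma damped_oscillation_lipschitz (psi : R -> R) (w w' x x' K N : R) :
  (forall x, `|psi x| <= 1) -> (forall x y, `|psi x - psi y| <= `|x - y|) ->
  0 <= w -> 0 <= w' -> `|w' - w| <= K -> `|x' - x| <= N ->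
  `|expR (- w') * psi x' - expR (- w) * psi x| <= K + N.
Proof.
move=> psi1 psiL w0 w'0 wK xN.
have ew1 : `|expR (- w)| <= 1.
  by rewrite ger0_norm ?expR_ge0// -expR0 ler_expR oppr_le0.
have hL := expRN_lipschitz w'0 w0.
have hp := psiL x' x; have h1 := psi1 x'.
move: (expR (- w)) ew1 (expR (- w')) hL (psi x) (psi x') hp h1 => e e1 e' hL c c' hp h1.
rewrite (_ : _ - _ = (e' - e) * c' + e * (c' - c)); last by ring.
rewrite (le_trans (ler_normD _ _))// lerD//.
  by rewrite normrM (le_trans (ler_piMr _ h1))// (le_trans hL).
by rewrite normrM (le_trans (ler_piMl _ e1))// (le_trans hp).
Qed.

Section damped_oscillation.
Variables (p a W A : R -> R) (bp : bmeasurable p) (ba : bmeasurable a).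
Variable (T xi th : R).
Hypothesis p0 : forall s, 0 <= p s.
Hypotheses (mW : measurable_fun setT W) (mA : measurable_fun setT A).
Hypotheses (W0 : W 0 = 0) (A0 : A 0 = 0) (W_ge0 : forall t, 0 <= W t).
Hypothesis WE : forall s t, 0 <= s -> s <= t -> t <= T ->
  W t - W s = \int[leb]_(u in `[s, t]) p u.
Hypothesis AE : forall s t, 0 <= s -> s <= t -> t <= T ->
  A t - A s = \int[leb]_(u in `[s, t]) a u.

Definition damped (psi : R -> R) t := expR (- W t) * psi (xi * A t + th).
Definition ddamped t := - p t * damped cos t - xi * a t * damped sin t.

Lemma bmeasurable_damped (psi : R -> R) : measurable_fun setT psi ->
  (forall x, `|psi x| <= 1) -> bmeasurable (damped psi).
Proof.
move=> mpsi psi1; apply: bmeasurableM; last first.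
  split; last by exists 1.
  by apply: (measurableT_comp mpsi); apply: measurable_funD => //; exact: measurable_funM.
split.
  by apply: measurableT_comp; [exact: measurable_expR|exact: measurableT_comp].
by exists 1 => t; rewrite ger0_norm ?expR_ge0// -expR0 ler_expR oppr_le0.
Qed.

Lemma bmeasurable_ddamped : bmeasurable ddamped.
Proof.
have bc := bmeasurable_damped measurable_cos (@cos_max R).
have bs := bmeasurable_damped measurable_sin (@sin_max R).
apply: bmeasurableB; apply: bmeasurableM => //.
  exact: bmeasurableN.
by apply: bmeasurableM => //; exact: bmeasurable_cst.
Qed.

(** [W] and [A] need not be differentiable at a given time. On [[s, t]] the rate is compared with
    the one in which the damped oscillation is frozen at time [s]; the error is quadratic in
    [t - s], and [quadratic_increment_cst] concludes. *)
Lemma damped_FTC : 0 <= T ->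
  damped cos T = cos th + \int[leb]_(u in `[0, T]) ddamped u.
Proof.
move=> T0; have [_ [M pM]] := bp; have [_ [N aN]] := ba.
have M0 : 0 <= M := le_trans (normr_ge0 _) (pM 0).
have N0 : 0 <= N := le_trans (normr_ge0 _) (aN 0).
set K := M + `|xi| * N.
have K0 : 0 <= K by rewrite addr_ge0// mulr_ge0.
pose E t := damped cos t - \int[leb]_(u in `[0, t]) ddamped u.
have WL s t : 0 <= s -> s <= t -> t <= T -> `|W t - W s| <= M * (t - s).
  by move=> s0 st tT; rewrite WE//; exact: le_norm_Rintegral_itv.
have AL s t : 0 <= s -> s <= t -> t <= T -> `|xi * A t + th - (xi * A s + th)| <= `|xi| * N * (t - s).
  move=> s0 st tT; rewrite opprD addrACA subrr addr0 -mulrBr normrM -mulrA ler_wpM2l//.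
  by rewrite AE//; exact: le_norm_Rintegral_itv.
have osc (psi : R -> R) s t : 0 <= s -> s <= t -> t <= T -> (forall x, `|psi x| <= 1) ->
    (forall x y, `|psi x - psi y| <= `|x - y|) ->
    `|damped psi t - damped psi s| <= K * (t - s).
  move=> s0 st tT psi1 psiL; rewrite /K mulrDl.
  by apply: damped_oscillation_lipschitz => //; [exact: WL|exact: AL].
suff : E T = E 0.
  have -> : E 0 = cos th.
    by rewrite /E /damped W0 A0 set_itv1 Rintegral_set1 oppr0 expR0 mulr0 add0r mul1r addr0.
  by move=> <-; rewrite subrK.
apply: (@quadratic_increment_cst _ (4 * K ^+ 2)) => // s t s0 st tT.
have bd := bmeasurable_ddamped.
pose G u := - p u * damped cos s - xi * a u * damped sin s.
have bG : bmeasurable G.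
  apply: bmeasurableB; apply: bmeasurableM; try exact: bmeasurable_cst.
    exact: bmeasurableN.
  by apply: bmeasurableM => //; exact: bmeasurable_cst.
have IG : \int[leb]_(u in `[s, t]) G u =
    - (W t - W s) * damped cos s - (xi * A t + th - (xi * A s + th)) * damped sin s.
  have Ip := bmeasurable_integrable_itv s t bp.
  have Ia := bmeasurable_integrable_itv s t ba.
  have -> : xi * A t + th - (xi * A s + th) = xi * (A t - A s) by ring.
  rewrite WE// AE//.
  transitivity (\int[leb]_(u in `[s, t]) (- damped cos s * p u - xi * damped sin s * a u)).
    by apply: eq_Rintegral => u _; rewrite /G; ring.
  rewrite RintegralB//; last 2 first.
  - exact: (integrableZl _ (- damped cos s) Ip).
  - exact: (integrableZl _ (xi * damped sin s) Ia).
  rewrite !RintegralZl//.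
  move: (\int[leb]_(u in _) p u) (\int[leb]_(u in _) a u) => x y; ring.
have -> : E t - E s = (damped cos t - damped cos s - \int[leb]_(u in `[s, t]) G u) +
    \int[leb]_(u in `[s, t]) (G u - ddamped u).
  have -> : \int[leb]_(u in `[s, t]) (G u - ddamped u) =
      \int[leb]_(u in `[s, t]) G u - \int[leb]_(u in `[s, t]) ddamped u.
    by apply: RintegralB => //; exact: bmeasurable_integrable_itv.
  rewrite /E (Rintegral_itv_chasles bd s0 st).
  move: (\int[leb]_(u in `[0, s]) ddamped u) (\int[leb]_(u in `[s, t]) ddamped u)
    (\int[leb]_(u in `[s, t]) G u) => x y z; ring.
rewrite (le_trans (ler_normD _ _))//.
have -> : 4 * K ^+ 2 * (t - s) ^+ 2 = 3 * (K * (t - s)) ^+ 2 + K * (K * (t - s)) * (t - s) by ring.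
apply: lerD; last first.
  apply: le_norm_Rintegral_itv => //; first exact: bmeasurableB.
  move=> u /andP[su ut].
  have -> : G u - ddamped u = p u * (damped cos u - damped cos s) +
     xi * a u * (damped sin u - damped sin s).
    by rewrite /G /ddamped; ring.
  have uT := le_trans ut tT.
  have h1 := osc _ _ _ s0 su uT (@cos_max R) cos_lipschitz.
  have h2 := osc _ _ _ s0 su uT (@sin_max R) sin_lipschitz.
  have h3 : K * (u - s) <= K * (t - s) by rewrite ler_wpM2l// lerD2r.
  rewrite (le_trans (ler_normD _ _))// mulrDl lerD//.
    by rewrite normrM ler_pM// (le_trans h1).
  by rewrite normrM ler_pM// ?(le_trans h2)// normrM ler_wpM2l.
rewrite IG.
have -> : damped cos t = expR (- W t) * cos (xi * A s + th + (xi * A t + th - (xi * A s + th))).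
  by congr (_ * cos _); ring.
apply: damped_oscillation_taylor => //.
- by rewrite -subr_ge0 WE//; exact: Rintegral_ge0.
- rewrite (le_trans (ler_norm _))// (le_trans (WL _ _ s0 st tT))// ler_wpM2r ?subr_ge0//.
  by rewrite /K lerDl mulr_ge0.
- rewrite (le_trans (AL _ _ s0 st tT))// ler_wpM2r ?subr_ge0//.
  by rewrite /K lerDr.
Qed.

End damped_oscillation.
End primitive.

(** * Exchange of expectation and frequency integral *)

Section transform_exchange.
Context d (T : measurableType d) (R : realType) (m1 : {finite_measure set T -> \bar R}).
Local Notation leb := (@lebesgue_measure R).
Variables (u psi : R -> R) (U V : T -> R).
Hypotheses (du : exp_dominated u) (mpsi : measurable_fun setT psi).
Hypothesis psi1 : forall x, `|psi x| <= 1.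
Hypotheses (bU : bmeasurable U) (mV : measurable_fun setT V).

Let h (z : T * R) := U z.1 * (u z.2 * psi (z.2 * V z.1)).

Let mh : measurable_fun setT h.
Proof.
have [mU _] := bU; have [mu _] := du.
apply: measurable_funM; first exact: measurableT_comp.
apply: measurable_funM; first exact: measurableT_comp.
by apply: (measurableT_comp mpsi); apply: measurable_funM => //; exact: measurableT_comp.
Qed.

Let h_dominated : exists2 k : R -> R, (forall t, 0 <= k t) &
  leb.-integrable setT (EFin \o k) /\ (forall x t, `|h (x, t)| <= k t).
Proof.
have [_ [M UM]] := bU; exists (fun t => M * `|u t|) => [t|].
  by rewrite mulr_ge0// (le_trans (normr_ge0 _) (UM point)).
split; last by move=> x t; rewrite /h/= !normrM ler_pM// ler_piMr.
exact: (integrableZl measurableT M (integrable_norm (exp_dominated_integrable du))).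
Qed.

Let transform_section t : u t * \int[m1]_x (U x * psi (t * V x)) = \int[m1]_x h (x, t).
Proof.
rewrite -bRintegralZl; first by apply: eq_Rintegral => x _; rewrite /h/=; ring.
apply: bmeasurableM => //; split; last by exists 1 => x.
by apply: (measurableT_comp mpsi); exact: measurable_funM.
Qed.

Lemma transform_exchange :
  \int[m1]_x (U x * \int[leb]_t (u t * psi (t * V x))) =
  \int[leb]_t (u t * \int[m1]_x (U x * psi (t * V x))).
Proof.
have [k k0 [ik hk]] := h_dominated.
under [RHS]eq_Rintegral do rewrite transform_section.
rewrite -(@Rintegral_exchange _ _ T (measurableTypeR R) R m1 leb k h k0 ik mh hk).
apply: eq_Rintegral => x _; rewrite /h/= RintegralZl//.
apply: exp_dominated_integrable; apply: exp_dominatedM => //.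
exact: bmeasurable_psi.
Qed.

Lemma transform_integrable :
  leb.-integrable setT (EFin \o (fun t => u t * \int[m1]_x (U x * psi (t * V x)))).
Proof.
have [k k0 [ik hk]] := h_dominated.
have ms := @measurable_section2 _ _ T (measurableTypeR R) R m1 leb k h k0 ik mh hk.
under eq_fun do rewrite transform_section.
have ik2 := integrableZl measurableT (fine (m1 setT)) ik.
apply: (le_integrable measurableT _ _ ik2); first exact/measurable_EFinP.
move=> t _ /=; rewrite lee_fin.
have bh : bmeasurable (fun x => h (x, t)) by split; [exact: measurableT_comp|exists (k t)].
rewrite (le_trans (le_normr_Rintegral _ (bmeasurable_integrable m1 bh)))//.
rewrite [leRHS]ger0_norm; last by rewrite mulr_ge0// fine_ge0.
rewrite [leRHS](_ : _ = \int[m1]_x (k t)); last by rewrite Rintegral_cst// mulrC.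
apply: le_bRintegral; first exact: bmeasurable_norm.
  exact: bmeasurable_cst.
by move=> x; exact: hk.
Qed.

End transform_exchange.

Section uniform_time.
Context {R : realType}.
Local Notation leb := (@lebesgue_measure R).

Definition unit_time : probability (measurableTypeR R) R := uniform_prob (@ltr01 R).

Lemma Rintegral_unit_time (f : R -> R) : bmeasurable f ->
  \int[unit_time]_s f s = \int[leb]_(s in `[0, 1]) f s.
Proof.
move=> bf; have [mf [M fM]] := bf.
have ge0_case (g : R -> R) : bmeasurable g -> (forall s, 0 <= g s) ->
    \int[unit_time]_s g s = \int[leb]_(s in `[0, 1]) g s.
  move=> [mg _] g0; congr fine; rewrite integral_uniform//.
    by rewrite subr0 invr1 mul1e.
  exact/measurable_EFinP.
(* The formula for the uniform law concerns nonnegative functions; adding the bound [M] reduces to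
   that case. *)
have M0 s : 0 <= f s + M by have := fM s; rewrite ler_norml => /andP[]; lra.
have bfM : bmeasurable (fun s => f s + M).
  by apply: bmeasurableD => //; exact: bmeasurable_cst.
have := ge0_case _ bfM M0.
rewrite bRintegralD//; last exact: bmeasurable_cst.
rewrite RintegralD//; last 2 first.
- exact: bmeasurable_integrable_itv.
- by apply: bmeasurable_integrable_itv; exact: bmeasurable_cst.
rewrite (ge0_case (fun=> M)); [exact: addIr|exact: bmeasurable_cst|].
by move=> _; apply: le_trans (fM 0).
Qed.

End uniform_time.

Section adapted_integrals.
Context d (T : measurableType d) (R : realType).
Local Notation leb := (@lebesgue_measure R).
Variables (t : R) (Y : R -> T -> R) (f : R -> R).
Hypothesis t0 : 0 <= t.
Hypothesis mY : forall s, 0 <= s <= t -> measurable_fun setT (Y s).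
Hypothesis rY : forall w s, 0 <= s < t -> Y u w @[u --> s^'+] --> Y s w.
Hypothesis bf : bmeasurable f.

Lemma bmeasurable_joint :
  bmeasurable (fun z : T * R => f (Y (clamp t z.2) z.1)).
Proof. by apply: (bmeasurable_comp bf); exact: measurable_joint. Qed.

Lemma bmeasurable_path w :
  bmeasurable (fun s => f (Y (clamp t s) w)).
Proof.
have [m [M fM]] := bmeasurable_joint.
split; last by exists M => s; exact: (fM (w, s)).
have := measurableT_comp m (pair1_measurable w); exact.
Qed.

Lemma Rintegral_clamp w s : 0 <= s <= t ->
  \int[leb]_(u in `[0, s]) f (Y u w) = \int[leb]_(u in `[0, s]) f (Y (clamp t u) w).
Proof.
move=> /andP[s0 st]; apply: eq_Rintegral => u /set_mem/=; rewrite in_itv/= => /andP[u0 us].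
by rewrite clamp_id// u0 (le_trans us).
Qed.

Lemma measurable_path_integral : bmeasurable (fun w => \int[leb]_(u in `[0, t]) f (Y u w)).
Proof.
have [m [M fM]] := bmeasurable_joint.
have M0 : 0 <= M := le_trans (normr_ge0 _) (fM (point, 0)).
(* A Dirac mass serves as an arbitrary finite measure on [T], which may carry any sigma-algebra
   here. *)
have := @bmeasurable_section1 _ _ _ _ R (@dirac _ T point R) leb
  (fun u => M * \1_(`[0, t] : set R) u)
  (fun z => f (Y (clamp t z.2) z.1) * \1_(`[0, t] : set R) z.2).
have -> : (fun w => \int[leb]_(u in `[0, t]) f (Y u w)) =
    (fun w => \int[leb]_u (f (Y (clamp t u) w) * \1_(`[0, t] : set R) u)).
  apply/funext => w; rewrite Rintegral_clamp ?t0 ?lexx//.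
  by rewrite Rintegral_mkcond mulr_indic_restrict.
apply.
- by move=> u; rewrite mulr_ge0.
- exact: (integrableZl measurableT M (integrable_indic_itv 0 t true false)).
- apply: measurable_funM => //.
  have mi : measurable_fun setT (\1_(`[0, t]%classic : set R) : R -> R) by exact: measurable_indic.
  exact: (measurableT_comp mi measurable_snd).
- move=> w u /=; rewrite normrM (ger0_norm (_ : 0 <= \1__ u))// ler_wpM2r//.
  exact: (fM (w, u)).
Qed.

End adapted_integrals.

(** * Drift functionals along the path of the solution *)

Section dynkin.
Context d (Omega : measurableType d) (R : realType) (P : probability Omega R).
Local Notation leb := (@lebesgue_measure R).
Variables (F : R -> set (set Omega)) (X L : R -> {RV P >-> R}) (al : R).
Hypotheses (hF : filtration F) (aX : adapted F X) (cX : cadlag_process X).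
Hypotheses (al12 : 1 < al < 2) (stL : symmetric_stable al F L).
Variables (m : R -> R) (bm : bmeasurable m) (kap : R) (kap0 : 0 <= kap).

Definition drift_path (f : R -> R) (t : R) (w : Omega) : R :=
  \int[leb]_(u in `[0, t]) f (X u w).

Local Notation nm := (fun x => `|m x|).
Local Notation A := (drift_path m).
Local Notation Aq := (drift_path nm).

Let bnm : bmeasurable nm. Proof. exact: bmeasurable_norm. Qed.

Lemma adapted_measurable (Y : R -> {RV P >-> R}) t : adapted F Y -> 0 <= t ->
  forall s, 0 <= s <= t ->
  @measurable_fun _ _ (g_sigma_algebraType (F t)) R setT (Y s).
Proof.
move=> aY t0 s /andP[s0 st] _ B mB; rewrite setTI.
rewrite /measurable/= sigma_algebra_id; last exact: (filtration_sigma hF).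
apply: (filtration_mono hF s0 st); apply: (aY s s0).
by exists B => //; rewrite setTI.
Qed.

Lemma cadlag_right (Y : R -> {RV P >-> R}) (t : R) : cadlag_process Y ->
  forall w s, 0 <= s < t -> Y u w @[u --> s^'+] --> Y s w.
Proof. by move=> cY w s /andP[s0 _]; have [+ _] := cY w; exact. Qed.

Lemma measurable_drift_path f t : bmeasurable f -> 0 <= t ->
  @bmeasurable _ (g_sigma_algebraType (F t)) R (drift_path f t).
Proof.
move=> bf t0; apply: (@measurable_path_integral _ (g_sigma_algebraType (F t)) R t X f) => //.
  exact: adapted_measurable.
exact: cadlag_right.
Qed.

Lemma measurable_drift_path_ambient f t : bmeasurable f -> 0 <= t ->
  bmeasurable (drift_path f t).
Proof.
move=> bf t0; apply: measurable_path_integral => //.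
exact: cadlag_right.
Qed.

Let mpath (f : R -> R) w : bmeasurable f ->
  bmeasurable (fun s : R => f (X (clamp 1 s) w)).
Proof.
move=> bf; apply: (@bmeasurable_path _ Omega R 1 X f) => //.
exact: cadlag_right.
Qed.

Lemma drift_path_increment f w s t : bmeasurable f ->
  0 <= s -> s <= t -> t <= 1 ->
  drift_path f t w - drift_path f s w = \int[leb]_(u in `[s, t]) f (X (clamp 1 u) w).
Proof.
move=> bf s0 st t1; rewrite /drift_path.
rewrite !(@Rintegral_clamp _ _ R 1 X f) ?s0 ?(le_trans st)// ?(le_trans s0)//.
by rewrite (Rintegral_itv_chasles (mpath w bf) s0 st) addrC addKr.
Qed.

Lemma drift_path0 f w : drift_path f 0 w = 0.
Proof. by rewrite /drift_path set_itv1 Rintegral_set1. Qed.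

Lemma drift_path_right f : bmeasurable f ->
  forall w s, 0 <= s < 1 -> drift_path f u w @[u --> s^'+] --> drift_path f s w.
Proof.
move=> bf w s /andP[s0 s1]; have [_ [M fM]] := bf.
have M0 : 0 <= M := le_trans (normr_ge0 _) (fM 0).
have M10 : 0 < M + 1 by rewrite ltr_wpDl.
apply/cvgrPdist_le => e e0; near=> t.
have st : s < t by near: t; exact: nbhs_right_gt.
rewrite distrC drift_path_increment// ?(ltW st)//; last first.
  by apply: ltW; near: t; exact: nbhs_right_lt.
rewrite (le_trans (le_norm_Rintegral_itv (mpath w bf) (ltW st) (fun u _ => fM _)))//.
rewrite (@le_trans _ _ ((M + 1) * (t - s)))//.
  by rewrite ler_wpM2r ?subr_ge0 ?(ltW st)// lerDl.
rewrite mulrC -ler_pdivlMr// lerBlDl ltW//.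
near: t; apply: nbhs_right_lt; rewrite ltrDl divr_gt0//.
Unshelve. all: by end_near. Qed.

(** A process as a function on space-time. Time is clamped to [[0, 1]], outside of which
    [space_time] has no mass. *)
Definition joint (Y : R -> Omega -> R) (z : Omega * R) : R := Y (clamp 1 z.2) z.1.

Lemma measurable_joint_drift f : bmeasurable f ->
  measurable_fun setT (joint (drift_path f)).
Proof.
move=> bf; apply: measurable_joint => //.
  by move=> s /andP[s0 _]; have [] := measurable_drift_path_ambient bf s0.
exact: drift_path_right.
Qed.

Lemma measurable_joint_process (Y : R -> {RV P >-> R}) : cadlag_process Y ->
  measurable_fun setT (joint Y).
Proof.
by move=> cY; apply: measurable_joint => //; exact: cadlag_right.
Qed.

Definition approx_process t w : R := L t w + A t w.
Definition drift_weight t w : R := expR (- (kap * t + Aq t w)).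

Local Notation Z := approx_process.
Local Notation wt := drift_weight.

Lemma drift_path_norm_ge0 t w : 0 <= Aq t w.
Proof. exact: Rintegral_ge0. Qed.

Lemma drift_weight_itv t w : 0 <= t -> 0 <= wt t w <= 1.
Proof.
move=> t0; rewrite expR_ge0 -expR0 ler_expR oppr_le0.
by rewrite addr_ge0 ?mulr_ge0 ?drift_path_norm_ge0.
Qed.

Lemma measurable_joint_approx : measurable_fun setT (joint Z).
Proof.
apply: measurable_funD; last exact: measurable_joint_drift.
by apply: measurable_joint_process; case: stL => -[].
Qed.

Lemma bmeasurable_joint_weight : bmeasurable (joint wt).
Proof.
split; last first.
  exists 1 => z; have /andP[? ?] := @drift_weight_itv (clamp 1 z.2) z.1 (proj1 (andP (clamp_itv ler01 z.2))).
  by rewrite ger0_norm.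
apply: measurableT_comp; first exact: measurable_expR.
apply: measurableT_comp => //; apply: measurable_funD; last exact: measurable_joint_drift.
apply: measurable_funM => //; apply: measurableT_comp; last exact: measurable_snd.
exact: measurable_clamp.
Qed.

Lemma bmeasurable_joint_rate f : bmeasurable f ->
  bmeasurable (joint (fun s w => f (X s w))).
Proof.
move=> bf; apply: (@bmeasurable_joint _ _ R 1 X f) => //.
exact: cadlag_right.
Qed.

End dynkin.

(** * Dynkin's formula *)

Section stable_increments.
Context d (Omega : measurableType d) (R : realType) (P : probability Omega R).
Variables (F : R -> set (set Omega)) (L : R -> {RV P >-> R}) (al : R).
Hypotheses (hF : filtration F) (stL : symmetric_stable al F L).

Lemma stable_char t xi : 0 <= t ->
  \int[P]_w cos (xi * L t w) = expR (- (t * `|xi| `^ al)) /\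
  \int[P]_w sin (xi * L t w) = 0.
Proof.
move=> t0; have [_ charL] := stL; have E := charL t xi t0.
by split; [exact: (congr1 (@complex.Re R) E)|exact: (congr1 (@complex.Im R) E)].
Qed.

Lemma stable_increment_char s t xi : 0 <= s -> s <= t ->
  \int[P]_w cos (xi * (L t w - L s w)) = expR (- ((t - s) * `|xi| `^ al)) /\
  \int[P]_w sin (xi * (L t w - L s w)) = 0.
Proof.
move=> s0 st; have [levL _] := stL.
pose D : {RV P >-> R} := (L t \- L s)%R.
have push (Y : {RV P >-> R}) (psi : R -> R) : measurable_fun setT psi ->
    (forall x, `|psi x| <= 1) ->
    \int[distribution P Y]_x psi (xi * x) = \int[P]_w psi (xi * Y w).
  move=> mpsi psi1.
  have m1 : measurable_fun setT (fun x : R => psi (xi * x)).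
    by apply: (measurableT_comp mpsi); exact: measurable_funM.
  congr fine; apply: integral_distribution; first exact/measurable_EFinP.
  apply: (@bmeasurable_integrable _ _ _ P (fun w => psi (xi * Y w))).
  by split; [exact: (measurableT_comp m1)|exists 1 => w].
have stat (psi : R -> R) : measurable_fun setT psi -> (forall x, `|psi x| <= 1) ->
    \int[P]_w psi (xi * D w) = \int[P]_w psi (xi * L (t - s) w).
  move=> mpsi psi1; rewrite -!push//; congr fine.
  by apply: eq_measure_integral => B mB _; exact: (levy_stationary levL s0 st mB).
have ts0 : 0 <= t - s by rewrite subr_ge0.
have [<- <-] := stable_char xi ts0.
by split; apply: stat => //; [exact: measurable_cos|exact: cos_max|exact: measurable_sin|exact: sin_max].
Qed.

Lemma stable_increment_phase s t xi (U V : g_sigma_algebraType (F s) -> R) :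
  0 <= s -> s <= t -> bmeasurable U -> measurable_fun setT V ->
  let e := expR (- ((t - s) * `|xi| `^ al)) in
  \int[P]_w (U w * cos (V w + xi * (L t w - L s w))) = e * \int[P]_w (U w * cos (V w)) /\
  \int[P]_w (U w * sin (V w + xi * (L t w - L s w))) = e * \int[P]_w (U w * sin (V w)).
Proof.
move=> s0 st bU mV e; have [Ec Es] := stable_increment_char xi s0 st.
pose D : {RV P >-> R} := (L t \- L s)%R.
apply: (@independent_phase _ Omega R P (F s) (filtration_sigma hF s0)
  (filtration_sub hF s0) D _ xi e Ec Es U V bU mV) => A B FA mB.
by have [levL _] := stL; exact: (levy_independent levL s0 st FA mB).
Qed.

End stable_increments.

(** * Dynkin's formula for cosines *)

Section dynkin_identity.
Context d (Omega : measurableType d) (R : realType) (P : probability Omega R).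
Local Notation leb := (@lebesgue_measure R).
Variables (F : R -> set (set Omega)) (X L : R -> {RV P >-> R}) (al : R).
Hypotheses (hF : filtration F) (aX : adapted F X) (cX : cadlag_process X).
Hypotheses (al12 : 1 < al < 2) (stL : symmetric_stable al F L).
Variables (m : R -> R) (bm : bmeasurable m) (kap : R) (kap0 : 0 <= kap).

Definition space_time : probability _ R := (P \x (@unit_time R))%E.

Local Notation Q := space_time.
Local Notation nm := (fun x => `|m x|).
Local Notation A := (drift_path X m).
Local Notation Aq := (drift_path X nm).
Local Notation Z := (approx_process X L m).
Local Notation wt := (drift_weight X m kap).
Local Notation jw := (joint wt).
Local Notation jZ := (joint Z).
Local Notation ja := (joint (fun s w => m (X s w))).

Let bnm : bmeasurable nm. Proof. exact: bmeasurable_norm. Qed.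
Let levL : levy_process F L. Proof. by case: stL. Qed.
Let aL : adapted F L. Proof. exact: levy_adapted levL. Qed.

Lemma norm_section (h : Omega * R -> R) M u :
  (forall z, `|h z| <= M) -> bmeasurable h -> `|\int[P]_w h (w, u)| <= M.
Proof.
move=> hM [mh _].
have bu : bmeasurable (fun w => h (w, u)) by split; [exact: measurableT_comp|exists M => w].
rewrite (le_trans (le_normr_Rintegral _ (bmeasurable_integrable P bu)))//.
rewrite (@le_trans _ _ (\int[P]_w (M : R)))//; last first.
  by rewrite Rintegral_cst// [X in _ * fine X]probability_setT mulr1.
apply: le_bRintegral => //; first exact: bmeasurable_norm.
exact: bmeasurable_cst.
Qed.

Lemma bmeasurable_time_average (h : Omega * R -> R) : bmeasurable h ->
  bmeasurable (fun w => \int[leb]_(u in `[0, 1]) h (w, u)).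
Proof.
move=> [mh [M hM]].
have Eu w : \int[leb]_(u in `[0, 1]) h (w, u) = \int[@unit_time R]_u h (w, u).
  rewrite Rintegral_unit_time//.
  by split; [exact: (measurableT_comp mh)|exists M => u].
under [X in bmeasurable X]eq_fun do rewrite Eu.
apply: (@bmeasurable_section1 _ _ _ _ R P (@unit_time R) (fun=> M) h) => //.
- by move=> _; exact: (le_trans (normr_ge0 _) (hM point)).
- by apply: bmeasurable_integrable; exact: bmeasurable_cst.
Qed.

Lemma bmeasurable_expectation (h : Omega * R -> R) : bmeasurable h ->
  bmeasurable (fun u : R => \int[P]_w h (w, u)).
Proof.
move=> bh; have [mh [M hM]] := bh.
have M0 : 0 <= M := le_trans (normr_ge0 _) (hM point).
have iM : (@unit_time R).-integrable setT (EFin \o (fun=> M)).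
  by apply: bmeasurable_integrable; exact: bmeasurable_cst.
split; last by exists M => u; exact: norm_section.
exact: (@measurable_section2 _ _ _ _ R P (@unit_time R) (fun=> M) h (fun=> M0) iM mh (fun x y => hM (x, y))).
Qed.

Lemma Rintegral_space_time (h : Omega * R -> R) : bmeasurable h ->
  \int[Q]_z h z = \int[leb]_(u in `[0, 1]) \int[P]_w h (w, u) /\
  \int[Q]_z h z = \int[P]_w \int[leb]_(u in `[0, 1]) h (w, u).
Proof.
move=> bh; have [mh [M hM]] := bh.
have M0 : 0 <= M := le_trans (normr_ge0 _) (hM point).
have iM : (@unit_time R).-integrable setT (EFin \o (fun=> M)).
  by apply: bmeasurable_integrable; exact: bmeasurable_cst.
have E1 := @Rintegral_prod1 _ _ _ _ R P (@unit_time R) (fun=> M) h (fun=> M0) iM mh (fun x y => hM (x, y)).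
have E2 := @Rintegral_prod2 _ _ _ _ R P (@unit_time R) (fun=> M) h (fun=> M0) iM mh (fun x y => hM (x, y)).
split.
  by rewrite -[LHS]E2 Rintegral_unit_time//; exact: bmeasurable_expectation.
rewrite -[LHS]E1; apply: eq_Rintegral => w _; apply: Rintegral_unit_time.
by split; [exact: measurableT_comp|exists M => u].
Qed.

Section fixed_path.
Variables (w : Omega) (c : R).
Hypothesis c0 : 0 <= c.

Let p u := kap + c + `|m (X (clamp 1 u) w)|.
Let a u := m (X (clamp 1 u) w).
Let W s := (kap + c) * clamp 1 s + Aq (clamp 1 s) w.
Let V s := A (clamp 1 s) w.

Let ba : bmeasurable a.
Proof.
apply: (@bmeasurable_path _ Omega R 1 X m) => //; exact: cadlag_right.
Qed.

Let bp : bmeasurable p.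
Proof.
apply: bmeasurableD; first exact: bmeasurable_cst.
exact: bmeasurable_norm.
Qed.

Let path_measurable (h : Omega * R -> R) : measurable_fun setT h ->
  measurable_fun setT (fun s : R => h (w, s)).
Proof. by move=> mh; exact: measurableT_comp. Qed.

(** The noise is frozen at its terminal value [L 1], which makes each path
    absolutely continuous in time; [dynkin_cos] recovers [L u] by independence
    of the increment [L 1 - L u]. *)
Lemma path_dynkin xi :
  expR (- c) * (wt 1 w * cos (xi * Z 1 w)) = cos (xi * L 1 w) +
  \int[leb]_(u in `[0, 1]) (expR (- (c * u)) *
     (wt u w * (- (kap + c + `|m (X u w)|) * cos (xi * A u w + xi * L 1 w)
       - xi * m (X u w) * sin (xi * A u w + xi * L 1 w)))).
Proof.
have W0 t : 0 <= W t.
  have /andP[h _] := clamp_itv (@ler01 R) t.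
  by rewrite addr_ge0 ?mulr_ge0 ?addr_ge0// drift_path_norm_ge0.
have c1 (s : R) : 0 <= s -> s <= 1 -> clamp 1 s = s by move=> ? ?; rewrite clamp_id//; apply/andP.
have := @damped_FTC R p a W V bp ba 1 xi (xi * L 1 w).
have -> : damped W V xi (xi * L 1 w) cos 1 = expR (- c) * (wt 1 w * cos (xi * Z 1 w)).
  rewrite /damped /W /V c1// /drift_weight mulrA -expRD; congr (expR _ * cos _).
    ring.
  by rewrite /approx_process; ring.
move=> ->//.
- congr (_ + _); apply: eq_Rintegral => u /set_mem/=; rewrite in_itv/= => /andP[u0 u1].
  rewrite /ddamped /damped /p /a /W /V c1// /drift_weight.
  have -> : expR (- ((kap + c) * u + Aq u w)) = expR (- (c * u)) * expR (- (kap * u + Aq u w)).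
    by rewrite -expRD; congr expR; ring.
  ring.
- move=> s; rewrite /p addr_ge0// addr_ge0//.
- apply: measurable_funD; last exact: (path_measurable (measurable_joint_drift cX bnm)).
  apply: measurable_funM => //; exact: measurable_clamp.
- exact: (path_measurable (measurable_joint_drift cX bm)).
- by rewrite /W c1// mulr0 drift_path0 addr0.
- by rewrite /V c1// drift_path0.
- move=> s t s0 st t1.
  rewrite /W; have -> : clamp 1 s = s by apply: c1 => //; exact: le_trans t1.
  have -> : clamp 1 t = t by apply: c1 => //; exact: le_trans st.
  have -> : (kap + c) * t + Aq t w - ((kap + c) * s + Aq s w) =
    (kap + c) * (t - s) + (Aq t w - Aq s w) by ring.
  rewrite drift_path_increment// RintegralD//; last 2 first.
  + by apply: bmeasurable_integrable_itv; exact: bmeasurable_cst.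
  + by apply: bmeasurable_integrable_itv; exact: bmeasurable_norm.
  by rewrite Rintegral_cst// [X in fine X](lebesgue_measure_itvcc st).
- move=> s t s0 st t1.
  rewrite /V; have -> : clamp 1 s = s by apply: c1 => //; exact: le_trans t1.
  have -> : clamp 1 t = t by apply: c1 => //; exact: le_trans st.
  exact: drift_path_increment.
Qed.

End fixed_path.

(** Frequency [0] in [path_dynkin]: the discount starts at [1], loses the integral of
    [wt * (kap + |m|)] and stays nonnegative. The bound is pathwise and does not depend on [m],
    which is the purpose of the discount. *)
Lemma path_weight_rate w : \int[leb]_(u in `[0, 1]) (wt u w * `|m (X u w)|) <= 1.
Proof.
have := path_dynkin w (lexx 0) 0.
have -> : 0 * L 1 w = 0 by exact: mul0r.
have -> : 0 * Z 1 w = 0 by exact: mul0r.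
have -> : expR (- 0) * (wt 1 w * cos 0) = wt 1 w by rewrite oppr0 expR0 mul1r cos0 mulr1.
rewrite cos0 => E.
have bI (f : R -> R) : bmeasurable f ->
    leb.-integrable `[0, 1] (EFin \o (fun u => wt (clamp 1 u) w * f u)).
  move=> bf; apply: bmeasurable_integrable_itv; apply: bmeasurableM => //.
  have [mj [M jM]] := bmeasurable_joint_weight cX bm kap0.
  by split; [exact: (measurableT_comp mj (pair1_measurable w))|exists M => s; exact: (jM (w, s))].
have bq : bmeasurable (fun u : R => `|m (X (clamp 1 u) w)|).
  apply: (@bmeasurable_path _ Omega R 1 X nm) => //; exact: cadlag_right.
have EE : \int[leb]_(u in `[0, 1]) (wt u w * `|m (X u w)|) =
  \int[leb]_(u in `[0, 1]) (wt (clamp 1 u) w * `|m (X (clamp 1 u) w)|).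
  by apply: eq_Rintegral => u /set_mem/=; rewrite in_itv/= => u01; rewrite clamp_id.
have E' : wt 1 w = 1 - \int[leb]_(u in `[0, 1]) (wt (clamp 1 u) w * (kap + `|m (X (clamp 1 u) w)|)).
  rewrite E -[X in _ = 1 - X]mul1r -mulNr -RintegralZl//; last first.
    by apply: bI; apply: bmeasurableD => //; exact: bmeasurable_cst.
  congr (_ + _); apply: eq_Rintegral => u /set_mem/=; rewrite in_itv/= => u01.
  rewrite clamp_id//; move: (wt u w) (A u w) (m (X u w)) => x y z.
  have -> : - (0 * u) = 0 by ring.
  have -> : 0 * y + 0 = 0 by ring.
  rewrite expR0 cos0; ring.
have w0 : 0 <= wt 1 w by exact: expR_ge0.
rewrite EE; move: w0; rewrite E' subr_ge0; apply: le_trans.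
apply: le_Rintegral => //.
- exact: bI.
- by apply: bI; apply: bmeasurableD => //; exact: bmeasurable_cst.
- by move=> u _; rewrite ler_wpM2l ?expR_ge0// lerDr.
Qed.

(** The pathwise bound integrated over an event. The right side involves [E] alone, so it survives
    the blow-up of the mollified drifts. *)
Lemma event_weight_rate (E : set Omega) : measurable E ->
  \int[Q]_z (\1_E z.1 * `|jw z * ja z|) <= fine (P E).
Proof.
move=> mE; have bE : bmeasurable (\1_E : Omega -> R) by exact: bmeasurable_indic.
have bE1 : bmeasurable (fun z : Omega * R => \1_E z.1 : R).
  exact: (bmeasurable_comp bE measurable_fst).
have bj : bmeasurable (fun z => jw z * `|ja z|).
  apply: bmeasurableM; first exact: bmeasurable_joint_weight.
  exact/bmeasurable_norm/bmeasurable_joint_rate.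
have b := bmeasurableM bE1 bj.
under eq_Rintegral do rewrite normrM (ger0_norm (expR_ge0 _)).
have [_ ->] := Rintegral_space_time b.
rewrite -[leRHS](_ : \int[P]_w (\1_E w : R) = _); last by rewrite /Rintegral integral_indic// setIT.
have bt := bmeasurable_time_average b.
apply: (le_bRintegral P bt bE) => w /=; have [mj [M jM]] := bj.
rewrite RintegralZl//; last first.
  apply: bmeasurable_integrable_itv.
  by split; [exact: (measurableT_comp mj (pair1_measurable w))|exists M => u].
rewrite ler_piMr// (le_trans _ (path_weight_rate w))// le_eqVlt; apply/orP; left; apply/eqP.
by apply: eq_Rintegral => u /set_mem/=; rewrite in_itv/= /joint/= => u01; rewrite clamp_id.
Qed.

Lemma event_weight (E : set Omega) : measurable E ->
  \int[Q]_z (\1_E z.1 * `|jw z|) <= fine (P E).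
Proof.
move=> mE; have bE : bmeasurable (\1_E : Omega -> R) by exact: bmeasurable_indic.
have bE1 : bmeasurable (fun z : Omega * R => \1_E z.1 : R).
  exact: (bmeasurable_comp bE measurable_fst).
have bj := bmeasurable_norm (bmeasurable_joint_weight cX bm kap0).
have <- : \int[Q]_z (\1_E z.1 : R) = fine (P E).
  have [_ ->] := Rintegral_space_time bE1.
  rewrite -[RHS](_ : \int[P]_w (\1_E w : R) = _); last by rewrite /Rintegral integral_indic// setIT.
  apply: eq_Rintegral => w _; rewrite /= Rintegral_cst//.
  by rewrite [X in _ * fine X](lebesgue_measure_itvcc ler01) subr0 mulr1.
apply: le_bRintegral => //; first exact: bmeasurableM.
move=> z; rewrite ler_piMr// ger0_norm ?expR_ge0//.
have /andP[h _] := clamp_itv (@ler01 R) z.2.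
by have /andP[] := drift_weight_itv X m kap0 z.1 h.
Qed.

Lemma dynkin_cos xi (c := `|xi| `^ al) :
  \int[P]_w (wt 1 w * cos (xi * Z 1 w)) = 1 +
  \int[Q]_z (jw z * (- (kap + c + `|ja z|) * cos (xi * jZ z) - xi * ja z * sin (xi * jZ z))).
Proof.
have c0 : 0 <= c by exact: powR_ge0.
have bjw := bmeasurable_joint_weight cX bm kap0.
have bja := bmeasurable_joint_rate cX bm.
have mjZ := measurable_joint_approx cX stL bm.
have mjA := measurable_joint_drift cX bm.
have bpsi (psi : R -> R) (V : Omega * R -> R) : measurable_fun setT psi -> (forall x, `|psi x| <= 1) ->
    measurable_fun setT V -> bmeasurable (fun z => psi (V z)).
  by move=> mpsi psi1 mV; split; [exact: (measurableT_comp mpsi)|exists 1].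
pose U1 z := jw z * (- (kap + c + `|ja z|)).
pose U2 z := jw z * (- (xi * ja z)).
have bU1 : bmeasurable U1.
  apply: bmeasurableM => //; apply: bmeasurableN.
  apply: bmeasurableD; first exact: bmeasurable_cst.
  exact: bmeasurable_norm.
have bU2 : bmeasurable U2.
  apply: bmeasurableM => //; apply: bmeasurableN.
  by apply: bmeasurableM => //; exact: bmeasurable_cst.
pose V1 (z : Omega * R) := xi * joint A z + xi * L 1 z.1.
have mV1 : measurable_fun setT V1.
  by apply: measurable_funD; apply: measurable_funM => //; exact: measurableT_comp.
pose V2 z := xi * jZ z.
have mV2 : measurable_fun setT V2 by exact: measurable_funM.
have bh (V : Omega * R -> R) : measurable_fun setT V ->
    bmeasurable (fun z => U1 z * cos (V z) + U2 z * sin (V z)).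
  move=> mV; apply: bmeasurableD; apply: bmeasurableM => //.
    exact: (bpsi _ _ measurable_cos (@cos_max R)).
  exact: (bpsi _ _ measurable_sin (@sin_max R)).
pose e (z : Omega * R) := expR (- (c * clamp 1 z.2)).
have be : bmeasurable e.
  split; last first.
    exists 1 => z; rewrite ger0_norm ?expR_ge0// -expR0 ler_expR oppr_le0 mulr_ge0//.
    by have /andP[] := clamp_itv (@ler01 R) z.2.
  apply: (measurableT_comp (@measurable_expR R)); apply: measurableT_comp => //.
  apply: measurable_funM => //; apply: (measurableT_comp (measurable_clamp _)).
  exact: measurable_snd.
pose h z := e z * (U1 z * cos (V1 z) + U2 z * sin (V1 z)).
pose g z := U1 z * cos (V2 z) + U2 z * sin (V2 z).
have -> : \int[Q]_z (jw z * (- (kap + c + `|ja z|) * cos (xi * jZ z) - xi * ja z * sin (xi * jZ z))) =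
    \int[Q]_z g z.
  by apply: eq_Rintegral => z _; rewrite /g /U1 /U2 /V2; ring.
have [chc _] := stable_char stL xi ler01.
have bsec (k : Omega * R -> R) (u : R) : bmeasurable k -> bmeasurable (fun w => k (w, u)).
  by move=> [mk [M kM]]; split; [exact: measurableT_comp|exists M => w].
(* Given the past at time [u], replacing [L 1] by [L u] costs the factor [exp (- c (1 - u))].
   Together with the prefactor [exp (- c u)] this is [exp (- c)] for every [u], the same factor as
   on the terminal value and on the expectation of [cos (xi L 1)]; it cancels throughout. *)
have phase (u : R) : 0 <= u <= 1 ->
    \int[P]_w h (w, u) = expR (- c) * \int[P]_w g (w, u).
  move=> u01; have /andP[u0 u1] := u01.
  have mG (Y : R -> {RV P >-> R}) : adapted F Y ->
     @measurable_fun _ _ (g_sigma_algebraType (F u)) R setT (Y u).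
    by move=> aY; apply: (adapted_measurable hF aY u0); rewrite u0 lexx.
  have ju (Y : R -> Omega -> R) w : joint Y (w, u) = Y u w by rewrite /joint/= clamp_id.
  have bX : @bmeasurable _ (g_sigma_algebraType (F u)) R (fun w => m (X u w)).
    by apply: (bmeasurable_comp bm); exact: mG.
  have bAq := measurable_drift_path hF aX cX bnm u0.
  have bA := measurable_drift_path hF aX cX bm u0.
  have bw : @bmeasurable _ (g_sigma_algebraType (F u)) R (wt u).
    split; last first.
      exists 1 => w; have /andP[? ?] := drift_weight_itv X m kap0 w u0.
      by rewrite ger0_norm.
    apply: (measurableT_comp (@measurable_expR R)); apply: measurableT_comp => //.
    by apply: measurable_funD => //; case: bAq.
  have mZ : @measurable_fun _ _ (g_sigma_algebraType (F u)) R setT (fun w => xi * Z u w).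
    apply: measurable_funM => //; apply: measurable_funD; first exact: mG.
    by case: bA.
  have b1 : @bmeasurable _ (g_sigma_algebraType (F u)) R
      (fun w => wt u w * (- (kap + c + `|m (X u w)|))).
    apply: bmeasurableM => //; apply: bmeasurableN.
    apply: bmeasurableD; first exact: bmeasurable_cst.
    exact: bmeasurable_norm.
  have b2 : @bmeasurable _ (g_sigma_algebraType (F u)) R
      (fun w => wt u w * (- (xi * m (X u w)))).
    apply: bmeasurableM => //; apply: bmeasurableN.
    by apply: bmeasurableM => //; exact: bmeasurable_cst.
  have bs1 : bmeasurable (fun w : Omega => wt u w * (- (kap + c + `|m (X u w)|)) * cos (xi * Z u w)).
    have := bsec (fun z => U1 z * cos (V2 z)) u (bmeasurableM bU1 (bpsi _ _ measurable_cos (@cos_max R) mV2)).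
    by under [X in bmeasurable X]eq_fun do rewrite /U1 /V2 !ju.
  have bs2 : bmeasurable (fun w : Omega => wt u w * (- (xi * m (X u w))) * sin (xi * Z u w)).
    have := bsec (fun z => U2 z * sin (V2 z)) u (bmeasurableM bU2 (bpsi _ _ measurable_sin (@sin_max R) mV2)).
    by under [X in bmeasurable X]eq_fun do rewrite /U2 /V2 !ju.
  have [E1 _] := stable_increment_phase hF stL xi u0 u1 b1 mZ.
  have [_ E2] := stable_increment_phase hF stL xi u0 u1 b2 mZ.
  transitivity (expR (- (c * u)) *
    (\int[P]_w (U1 (w, u) * cos (V1 (w, u))) + \int[P]_w (U2 (w, u) * sin (V1 (w, u))))).
    rewrite -bRintegralD; last 2 first.
    - by apply: (bsec (fun z => U1 z * cos (V1 z))); apply: bmeasurableM => //;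
        exact: (bpsi _ _ measurable_cos (@cos_max R)).
    - by apply: (bsec (fun z => U2 z * sin (V1 z))); apply: bmeasurableM => //;
        exact: (bpsi _ _ measurable_sin (@sin_max R)).
    rewrite -bRintegralZl; last exact: (bsec (fun z => U1 z * cos (V1 z) + U2 z * sin (V1 z)) u (bh _ mV1)).
    by apply: eq_Rintegral => w _; rewrite /h /e/= clamp_id.
  have V1E w : V1 (w, u) = xi * Z u w + xi * (L 1 w - L u w).
    by rewrite /V1 ju /approx_process/=; ring.
  under eq_Rintegral do rewrite V1E /U1 !ju.
  under [X in _ * (_ + X)]eq_Rintegral do rewrite V1E /U2 !ju.
  rewrite E1 E2 -mulrDr mulrA -expRD.
  have -> : - (c * u) + - ((1 - u) * `|xi| `^ al) = - c by rewrite -/c; ring.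
  congr (_ * _); rewrite -bRintegralD; last 2 first.
  - exact: bs1.
  - exact: bs2.
  by apply: eq_Rintegral => w _; rewrite /g /U1 /U2 /V2 !ju.
have bhh : bmeasurable h by exact: (bmeasurableM be (bh _ mV1)).
have bg : bmeasurable g by exact: bh.
have [Eh1 Eh2] := Rintegral_space_time bhh.
have [Eg _] := Rintegral_space_time bg.
have Ehg : \int[Q]_z h z = expR (- c) * \int[Q]_z g z.
  rewrite Eh1 Eg -RintegralZl//; last first.
    by apply: bmeasurable_integrable_itv; exact: bmeasurable_expectation.
  by apply: eq_Rintegral => u /set_mem/=; rewrite in_itv/= => u01; exact: phase.
have ec0 : expR (- c) != 0 by rewrite gt_eqF ?expR_gt0.
apply: (mulfI ec0); rewrite mulrDr mulr1 -Ehg Eh2.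
have bw1 : bmeasurable (fun w => wt 1 w * cos (xi * Z 1 w)).
  have := bsec (fun z => jw z * cos (V2 z)) 1 (bmeasurableM bjw (bpsi _ _ measurable_cos (@cos_max R) mV2)).
  rewrite /V2 /joint/=.
  by under [X in bmeasurable X]eq_fun do rewrite !clamp_id// ?ler01 ?lexx//.
rewrite -bRintegralZl// -[LHS in _ = LHS + _]mul1r mul1r.
under eq_Rintegral do rewrite (path_dynkin _ c0).
have Ep w : \int[leb]_(u in `[0, 1]) (expR (- (c * u)) *
     (wt u w * (- (kap + c + `|m (X u w)|) * cos (xi * A u w + xi * L 1 w)
       - xi * m (X u w) * sin (xi * A u w + xi * L 1 w)))) =
   \int[leb]_(u in `[0, 1]) h (w, u).
  apply: eq_Rintegral => u /set_mem/=; rewrite in_itv/= => u01.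
  rewrite /h /e /U1 /U2 /V1 /joint/= clamp_id//; ring.
under eq_Rintegral do rewrite Ep.
rewrite bRintegralD.
- by rewrite chc mul1r.
- by split; [apply: (measurableT_comp measurable_cos); exact: measurable_funM|exists 1 => w; exact: cos_max].
- exact: bmeasurable_time_average.
Qed.

End dynkin_identity.

Lemma Rintegral_combination d (T : measurableType d) (R : realType)
    (mu : {measure set T -> \bar R}) (f0 f1 f2 f3 : T -> R) (a b : R) :
  mu.-integrable setT (EFin \o f0) -> mu.-integrable setT (EFin \o f1) ->
  mu.-integrable setT (EFin \o f2) -> mu.-integrable setT (EFin \o f3) ->
  \int[mu]_x (f0 x - f1 x - a * f2 x - b * f3 x) =
  \int[mu]_x f0 x - \int[mu]_x f1 x - a * \int[mu]_x f2 x - b * \int[mu]_x f3 x.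
Proof.
move=> I0 I1 I2 I3.
have J2 := integrableZl measurableT a I2.
have J3 := integrableZl measurableT b I3.
have I01 := integrableB measurableT I0 I1.
have I012 := integrableB measurableT I01 J2.
by rewrite RintegralB// RintegralB// RintegralB// RintegralZl// RintegralZl.
Qed.

Lemma lipschitz_measurable (R : realType) (f : R -> R) :
  (exists c, forall x y, `|f x - f y| <= c * `|x - y|) -> measurable_fun setT f.
Proof.
move=> [c fc]; apply: continuous_measurable_fun => x.
apply/cvgrPdist_le => e e0; near=> y.
have c1 : 0 < `|c| + 1 by rewrite ltr_wpDl.
rewrite (le_trans (fc _ _))// (@le_trans _ _ ((`|c| + 1) * `|x - y|))//.
  by rewrite ler_wpM2r// (le_trans (ler_norm _))// lerDl.
rewrite mulrC -ler_pdivlMr//; near: y.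
apply: cvgr_dist_le; first exact: cvg_id.
by rewrite divr_gt0// ltr_wpDl.
Unshelve. all: by end_near. Qed.

Lemma bmeasurable_bump (R : realType) : bmeasurable (@bump R).
Proof.
split; first exact: (lipschitz_measurable (@bump_lipschitz R)).
by exists 1 => x; rewrite ger0_norm ?bump_ge0 ?bump_le1.
Qed.

Lemma bmeasurable_dbump (R : realType) : bmeasurable (@dbump R).
Proof.
split; first exact: (lipschitz_measurable (@dbump_lipschitz R)).
by exists 1; exact: dbump_le1.
Qed.

Lemma bmeasurable_frac_bump (R : realType) (al : R) : 1 < al < 2 ->
  bmeasurable (frac_bump al).
Proof.
move=> al12; split; first exact: (lipschitz_measurable (frac_bump_lipschitz al12)).
exact: frac_bump_bounded.
Qed.

(** * Dynkin's formula for [bump] *)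

Section dynkin_bump.
Context d (Omega : measurableType d) (R : realType) (P : probability Omega R).
Local Notation leb := (@lebesgue_measure R).
Local Notation lw := (@laplace_weight R).
Variables (F : R -> set (set Omega)) (X L : R -> {RV P >-> R}) (al : R).
Hypotheses (hF : filtration F) (aX : adapted F X) (cX : cadlag_process X).
Hypotheses (al12 : 1 < al < 2) (stL : symmetric_stable al F L).
Variables (m : R -> R) (bm : bmeasurable m) (kap : R) (kap0 : 0 <= kap).

Local Notation Q := (space_time P).
Local Notation nm := (fun x => `|m x|).
Local Notation Z := (approx_process X L m).
Local Notation wt := (drift_weight X m kap).
Local Notation jw := (joint wt).
Local Notation jZ := (joint Z).
Local Notation ja := (joint (fun s w => m (X s w))).

(** This is [dynkin_cos] at frequency [t lam], averaged in [t] against [exp (- t)]: the factor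
    [|t lam|^al] turns cosines into [frac_bump], the factor [t lam] turns sines into [dbump]. Signs
    flip because [bump] is [1] minus the averaged cosine. *)
Lemma dynkin_bump lam : 0 < lam ->
  \int[P]_w (wt 1 w * bump (lam * Z 1 w)) =
  \int[Q]_z (jw z * (- (kap + `|ja z|) * bump (lam * jZ z)
     + lam `^ al * frac_bump al (lam * jZ z) + lam * ja z * dbump (lam * jZ z))).
Proof.
move=> lam0; have al0 : al != 0 by rewrite gt_eqF//; move: al12; lra.
have bjw := bmeasurable_joint_weight cX bm kap0.
have bja := bmeasurable_joint_rate cX bm.
have mjZ := measurable_joint_approx cX stL bm.
have bsec (k : Omega * R -> R) (u : R) : bmeasurable k -> bmeasurable (fun w => k (w, u)).
  by move=> [mk [M kM]]; split; [exact: measurableT_comp|exists M => w].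
have j1 (Y : R -> Omega -> R) w : joint Y (w, 1) = Y 1 w.
  by rewrite /joint/= clamp_id// ler01 lexx.
have bw1 : bmeasurable (wt 1).
  have := bsec _ 1 bjw.
  by under [X in bmeasurable X]eq_fun do rewrite j1.
have mZ1 : measurable_fun setT (fun w => lam * Z 1 w).
  apply: measurable_funM => //.
  have := measurableT_comp mjZ (pair2_measurable (1 : R)).
  by under [X in measurable_fun _ X]eq_fun do rewrite /= j1.
have mlZ : measurable_fun setT (fun z => lam * jZ z) by exact: measurable_funM.
pose U1 z := jw z * (kap + `|ja z|).
pose U3 z := jw z * ja z.
have bU1 : bmeasurable U1.
  apply: bmeasurableM => //; apply: bmeasurableD; first exact: bmeasurable_cst.
  exact: bmeasurable_norm.
have bU3 : bmeasurable U3 by exact: bmeasurableM.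
have mc := @measurable_cos R; have ms := @measurable_sin R.
have c1 := @cos_max R; have s1 := @sin_max R.
have d1 := @exp_dominated_laplace R; have d3 := @exp_dominated_laplace1 R.
have d2 : exp_dominated (fun t => t `^ al * lw t).
  by apply: exp_dominated_powR; move: al12; lra.
have X0 := transform_exchange P d1 mc c1 bw1 mZ1.
have X1 := transform_exchange Q d1 mc c1 bU1 mlZ.
have X2 := transform_exchange Q d2 mc c1 bjw mlZ.
have X3 := transform_exchange Q d3 ms s1 bU3 mlZ.
have I1 := transform_integrable Q d1 mc c1 bU1 mlZ.
have I2 := transform_integrable Q d2 mc c1 bjw mlZ.
have I3 := transform_integrable Q d3 ms s1 bU3 mlZ.
have bt (psi : R -> R) (V : Omega * R -> R) : measurable_fun setT psi -> (forall x, `|psi x| <= 1) ->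
    measurable_fun setT V -> bmeasurable (fun z => psi (V z)).
  by move=> mpsi psi1 mV; split; [exact: (measurableT_comp mpsi)|exists 1].
(* Frequency [0] supplies the constant part of [bump]. *)
have Ew1 : \int[P]_w wt 1 w = 1 - \int[Q]_z U1 z.
  have := dynkin_cos hF aX cX stL bm kap0 0.
  rewrite normr0 powR0//.
  under eq_Rintegral do rewrite mul0r cos0 mulr1.
  move=> ->; rewrite -bRintegralN//; congr (_ + _).
  apply: eq_Rintegral => z _; rewrite /U1.
  move: (jZ z) (ja z) (jw z) => x y v.
  have -> : 0 * x = 0 by ring.
  rewrite cos0; ring.
have Ecos : \int[leb]_t (lw t * \int[P]_w (wt 1 w * cos (t * (lam * Z 1 w)))) =
    1 - \int[leb]_t (lw t * \int[Q]_z (U1 z * cos (t * (lam * jZ z))))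
      - lam `^ al * \int[leb]_t (t `^ al * lw t * \int[Q]_z (jw z * cos (t * (lam * jZ z))))
      - lam * \int[leb]_t (t * lw t * \int[Q]_z (U3 z * sin (t * (lam * jZ z)))).
  have := Rintegral_combination (lam `^ al) lam (exp_dominated_integrable d1) I1 I2 I3.
  rewrite integral_laplace => <-.
  apply: eq_Rintegral => t _; case: (ltP t 0) => t0.
    by rewrite laplace_weight_lt0// !(mulr0, mul0r, subr0).
  under eq_Rintegral do rewrite mulrA.
  rewrite (dynkin_cos hF aX cX stL bm kap0).
  have -> : `|t * lam| `^ al = t `^ al * lam `^ al.
    by rewrite ger0_norm ?mulr_ge0 ?(ltW lam0)// powRM// ltW.
  have bt1 : bmeasurable (fun z => cos (t * (lam * jZ z))).
    by apply: bt => //; exact: measurable_funM.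
  have bt2 : bmeasurable (fun z => sin (t * (lam * jZ z))).
    by apply: bt => //; exact: measurable_funM.
  have b1 := bmeasurableM bU1 bt1.
  have b2 := bmeasurableM bjw bt1.
  have b3 := bmeasurableM bU3 bt2.
  transitivity (lw t * (1 - \int[Q]_z (U1 z * cos (t * (lam * jZ z)))
    - t `^ al * lam `^ al * \int[Q]_z (jw z * cos (t * (lam * jZ z)))
    - t * lam * \int[Q]_z (U3 z * sin (t * (lam * jZ z))))); last first.
    move: (\int[Q]_z (U1 z * _)) (\int[Q]_z (jw z * _)) (\int[Q]_z (U3 z * _)) => x y z; ring.
  congr (_ * _).
  rewrite -!bRintegralZl// -!addrA; congr (_ + _); rewrite !addrA.
  rewrite -bRintegralN// -bRintegralB//; last 2 first.
  - exact: bmeasurableN.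
  - by apply: bmeasurableM => //; exact: bmeasurable_cst.
  rewrite -bRintegralB//; last 2 first.
  - apply: bmeasurableB; first exact: bmeasurableN.
    by apply: bmeasurableM => //; exact: bmeasurable_cst.
  - by apply: bmeasurableM => //; exact: bmeasurable_cst.
  by apply: eq_Rintegral => z _; rewrite /U1 /U3 -!mulrA; ring.
have bb := @bmeasurable_bump R.
have bfb := bmeasurable_frac_bump al12.
have bdb := @bmeasurable_dbump R.
have B1 : \int[P]_w (wt 1 w * bump (lam * Z 1 w)) = \int[P]_w wt 1 w -
    \int[leb]_t (lw t * \int[P]_w (wt 1 w * cos (t * (lam * Z 1 w)))).
  rewrite -X0.
  have Eb w : \int[leb]_t (lw t * cos (t * (lam * Z 1 w))) = 1 - bump (lam * Z 1 w).
    by rewrite bumpE subKr.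
  under [X in _ - X]eq_Rintegral do rewrite Eb.
  have bZ := bmeasurable_comp bb mZ1.
  rewrite -bRintegralB//; last first.
    by apply: bmeasurableM => //; apply: bmeasurableB => //; exact: bmeasurable_cst.
  by apply: eq_Rintegral => w _; ring.
rewrite B1 Ecos Ew1 -X1 -X2 -X3.
have bZ := bmeasurable_comp bb mlZ.
have fZ := bmeasurable_comp bfb mlZ.
have dZ := bmeasurable_comp bdb mlZ.
have Eb z : \int[leb]_t (lw t * cos (t * (lam * jZ z))) = 1 - bump (lam * jZ z).
  by rewrite bumpE subKr.
under [X in _ - (_ - X - _ - _)]eq_Rintegral do rewrite Eb.
under [X in _ - (_ - _ * X)]eq_Rintegral do rewrite -dbumpE.
transitivity (\int[Q]_z (U1 z * (1 - bump (lam * jZ z))) - \int[Q]_z U1 z +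
   lam `^ al * \int[Q]_z (jw z * frac_bump al (lam * jZ z)) + lam * \int[Q]_z (U3 z * dbump (lam * jZ z))).
  rewrite /frac_bump; move: (\int[Q]_z (U1 z * _)) (\int[Q]_z (jw z * _)) (\int[Q]_z (U3 z * _)) (\int[Q]_z U1 z) => x y z v; ring.
have b1 : bmeasurable (fun z => U1 z * (1 - bump (lam * jZ z))).
  by apply: bmeasurableM => //; apply: bmeasurableB => //; exact: bmeasurable_cst.
have b2 := bmeasurableM bjw fZ.
have b3 := bmeasurableM bU3 dZ.
have bc (c : R) f : bmeasurable f -> bmeasurable (fun z : Omega * R => c * f z).
  by move=> bf; apply: bmeasurableM => //; exact: bmeasurable_cst.
rewrite -!bRintegralZl// -bRintegralB// -bRintegralD//; last 2 first.
- exact: bmeasurableB.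
- exact: bc.
rewrite -bRintegralD//; last 2 first.
- by apply: bmeasurableD; [exact: bmeasurableB|exact: bc].
- exact: bc.
by apply: eq_Rintegral => z _; rewrite /U1 /U3/=; ring.
Qed.

End dynkin_bump.

(** * Dyadic scales *)

Section bounded_lipschitz.
Context {R : realType}.
Implicit Types (f g : R -> R).

Definition bounded_lipschitz f :=
  exists M, forall x y, `|f x| <= M /\ `|f x - f y| <= M * `|x - y|.

Lemma bounded_lipschitzW f (b c : R) : (forall x, `|f x| <= b) ->
  (forall x y, `|f x - f y| <= c * `|x - y|) -> bounded_lipschitz f.
Proof.
move=> fb fc; exists (Num.max b c) => x y; split; first by rewrite le_max fb.
by rewrite (le_trans (fc x y))// ler_wpM2r// le_max lexx orbT.
Qed.

Lemma bounded_lipschitz_measurable f : bounded_lipschitz f -> bmeasurable f.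
Proof.
move=> [M h]; split; last by exists M => x; case: (h x x).
by apply: lipschitz_measurable; exists M => x y; case: (h x y).
Qed.

(** Three weights occur together: [a = (2 r)^-1] for the test function, [a = r] for its generator
    since [2^(al j) (2 r)^-j = r^j], and [a = r^-1] for its derivative since
    [2^j (2 r)^-j = r^-j]. *)
Definition multiscale (a : R) g (K : nat) (x : R) : R :=
  \sum_(0 <= j < K) a ^+ j * g (2 ^+ j * x).

Lemma bounded_lipschitz_multiscale a g K :
  bounded_lipschitz g -> bounded_lipschitz (multiscale a g K).
Proof.
move=> [M gM]; have M0 : 0 <= M by have [h _] := gM 0 0; exact: le_trans h.
exists (\sum_(0 <= j < K) `|a| ^+ j * (M * 2 ^+ j)) => x y; split.
  rewrite (le_trans (ler_norm_sum _ _ _))//; apply: ler_sum => j _.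
  rewrite normrM normrX ler_wpM2l ?exprn_ge0//.
  have [h _] := gM (2 ^+ j * x) 0; rewrite (le_trans h)// ler_peMr// exprn_ege1//; lra.
rewrite /multiscale -sumrB (le_trans (ler_norm_sum _ _ _))// mulr_suml.
apply: ler_sum => j _; rewrite -mulrBr normrM normrX -mulrA ler_wpM2l ?exprn_ge0//.
have [_ h] := gM (2 ^+ j * x) (2 ^+ j * y); rewrite (le_trans h)//.
by rewrite -mulrBr normrM (ger0_norm (_ : 0 <= 2 ^+ j)) ?exprn_ge0// mulrA.
Qed.

End bounded_lipschitz.

(** * Balance of generator and drift across scales *)

Section scales.
Context {R : realType}.
Variables (al : R) (al12 : 1 < al < 2).

(** A test function with weights [2^(- beta j)] suits the argument for [1 < beta < al]: [beta < al]
    makes the generator terms grow geometrically up to the scale of [x], [beta > 1] makes the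
    derivative terms decay, which removes the truncation error. The midpoint [beta = (1 + al) / 2]
    gives the reciprocal ratios [r] and [r^-1]. *)
Definition scale_ratio : R := 2 `^ ((al - 1) / 2).
Local Notation r := scale_ratio.

Lemma scale_ratio_sqr : r ^+ 2 = 2 `^ (al - 1).
Proof. by rewrite expr2 -powRD ?pnatr_eq0 ?implybT//; congr (_ `^ _); field. Qed.

Lemma scale_ratio_gt1 : 1 < r.
Proof.
have h : {in Num.nneg &, {homo (@powR R) ^~ ((al - 1) / 2) : x y / x < y}}.
  by apply: gt0_ltr_powR; move: al12; lra.
have : (1 : R) `^ ((al - 1) / 2) < r by apply: h; rewrite ?nnegrE//; lra.
by rewrite powR1.
Qed.

Lemma scale_ratio_lt2 : r < 2.
Proof.
have : r ^+ 2 <= (2 : R) `^ 1.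
  by rewrite scale_ratio_sqr; apply: ler_powR; move: al12; lra.
by rewrite powRr1//; have := scale_ratio_gt1; nra.
Qed.

Lemma scale_powR j : ((2 : R) ^+ j) `^ al = (2 * r) ^+ j * r ^+ j.
Proof.
rewrite -exprMn -mulrA -expr2 scale_ratio_sqr.
have -> : 2 * 2 `^ (al - 1) = 2 `^ al.
  rewrite -[X in X * _](powRr1 (_ : 0 <= 2))// -powRD ?pnatr_eq0 ?implybT//.
  by congr (_ `^ _); ring.
elim: j => [|j IH]; first by rewrite !expr0 powR1.
by rewrite !exprS powRM ?exprn_ge0// IH.
Qed.

Lemma scale_singularity J (y : R) : 0 < y -> 2 ^+ J * y <= 1 ->
  (r ^+ 2) ^+ J <= y `^ (1 - al).
Proof.
move=> y0 yJ.
have p0 : 0 < y `^ (al - 1) by rewrite powR_gt0.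
have -> : 1 - al = - (al - 1) by ring.
rewrite powRN -[leRHS]mul1r ler_pdivlMr//.
have -> : (r ^+ 2) ^+ J = (2 ^+ J) `^ (al - 1).
  rewrite scale_ratio_sqr; elim: J {yJ} => [|J IH]; first by rewrite !expr0 powR1.
  by rewrite !exprS powRM ?exprn_ge0// IH.
rewrite -powRM ?exprn_ge0 ?(ltW y0)//.
have al1 : 0 <= al - 1 by move: al12; lra.
rewrite (@le_trans _ _ (1 `^ (al - 1)))//; last by rewrite powR1.
by apply: ge0_ler_powR => //; rewrite nnegrE ?mulr_ge0 ?exprn_ge0 ?(ltW y0).
Qed.

(** [J.+1] is the least exponent bringing [|x|] above [1 / 2]. It is not [0] because [|x| <= 1 / 2],
    and its minimality gives the upper bound [1]. *)
Lemma dyadic_scale (x : R) : x != 0 -> `|x| <= 1 / 2 ->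
  exists J, 2 ^+ J.+1 * `|x| <= 1 /\ 1 / 2 < 2 ^+ J.+1 * `|x|.
Proof.
move=> x0 x2; have ax0 : 0 < `|x| by rewrite normr_gt0.
have ex : exists J : nat, 1 / 2 < 2 ^+ J * `|x|.
  exists (Num.truncn (`|x|^-1)); rewrite -ltr_pdivrMr//.
  rewrite (@lt_le_trans _ _ ((Num.truncn (`|x|^-1)).+1%:R))//.
    rewrite (le_lt_trans _ (truncnS_gt _))// ler_piMl ?invr_ge0//; lra.
  by rewrite -natrX ler_nat ltn_expl.
case: (ex_minnP ex) => -[|J] PJ Jmin.
  by move: PJ; rewrite expr0 mul1r; lra.
exists J; split => //.
have : ~~ (1 / 2 < 2 ^+ J * `|x|).
  by apply/negP => /Jmin; rewrite ltnn.
by rewrite -leNgt exprS; lra.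
Qed.

Variables (c : R) (c0 : 0 < c).
Hypothesis frac_le : forall x, `|frac_bump al x| <= c.
Hypothesis frac_decay : forall x, `|x * frac_bump al x| <= c.

Local Notation H := (multiscale r (frac_bump al)).
Local Notation G := (multiscale r^-1 (@dbump R)).
Local Notation B := (multiscale (2 * r)^-1 (@bump R)).

(** The first summand is the geometric sum of the [c r^j] up to the scale of [x]; the second is the
    tail beyond it, summable with ratio [r / 2] thanks to [frac_decay]. *)
Definition scale_cst : R := c * r / (r - 1) + 2 * c / (1 - r / 2).
Local Notation c1 := scale_cst.

Let r1 : 0 < r - 1. Proof. by rewrite subr_gt0; exact: scale_ratio_gt1. Qed.
Let r2 : 0 < 1 - r / 2. Proof. have := scale_ratio_lt2; lra. Qed.
Let r0 : 0 < r. Proof. have := r1; lra. Qed.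

Lemma scale_cst_gt0 : 0 < c1.
Proof. by rewrite addr_gt0 ?divr_gt0 ?mulr_gt0. Qed.

Let geo_le K (x : R) : H K x <= c / (r - 1) * r ^+ K.
Proof.
rewrite /multiscale; elim: K => [|K IH]; first by rewrite big_geq// expr0 mulr1 ltW ?divr_gt0.
rewrite big_nat_recr//= (le_trans (lerD IH (_ : _ <= r ^+ K * c)))//.
  by rewrite ler_wpM2l ?exprn_ge0 ?(ltW r0)// (le_trans (ler_norm _)).
rewrite le_eqVlt; apply/orP; left; apply/eqP; rewrite exprS.
by have := r1; move: (r ^+ K) => p h; field; rewrite gt_eqF.
Qed.

Lemma multiscale_frac_le K x : H K x <= c1 * r ^+ K.
Proof.
rewrite (le_trans (geo_le K x))// ler_wpM2r ?exprn_ge0 ?(ltW r0)//.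
rewrite /scale_cst -[leLHS]addr0 lerD//; last by rewrite ltW ?divr_gt0 ?mulr_gt0.
rewrite ler_pM2r ?invr_gt0// ler_peMr ?(ltW c0)//; have := r1; lra.
Qed.

Lemma multiscale_frac_decay K J x : 1 / 2 < 2 ^+ J * `|x| -> H K x <= c1 * r ^+ J.
Proof.
move=> xJ; have rJ n : 0 < r ^+ n by rewrite exprn_gt0.
have tail i : H (J.+1 + i) x <=
    c / (r - 1) * r ^+ J.+1 + 2 * c / (1 - r / 2) * r ^+ J * (1 - (r / 2) ^+ i).
  elim: i => [|i IH]; first by rewrite addn0 expr0 subrr mulr0 addr0.
  rewrite addnS {1}/multiscale big_nat_recr//= -/(multiscale _ _ _ x).
  set j := (J.+1 + i)%N.
  have P2 n : 0 < (2 : R) ^+ n by rewrite exprn_gt0.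
  (* As [j = J + 1 + i], the argument [2^j x] exceeds [2^i] in modulus and the decay gives
     [c / 2^i]; the spare factor [r] is bounded by [2]. *)
  have h : r ^+ j * frac_bump al (2 ^+ j * x) <= 2 * c * r ^+ J * (r / 2) ^+ i.
    have -> : 2 * c * r ^+ J * (r / 2) ^+ i = r ^+ (J + i) * (2 * c / 2 ^+ i).
      rewrite exprD expr_div_n; ring.
    have d1 := frac_decay (2 ^+ j * x).
    have x0 : 0 < `|x| by rewrite -(pmulr_rgt0 _ (P2 J)); apply: le_lt_trans xJ.
    have d2 : `|frac_bump al (2 ^+ j * x)| <= c / (2 ^+ i).
      rewrite ler_pdivlMr//; apply: le_trans d1; rewrite normrM mulrC ler_wpM2r//.
      rewrite normrM (ger0_norm (ltW (P2 _))) /j addSn exprS exprD.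
      have : 2 ^+ i * (1 / 2) <= 2 ^+ i * (2 ^+ J * `|x|) by rewrite ler_wpM2l ?(ltW (P2 _))// ltW.
      nra.
    have -> : r ^+ j = r ^+ (J + i).+1 by rewrite /j addSn.
    have h1 : r * frac_bump al (2 ^+ j * x) <= r * (c / 2 ^+ i).
      by rewrite ler_wpM2l ?(ltW r0)// (le_trans (ler_norm _)).
    have h2 : r * (c / 2 ^+ i) <= 2 * (c / 2 ^+ i).
      by rewrite ler_wpM2r ?(ltW scale_ratio_lt2)// divr_ge0 ?(ltW c0)// ltW.
    have := le_trans h1 h2; rewrite -(ler_pM2l (rJ (J + i)%N)) exprS -!mulrA; apply: le_trans.
    by rewrite -/j mulrCA.
  rewrite (le_trans (lerD IH h))// -addrA lerD2l le_eqVlt; apply/orP; left; apply/eqP.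
  have := r2; rewrite exprS; move: (r ^+ J) ((r / 2) ^+ i) => p q; move: (r / 2) => s hs.
  by field; rewrite gt_eqF.
case: (leqP K J) => KJ.
  rewrite (le_trans (multiscale_frac_le K x))// ler_wpM2l ?(ltW scale_cst_gt0)//.
  by rewrite ler_weXn2l// ltW// scale_ratio_gt1.
rewrite -(subnKC KJ) (le_trans (tail _))// /scale_cst [leRHS]mulrDl; apply: lerD.
  rewrite exprS; move: (r ^+ J) => p; rewrite le_eqVlt; apply/orP; left; apply/eqP; ring.
apply: ler_piMr; first by rewrite mulr_ge0 ?(ltW (rJ _))// ltW// divr_gt0// mulr_gt0.
by rewrite gerBl exprn_ge0// divr_ge0// ltW.
Qed.

Lemma multiscale_bump_ge K x : bump x <= B K.+1 x.
Proof.
rewrite /multiscale big_nat_recl//= expr0 !mul1r lerDl; apply: sumr_ge0 => j _.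
by rewrite mulr_ge0 ?bump_ge0// exprn_ge0// invr_ge0 mulr_ge0// ltW.
Qed.

(** All scales pull in the same direction, so a restoring drift gains from each of them and a lower
    bound may keep a single one. *)
Lemma multiscale_dbump_sgn K x :
  G K x = Num.sg x * (\sum_(0 <= j < K) r^-1 ^+ j * `|dbump (2 ^+ j * x)|).
Proof.
rewrite /multiscale mulr_sumr; apply: eq_bigr => j _.
rewrite [RHS]mulrCA; congr (_ * _).
by rewrite [LHS](dbump_sgn (2 ^+ j * x)) sgrM gtr0_sg ?mul1r// exprn_gt0.
Qed.

Let invX_ge0 j : 0 <= r^-1 ^+ j. Proof. by rewrite exprn_ge0// invr_ge0 ltW. Qed.

(** For the window [|x| <= 2^-n], where the drift has no sign: it bounds there both the generator
    sum and the slope at [0] of the derivative sum. It depends on [K] but not on [n], which goes to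
    infinity first. *)
Definition small_cst K : R := c1 * r ^+ K + \sum_(0 <= j < K) 2 * 2 ^+ j.

Lemma multiscale_dbump_le K x : `|G K x| <= small_cst K * `|x|.
Proof.
rewrite (@le_trans _ _ ((\sum_(0 <= j < K) 2 * 2 ^+ j) * `|x|))//; last first.
  by rewrite ler_wpM2r// lerDr mulr_ge0 ?(ltW scale_cst_gt0)// exprn_ge0// ltW.
rewrite (le_trans (ler_norm_sum _ _ _))// mulr_suml; apply: ler_sum => j _.
rewrite normrM (ger0_norm (invX_ge0 j)) (le_trans (ler_piMl _ _))//.
  by rewrite exprn_ile1 ?invr_ge0 ?(ltW r0)// invf_le1// ltW// scale_ratio_gt1.
by rewrite (le_trans (dbump_le _))// normrM (ger0_norm (exprn_ge0 j (_ : 0 <= 2)))// mulrA.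
Qed.

(** At distance [2^-J] from [0] the generator term is at most [c1 r^J], while the
    restoring drift contributes at least [C r^(2J-2) r^-J / 4]: hence the value
    of [C]. *)
Lemma multiscale_drift K n (x a b : R) (C := 4 * r ^+ 2 * c1) : bump x <= b ->
  (2^-1 ^+ n < `|x| -> Num.sg x * a <= 0) ->
  (2^-1 ^+ n < `|x| -> `|x| <= 1 / 2 -> Num.sg x * a <= - (C * (2 * `|x|) `^ (1 - al))) ->
  H K x + a * G K x <= 5 * c1 * b + r^-1 ^+ K * `|a| + small_cst K * 2^-1 ^+ n * `|a|
     + small_cst K * (`|x| <= 2^-1 ^+ n)%R%:R.
Proof.
move=> hb asg asing.
have sK : 0 <= small_cst K.
  rewrite addr_ge0 ?sumr_ge0 ?mulr_ge0 ?(ltW scale_cst_gt0)//.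
    by rewrite exprn_ge0// ltW.
have h5 : 0 <= 5 * c1 * b.
  apply: mulr_ge0; last exact: le_trans (bump_ge0 x) hb.
  by rewrite mulr_ge0// ltW// scale_cst_gt0.
have ha : 0 <= r^-1 ^+ K * `|a| by rewrite mulr_ge0.
have hn : 0 <= (2^-1 : R) ^+ n by rewrite exprn_ge0// invr_ge0.
have hs : 0 <= small_cst K * 2^-1 ^+ n * `|a| by rewrite !mulr_ge0.
(* Inside the window only crude bounds are available; the derivative sum is at most linear in [x],
   which supplies a factor [2^-n] against [|a|]. *)
case: (leP `|x| (2^-1 ^+ n)) => [xn|xn].
  have hG : a * G K x <= small_cst K * 2^-1 ^+ n * `|a|.
    rewrite (le_trans (ler_norm _))// normrM mulrC ler_wpM2r//.
    by rewrite (le_trans (multiscale_dbump_le K x))// ler_wpM2l.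
  have hH : H K x <= small_cst K.
    by rewrite (le_trans (multiscale_frac_le K x))// lerDl sumr_ge0// => j _; rewrite mulr_ge0 ?exprn_ge0.
  by rewrite mulr1; lra.
rewrite mulr0 addr0.
have x0 : x != 0 by rewrite -normr_gt0; apply: le_lt_trans xn.
have ax0 : 0 < `|x| by rewrite normr_gt0.
set S := \sum_(0 <= j < K) r^-1 ^+ j * `|dbump (2 ^+ j * x)|.
have S0 : 0 <= S by apply: sumr_ge0 => j _; rewrite mulr_ge0.
have aG : a * G K x = Num.sg x * a * S.
  by rewrite multiscale_dbump_sgn -/S; ring.
have asS : Num.sg x * a * S <= 0 by rewrite mulr_le0_ge0// asg.
rewrite aG.
(* Away from [0] the drift term is merely nonpositive, but [b >= 1 / 5], so [5 c1 b] pays for the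
   generator. *)
case: (leP `|x| (1 / 2)) => x2; last first.
  have hH : H K x <= c1.
    have x2' : 1 / 2 < 2 ^+ 0 * `|x| by rewrite expr0 [ltRHS]mul1r.
    by have := multiscale_frac_decay K x2'; rewrite expr0 mulr1.
  have hB := le_trans (bump_ge (ltW x2)) hb.
  have : 5 * c1 * (1 / 5) <= 5 * c1 * b.
    by rewrite ler_wpM2l// mulr_ge0// ltW// scale_cst_gt0.
  lra.
have [J [J1 J2]] := dyadic_scale x0 x2.
have C0 : 0 <= C.
  apply: mulr_ge0 (ltW scale_cst_gt0); apply: mulr_ge0 => //; exact: sqr_ge0.
have sing : C * (r ^+ 2) ^+ J <= `|a|.
  have h1 : C * (r ^+ 2) ^+ J <= C * (2 * `|x|) `^ (1 - al).
    apply: ler_wpM2l => //.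
    by apply: scale_singularity; [rewrite mulr_gt0|rewrite mulrA -exprSr].
  have h2 := asing xn x2.
  have : `|Num.sg x * a| = `|a| by rewrite normrM normr_sg x0 mul1r.
  by move=> <-; rewrite (le_trans h1)// -[leLHS]opprK (le_trans (_ : _ <= - (Num.sg x * a)))// ?lerN2// -normrN ler_norm.
have rp n' : 0 < r ^+ n' by rewrite exprn_gt0.
(* If the scale [J + 1] of [x] is among the [K] summed ones, its single derivative term already
   offsets the generator. *)
case: (ltnP J.+1 K) => KJ.
  have hH := multiscale_frac_decay K J2.
  have hS : r^-1 ^+ J.+1 * (1 / 4) <= S.
    rewrite /S (bigD1_seq J.+1) ?mem_index_iota ?iota_uniq//=.
    have d : 1 / 4 <= `|dbump (2 ^+ J.+1 * x)|.
      by apply: dbump_ge; rewrite normrM (ger0_norm (exprn_ge0 _ (_ : 0 <= 2)))// J1 ltW.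
    rewrite -[leLHS]addr0 lerD//; first by rewrite ler_wpM2l.
    by apply: sumr_ge0 => j _; rewrite mulr_ge0.
  have h1 : - (Num.sg x * a) = `|a|.
    have : `|Num.sg x * a| = `|a| by rewrite normrM normr_sg x0 mul1r.
    by move=> <-; rewrite ler0_norm// asg.
  have h2 : C * (r ^+ 2) ^+ J * (r^-1 ^+ J.+1 * (1 / 4)) <= `|a| * S.
    apply: ler_pM => //; last by rewrite mulr_ge0.
    by apply: mulr_ge0 => //; rewrite exprn_ge0// sqr_ge0.
  have h3 : C * (r ^+ 2) ^+ J * (r^-1 ^+ J.+1 * (1 / 4)) = c1 * r ^+ J.+1.
    rewrite /C -exprM mulnC exprM expr2 !exprS exprVn.
    have := rp J; have := r0; move: (r ^+ J) => p rr pp.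
    by field; rewrite !gt_eqF.
  rewrite h3 -h1 in h2; lra.
(* Here [K <= J + 1]: the truncated sum does not resolve [x]. The generator saturates at [c1 r^K]
   while [|a|] is at least [4 c1 r^(2 J + 2)], hence at least [c1 r^(2 K)]; this is the truncation
   error [r^-K |a|]. *)
have hH := multiscale_frac_le K x.
suff : c1 * r ^+ K <= r^-1 ^+ K * `|a| by lra.
rewrite exprVn [leRHS]mulrC ler_pdivlMr// -mulrA; apply: le_trans sing.
have h : r ^+ K * r ^+ K <= r ^+ 2 * (r ^+ 2) ^+ J.
  by rewrite -exprS -exprD -exprM ler_weXn2l ?(ltW scale_ratio_gt1)// mul2n -addnn leq_add.
have c10 := scale_cst_gt0.
have q0 : 0 <= r ^+ 2 * (r ^+ 2) ^+ J 
  by apply: mulr_ge0; [exact: sqr_ge0|apply: exprn_ge0; exact: sqr_ge0].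
have h1 : c1 * (r ^+ K * r ^+ K) <= c1 * (r ^+ 2 * (r ^+ 2) ^+ J) by rewrite ler_wpM2l// ltW.
have h2 : 0 <= c1 * (r ^+ 2 * (r ^+ 2) ^+ J) by rewrite mulr_ge0// ltW.
have -> : C * (r ^+ 2) ^+ J = 4 * (c1 * (r ^+ 2 * (r ^+ 2) ^+ J)) by rewrite /C; ring.
lra.
Qed.

End scales.

(** * Removal of the mollification *)

Lemma bounded_convergence d (T : measurableType d) (R : realType)
    (mu : {finite_measure set T -> \bar R}) (f_ : nat -> T -> R) (f : T -> R) (M : R) :
  (forall n, measurable_fun setT (f_ n)) -> (forall n x, `|f_ n x| <= M) ->
  (forall x, f_ n x @[n --> \oo] --> f x) ->
  \int[mu]_x f_ n x @[n --> \oo] --> \int[mu]_x f x.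
Proof.
move=> mf fM cf; have mfl : measurable_fun setT f.
  by apply: (@measurable_fun_cvg _ _ _ _ f_) => // x _; exact: cf.
have bf n : bmeasurable (f_ n) by split => //; exists M.
have iM : mu.-integrable setT (EFin \o (fun=> M : R)).
  by apply: bmeasurable_integrable; exact: bmeasurable_cst.
have [|||||ifl _ h] := @dominated_convergence _ _ R mu setT measurableT
  (fun n x => (f_ n x)%:E) (EFin \o f) (EFin \o (fun=> M : R)).
- by move=> n; exact/measurable_EFinP.
- exact/measurable_EFinP.
- by apply: aeW => x _; apply: cvg_EFin; [exact: nearW|exact: cf].
- exact: iM.
- by apply: aeW => x n _; rewrite /= lee_fin.
by apply: fine_cvg; rewrite fineK//; exact: integrable_fin_num.
Qed.

Section space_time_limit.
Context d (Omega : measurableType d) (R : realType) (P : probability Omega R).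
Local Notation Q := (space_time P).

Global Instance space_time_filter : Filter (almost_everywhere Q) :=
  ae_filter_ringOfSetsType Q.

Lemma ae_space_time (S : Omega -> Prop) :
  {ae P, forall w, S w} -> {ae Q, forall z, S z.1}.
Proof.
move=> [N [mN N0 SN]]; exists (N `*` setT); split.
- exact: measurableX.
- have -> : Q (N `*` setT) = (P N * (@unit_time R) setT)%E by apply: product_measure1E.
  by rewrite [X in (X * _)%E]N0 mul0e.
- by move=> z /= Sz; split => //; exact: SN.
Qed.

(** On [E] the trivial bound [2 M] meets a mass of [|U|] of at most [P E]; off [E] the Lipschitz
    bound meets a total mass of at most [1]. Only these masses matter, never the supremum of [U]. *)
Lemma space_time_replacement (U V W : Omega * R -> R) (psi : R -> R) (M eps : R)
    (E : set Omega) :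
  bmeasurable U -> measurable_fun setT V -> measurable_fun setT W ->
  (forall B, measurable B -> \int[Q]_z (\1_B z.1 * `|U z|) <= fine (P B)) ->
  (forall x y, `|psi x| <= M /\ `|psi x - psi y| <= M * `|x - y|) ->
  measurable E -> 0 <= eps -> fine (P E) <= eps ->
  {ae Q, forall z, ~ E z.1 -> `|V z - W z| <= eps} ->
  `|\int[Q]_z (U z * psi (V z)) - \int[Q]_z (U z * psi (W z))| <= 3 * M * eps.
Proof.
move=> bU mV mW rU hpsi mE e0 PE VW.
have M0 : 0 <= M by have [h _] := hpsi 0 0; exact: le_trans h.
have bpsi : bmeasurable psi by apply: bounded_lipschitz_measurable; exists M.
have bV := bmeasurableM bU (bmeasurable_comp bpsi mV).
have bW := bmeasurableM bU (bmeasurable_comp bpsi mW).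
have bE : bmeasurable (fun z : Omega * R => \1_E z.1 : R).
  exact: (bmeasurable_comp (bmeasurable_indic R mE) measurable_fst).
have baU := bmeasurable_norm bU.
have bc (c : R) : @bmeasurable _ (Omega * R)%type R (fun=> c).
  exact: bmeasurable_cst.
have bEU := bmeasurableM bE baU.
rewrite -bRintegralB//.
have bVW := bmeasurableB bV bW.
have h1 := le_normr_Rintegral measurableT (bmeasurable_integrable Q bVW).
apply: (le_trans h1).
apply: (@le_trans _ _ (\int[Q]_z (M * eps * `|U z| + 2 * M * (\1_E z.1 * `|U z|)))).
  apply: ae_le_bRintegral.
  - exact: bmeasurable_norm.
  - exact: (bmeasurableD (bmeasurableM (bc _) baU) (bmeasurableM (bc _) bEU)).
  apply: filterS VW => z VWz /=.
  rewrite -mulrBr normrM.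
  have [p1 p2] := hpsi (V z) (W z); have [p3 _] := hpsi (W z) 0.
  rewrite indicE; case: (boolP (z.1 \in E)) => zE.
    rewrite mul1r -mulrDl mulrC ler_wpM2r// (le_trans (ler_normB _ _))//.
    have := mulr_ge0 M0 e0; lra.
  rewrite mul0r mulr0 addr0 mulrC ler_wpM2r// (le_trans p2)// ler_wpM2l// VWz//.
  by move/mem_set => zE'; rewrite zE' in zE.
rewrite bRintegralD//; last 2 first.
- exact: (bmeasurableM (bc _) baU).
- exact: (bmeasurableM (bc _) bEU).
rewrite !bRintegralZl//.
have h2 : \int[Q]_z `|U z| <= 1.
  have := rU setT measurableT; rewrite probability_setT.
  by under eq_Rintegral do rewrite indicT mul1r.
have h3 := le_trans (rU E mE) PE.
have k1 : M * eps * \int[Q]_z `|U z| <= M * eps by rewrite ler_piMr ?mulr_ge0.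
have k2 : 2 * M * \int[Q]_z (\1_E z.1 * `|U z|) <= 2 * M * eps by rewrite ler_wpM2l ?mulr_ge0.
have -> : 3 * M * eps = M * eps + 2 * M * eps by ring.
exact: lerD.
Qed.

End space_time_limit.

(** * Measurability of uniform deviations *)

Section uniform_deviation.
Context d (Omega : measurableType d) (R : realType).
Variables (Y Z : R -> Omega -> R) (eps : R).
Hypothesis mY : forall s, 0 <= s <= 1 -> measurable_fun setT (Y s).
Hypothesis mZ : forall s, 0 <= s <= 1 -> measurable_fun setT (Z s).
Hypothesis rY : forall w s, 0 <= s < 1 -> Y u w @[u --> s^'+] --> Y s w.
Hypothesis rZ : forall w s, 0 <= s < 1 -> Z u w @[u --> s^'+] --> Z s w.

Definition deviation : set Omega :=
  [set w | (eps%:E < uniform_dist 1 (Y ^~ w) (Z ^~ w))%E].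

(** By right-continuity a strict excess at some time is inherited by a grid time, so the supremum
    over [[0, 1]] reduces to countably many times. *)
Lemma measurable_deviation : measurable deviation.
Proof.
pose D s w := `|Y s w - Z s w|.
have mD s : 0 <= s <= 1 -> measurable_fun setT (D s).
  by move=> s01; apply: measurableT_comp => //; apply: measurable_funB; [exact: mY|exact: mZ].
have rD w s : 0 <= s < 1 -> D u w @[u --> s^'+] --> D s w.
  by move=> s01; apply: cvg_norm; apply: cvgB; [exact: rY|exact: rZ].
have -> : deviation = \bigcup_N \bigcup_k (D (grid_point 1 N k) @^-1` `]eps, +oo[).
  apply/seteqP; split => w /=.
    rewrite /deviation/= => /ereal_sup_gt[_ [s /= s01 <-]]; rewrite lte_fin => epsD.
    move: s01; rewrite in_itv/= => s01.
    have := @cvg_grid _ _ R 1 D ler01 rD w s; rewrite clamp_id// => /cvgr_gt/(_ _ epsD).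
    case=> N _ /(_ N (leqnn N))/= h.
    by exists N => //; exists (grid_index 1 N s) => //=; rewrite in_itv/= h.
  move=> [N _ [k _ /=]]; rewrite in_itv/= andbT => h.
  rewrite /deviation/=; apply: (@lt_le_trans _ _ (D (grid_point 1 N k) w)%:E); first by rewrite lte_fin.
  apply: ereal_sup_ubound.
  by exists (grid_point 1 N k) => //=; rewrite in_itv/= grid_point_itv.
apply: bigcup_measurable => N _; apply: bigcup_measurable => k _.
rewrite -[X in measurable X]setTI; apply: mD => //.
exact: grid_point_itv.
Qed.

Lemma deviationN w s : ~ deviation w -> 0 <= s <= 1 -> `|Y s w - Z s w| <= eps.
Proof.
move=> nD s01; rewrite leNgt; apply/negP => h; apply: nD; rewrite /deviation/=.
apply: (@lt_le_trans _ _ (`|Y s w - Z s w|)%:E); first by rewrite lte_fin.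
by apply: ereal_sup_ubound; exists s => //=; rewrite in_itv.
Qed.

End uniform_deviation.

Lemma continuous_process_right (R : realType) d (Omega : measurableType d)
    (P : probability Omega R) (A : R -> {RV P >-> R}) : continuous_process A ->
  forall w (s : R), 0 <= s < 1 -> A u w @[u --> s^'+] --> A s w.
Proof.
move=> cA w s /andP[s0 _].
have /continuous_within_itvcyP[h1 h2] := cA w.
move: s0; rewrite le_eqVlt => /predU1P[<-//|s0].
apply: cvg_at_right_filter; apply: h1; by rewrite in_itv/= s0.
Qed.

(** * Estimates uniform in the drift *)

Section energy.
Context d (Omega : measurableType d) (R : realType) (P : probability Omega R).
Variables (F : R -> set (set Omega)) (X L : R -> {RV P >-> R}) (al : R).
Hypotheses (hF : filtration F) (aX : adapted F X) (cX : cadlag_process X).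
Hypotheses (al12 : 1 < al < 2) (stL : symmetric_stable al F L).
Variables (m : R -> R) (bm : bmeasurable m) (kap : R) (kap0 : 0 <= kap).

Local Notation Q := (space_time P).
Local Notation Z := (approx_process X L m).
Local Notation wt := (drift_weight X m kap).
Local Notation jw := (joint wt).
Local Notation jZ := (joint Z).
Local Notation ja := (joint (fun s w => m (X s w))).
Local Notation r := (scale_ratio al).

Let bjw := bmeasurable_joint_weight cX bm kap0.
Let bja := bmeasurable_joint_rate cX bm.
Let mjZ : measurable_fun setT jZ. Proof. exact: (measurable_joint_approx cX stL bm). Qed.
Let bc (c : R) : @bmeasurable _ (Omega * R)%type R (fun=> c).
Proof. exact: bmeasurable_cst. Qed.
Let bU := bmeasurableM bjw bja.

Lemma joint_weight_itv z : 0 <= jw z <= 1.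
Proof.
have /andP[h _] := clamp_itv (@ler01 R) z.2.
exact: (drift_weight_itv X m kap0 z.1 h).
Qed.

Lemma weight_rate_le1 : \int[Q]_z `|jw z * ja z| <= 1.
Proof.
have := event_weight_rate L cX bm kap0 measurableT; rewrite probability_setT.
by under eq_Rintegral do rewrite indicT mul1r.
Qed.

Let bdyn lam : bmeasurable (fun z =>
  jw z * (- (kap + `|ja z|) * bump (lam * jZ z)
     + lam `^ al * frac_bump al (lam * jZ z) + lam * ja z * dbump (lam * jZ z))).
Proof.
have mlZ : measurable_fun setT (fun z => lam * jZ z) by exact: measurable_funM.
have b1 := bmeasurable_comp (@bmeasurable_bump R) mlZ.
have b2 := bmeasurable_comp (bmeasurable_frac_bump al12) mlZ.
have b3 := bmeasurable_comp (@bmeasurable_dbump R) mlZ.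
apply: bmeasurableM => //; apply: bmeasurableD; last first.
  apply: bmeasurableM => //; exact: (bmeasurableM (bc lam) bja).
apply: bmeasurableD; last by exact: (bmeasurableM (bc _) b2).
apply: bmeasurableM => //; apply: bmeasurableN.
by apply: bmeasurableD => //; exact: bmeasurable_norm.
Qed.

Let wt1_measurable : bmeasurable (wt 1) /\ measurable_fun setT (Z 1).
Proof.
have j1 (Y : R -> Omega -> R) w : joint Y (w, 1) = Y 1 w.
  by rewrite /joint/= clamp_id// ler01 lexx.
have [mw [M wM]] := bjw; split.
  have : bmeasurable (fun w => jw (w, 1)) by split; [exact: measurableT_comp|exists M => w].
  by under [X in bmeasurable X]eq_fun do rewrite j1.
have := measurableT_comp mjZ (pair2_measurable (1 : R)).
by under [X in measurable_fun _ X]eq_fun do rewrite /= j1.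
Qed.

Let weighted_bump_itv lam : 0 <= \int[P]_w (wt 1 w * bump (lam * Z 1 w)) <= 1.
Proof.
have w01 w := @drift_weight_itv _ _ _ P X m kap kap0 1 w ler01.
rewrite Rintegral_ge0/=; last by move=> w _; rewrite mulr_ge0 ?bump_ge0// expR_ge0.
have [bw mZ1] := wt1_measurable.
rewrite (@le_trans _ _ (\int[P]_w (1 : R)))//; last first.
  by rewrite Rintegral_cst// [X in _ * fine X]probability_setT mulr1.
apply: le_bRintegral; [|exact: bmeasurable_cst|].
  apply: bmeasurableM => //.
  apply: (bmeasurable_comp (@bmeasurable_bump R)); exact: measurable_funM.
by move=> w; rewrite mulr_ile1 ?bump_ge0 ?bump_le1//; case/andP: (w01 w).
Qed.

(** Dynkin's formula solved for the generator term: the terminal value costs [1], the discount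
    [kap + 1], the drift [lam]. Since [al > 1] the bound vanishes at high frequency. *)
Lemma weighted_frac_bump_le lam : 0 < lam ->
  \int[Q]_z (jw z * frac_bump al (lam * jZ z)) <= (2 + kap + lam) / lam `^ al.
Proof.
move=> lam0; have pl : 0 < lam `^ al by rewrite powR_gt0.
have mlZ : measurable_fun setT (fun z => lam * jZ z) by exact: measurable_funM.
have b2 := bmeasurable_comp (bmeasurable_frac_bump al12) mlZ.
have bf := bmeasurableM bjw b2.
have ba := bmeasurable_norm bU.
have be : bmeasurable (fun z => kap + (1 + lam) * `|jw z * ja z|).
  exact: (bmeasurableD (bc _) (bmeasurableM (bc _) ba)).
rewrite ler_pdivlMr// mulrC.
have h : lam `^ al * \int[Q]_z (jw z * frac_bump al (lam * jZ z)) -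
    (kap + (1 + lam) * \int[Q]_z `|jw z * ja z|) <= 1.
  have -> : kap + (1 + lam) * \int[Q]_z `|jw z * ja z| =
      \int[Q]_z (kap + (1 + lam) * `|jw z * ja z|).
    rewrite bRintegralD; [|exact: bc|exact: (bmeasurableM (bc _) ba)].
    rewrite bRintegralZl//; congr (_ + _).
    by rewrite Rintegral_cst// [X in _ * fine X]probability_setT mulr1.
  rewrite -bRintegralZl// -bRintegralB//; last exact: (bmeasurableM (bc _) bf).
  have /andP[_] := weighted_bump_itv lam; rewrite (dynkin_bump hF aX cX al12 stL bm kap0 lam0).
  apply: le_trans; apply: le_bRintegral; [|exact: bdyn|].
    exact: (bmeasurableB (bmeasurableM (bc _) bf) be).
  move=> z; have /andP[w0 w1] := joint_weight_itv z.
  rewrite normrM (ger0_norm w0).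
  have k1 : jw z * (kap + `|ja z|) * bump (lam * jZ z) <= kap + jw z * `|ja z|.
    rewrite (le_trans (ler_piMr _ (bump_le1 _)))//; first by rewrite mulr_ge0// addr_ge0.
    by rewrite mulrDr lerD2r ler_piMl.
  have k2 : - (jw z * lam * (ja z * dbump (lam * jZ z))) <= lam * (jw z * `|ja z|).
    have : `|jw z * lam * (ja z * dbump (lam * jZ z))| <= lam * (jw z * `|ja z|).
      rewrite normrM normrM (ger0_norm w0) (gtr0_norm lam0) [leRHS]mulrCA mulrA ler_wpM2l ?mulr_ge0 ?(ltW lam0)//.
      by rewrite normrM ler_piMr// dbump_le1.
    by apply: le_trans; rewrite -normrN ler_norm.
  move: k1 k2; move: (jw z) (ja z) (bump _) (dbump _) (frac_bump _ _) (lam `^ al) => w a b e f p k1 k2.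
  move: (`|a|) k1 k2 => q k1 k2.
  have -> : w * (- (kap + q) * b + p * f + lam * a * e) =
    p * (w * f) - w * (kap + q) * b - (- (w * lam * (a * e))) by ring.
  lra.
have := weight_rate_le1; have l1 : 0 <= 1 + lam by rewrite addr_ge0// ltW.
move: h; move: (\int[Q]_z (jw z * _)) (\int[Q]_z `|_|) => x y h hy.
have : (1 + lam) * y <= 1 + lam by rewrite ler_piMr.
lra.
Qed.

(** The sum of [dynkin_bump] at [lam = 2^j] with weights [(2 r)^-j]; of the terminal values only the
    sign is kept. *)
Lemma multiscale_dynkin K :
  0 <= \int[Q]_z (jw z * (- (kap + `|ja z|) * multiscale (2 * r)^-1 (@bump R) K (jZ z)
      + multiscale r (frac_bump al) K (jZ z) + ja z * multiscale r^-1 (@dbump R) K (jZ z))).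
Proof.
have r0 : 0 < r by apply: lt_trans (scale_ratio_gt1 al12).
have cj j : 0 <= (2 * r)^-1 ^+ j by rewrite exprn_ge0// invr_ge0 mulr_ge0// ltW.
pose G j z := jw z * (- (kap + `|ja z|) * bump (2 ^+ j * jZ z)
     + (2 ^+ j) `^ al * frac_bump al (2 ^+ j * jZ z) + 2 ^+ j * ja z * dbump (2 ^+ j * jZ z)).
have IG j : 0 <= \int[Q]_z G j z.
  have p : 0 < (2 : R) ^+ j by rewrite exprn_gt0.
  by rewrite /G -(dynkin_bump hF aX cX al12 stL bm kap0 p); case/andP: (weighted_bump_itv (2 ^+ j)).
have bG j : bmeasurable (fun z => (2 * r)^-1 ^+ j * G j z).
  exact: (bmeasurableM (bc _) (bdyn _)).
have : 0 <= \sum_(0 <= j < K) \int[Q]_z ((2 * r)^-1 ^+ j * G j z).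
  apply: sumr_ge0 => j _; rewrite bRintegralZl ?mulr_ge0//; exact: bdyn.
rewrite -bRintegral_sum//; congr (_ <= _); apply: eq_Rintegral => z _.
rewrite /multiscale !mulr_sumr -!big_split/= mulr_sumr; apply: eq_bigr => j _.
rewrite /G scale_powR.
have rj : 0 < r ^+ j by rewrite exprn_gt0.
have tj : 0 < (2 : R) ^+ j by rewrite exprn_gt0.
have -> : r^-1 ^+ j = (r ^+ j)^-1 by rewrite exprVn.
have -> : (2 * r)^-1 ^+ j = (2 ^+ j * r ^+ j)^-1 by rewrite exprVn exprMn.
have -> : (2 * r) ^+ j = 2 ^+ j * r ^+ j by rewrite exprMn.
have key (w a b f e t s q : R) : 0 < t -> 0 < s ->
    (t * s)^-1 * (w * (- (kap + q) * b + t * s * s * f + t * a * e)) =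
    w * (- (kap + q) * ((t * s)^-1 * b) + s * f + a * (s^-1 * e)).
  by move=> t0 s0; field; rewrite !gt_eqF.
exact: key.
Qed.

End energy.

Lemma le_geometric0 (R : realType) (a c x : R) : 0 <= x < 1 ->
  (forall K, a <= c * x ^+ K) -> a <= 0.
Proof.
move=> /andP[x0 x1] h.
apply: (@ler_cvg_to nat \oo _ R (fun=> a) (geometric c x)).
- exact: cvg_cst.
- by apply: cvg_geometric; rewrite ger0_norm.
- by apply: nearW => K; exact: h.
Qed.

Lemma le_epsilon_mul (R : realType) (a b M : R) :
  (forall e, 0 < e -> a <= b + M * e) -> a <= b.
Proof.
move=> h; apply/ler_addgt0Pr => e e0.
have M1 : 0 < `|M| + 1 by rewrite ltr_wpDl.
apply: (le_trans (h (e / (`|M| + 1)) (divr_gt0 e0 M1))).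
rewrite lerD2l mulrCA ler_piMr ?(ltW e0)// ler_pdivrMr// mul1r.
by rewrite (le_trans (ler_norm _))// lerDl.
Qed.

(** [x] has no sign, so the weight [w] is replaced by the smaller [v] on the positive part and by
    [1] on the negative part. The result no longer depends on [w], hence on the mollification. *)
Lemma cutoff_parts_le (R : realType) (v w x : R) : 0 <= v <= w -> w <= 1 ->
  v * Num.max x 0 - Num.max (- x) 0 <= w * x.
Proof.
move=> /andP[v0 vw] w1; have [x0|x0] := leP 0 x.
  by rewrite (max_idPr _) ?oppr_le0// subr0 ler_wpM2r.
rewrite mulr0 sub0r (max_idPl _) ?oppr_ge0 ?(ltW x0)// opprK.
by rewrite -[leLHS]mul1r ler_wnM2r ?(ltW x0).
Qed.

(** The rate [k + 1 + q] acts in three parts: [k] absorbs the term [k * f] of [y], [1] leaves the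
    gain [- v b], and [q] has the good sign and is dropped. *)
Lemma cutoff_drift_le (R : realType) (v w f b q y k p p' s s' o o' : R) :
  0 <= v <= w -> w <= 1 -> 0 <= b <= f -> 0 <= q ->
  y <= k * f + p * q + s * q + o -> p <= p' -> s <= s' -> o <= o' -> 0 <= o' ->
  w * (- (k + 1 + q) * f + y) <= - (v * b) + (p' + s') * (w * q) + o'.
Proof.
move=> /andP[v0 vw] w1 /andP[b0 bf] q0 yle pp ss oo o0.
have w0 := le_trans v0 vw; have f0 := le_trans b0 bf.
have h1 : v * b <= w * f by rewrite ler_pM.
have h2 : 0 <= w * (q * f) by rewrite !mulr_ge0.
have h3 : w * o' <= o' by rewrite ler_piMl.
have h4 : w * y <= w * (k * f + (p' + s') * q + o').
  rewrite ler_wpM2l// (le_trans yle)// lerD// -addrA lerD2l -mulrDl ler_wpM2r// lerD//.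
lra.
Qed.

(** * The contradiction *)

Section nonexistence.
Context d (Omega : measurableType d) (R : realType) (P : probability Omega R).
Local Notation Q := (space_time P).
Variables (F : R -> set (set Omega)) (X L A : R -> {RV P >-> R}) (al : R).
Hypotheses (hF : filtration F) (aX : adapted F X) (cX : cadlag_process X).
Hypotheses (al12 : 1 < al < 2) (stL : symmetric_stable al F L).
Hypothesis cA : continuous_process A.
Hypothesis XLA : {ae P, forall w, forall t : R, 0 <= t -> X t w = L t w + A t w}.
Local Notation r := (scale_ratio al).
Variables (c : R) (c0 : 0 < c).
Hypothesis frac_le : forall x, `|frac_bump al x| <= c.
Hypothesis frac_decay : forall x, `|x * frac_bump al x| <= c.
Local Notation C := (4 * r ^+ 2 * scale_cst al c).
Variables (nn : nat -> nat) (nn_ge : forall i, (i <= nn i)%N).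
Variables (m : nat -> R -> R) (bm : forall i, bmeasurable (m i)).
Hypothesis m_sgn : forall i x, 2^-1 ^+ nn i < `|x| -> Num.sg x * m i x <= 0.
Hypothesis m_sing : forall i x, 2^-1 ^+ nn i < `|x| -> `|x| <= 1 / 2 ->
  Num.sg x * m i x <= - (C * (2 * `|x|) `^ (1 - al)).
Local Notation dev i eps := (deviation (drift_path X (m i)) A eps).
Hypothesis dev_small : forall eps, 0 < eps -> exists i0, forall i, (i0 <= i)%N ->
  fine (P (dev i eps)) <= eps.
Local Notation Aq i := (drift_path X (fun x => `|m i x|) 1).
Hypothesis drift_bounded : {ae P, forall w, exists N : nat, forall i, Aq i w <= N%:R}.

(** The multiple of [scale_cst] matches the coefficient in [multiscale_drift]; the extra [1] is the
    gain that forces [bump] of the solution to vanish. *)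
Let kap : R := 5 * scale_cst al c + 1.
Let kap0 : 0 <= kap.
Proof. by rewrite addr_ge0// mulr_ge0// ltW// scale_cst_gt0. Qed.

Local Notation jX := (joint X).
Local Notation jw i := (joint (drift_weight X (m i) kap)).
Local Notation jZ i := (joint (approx_process X L (m i))).
Local Notation ja i := (joint (fun s w => m i (X s w))).

Let bc (a : R) : @bmeasurable _ (Omega * R)%type R (fun=> a).
Proof. exact: bmeasurable_cst. Qed.
Let mjX : measurable_fun setT jX. Proof. exact: measurable_joint_process. Qed.
Let mjZ i : measurable_fun setT (jZ i).
Proof. exact: (measurable_joint_approx cX stL (bm i)). Qed.
Let bjw i : bmeasurable (jw i).
Proof. exact: (bmeasurable_joint_weight cX (bm i) kap0). Qed.
Let bja i : bmeasurable (ja i).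
Proof. exact: (bmeasurable_joint_rate cX (bm i)). Qed.
Let jw01 i z : 0 <= jw i z <= 1. Proof. exact: joint_weight_itv. Qed.

Let measurable_dev i eps : measurable (dev i eps).
Proof.
apply: measurable_deviation.
- by move=> s /andP[s0 _]; case: (measurable_drift_path_ambient cX (bm i) s0).
- by [].
- by move=> w s s01; exact: (drift_path_right cX (bm i)).
- exact: continuous_process_right.
Qed.

(** In [Z - X] the noise cancels, leaving the mollified drift minus [A]. *)
Let approx_error i eps : {ae Q, forall z, ~ dev i eps z.1 -> `|jZ i z - jX z| <= eps}.
Proof.
apply: filterS (ae_space_time XLA) => z /= h nd.
have t01 := clamp_itv (@ler01 R) z.2; have /andP[t0 _] := t01.
rewrite /joint /approx_process (h _ t0).
have -> (x y u : R) : x + y - (x + u) = y - u by move=> *; ring.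
exact: (deviationN nd t01).
Qed.

Let replace i (U : Omega * R -> R) psi M eps : bmeasurable U ->
  (forall B, measurable B -> \int[Q]_z (\1_B z.1 * `|U z|) <= fine (P B)) ->
  (forall x y, `|psi x| <= M /\ `|psi x - psi y| <= M * `|x - y|) ->
  0 < eps -> fine (P (dev i eps)) <= eps ->
  `|\int[Q]_z (U z * psi (jZ i z)) - \int[Q]_z (U z * psi (jX z))| <= 3 * M * eps.
Proof.
move=> bU rU hpsi e0 Pe.
exact: (space_time_replacement bU (mjZ i) mjX rU hpsi (measurable_dev i eps) (ltW e0) Pe (approx_error i eps)).
Qed.

Definition drift_event N : set Omega := [set w | forall i, Aq i w <= N%:R].
(** A common lower bound for the discount factors of all mollifications. *)
Definition drift_cutoff N (z : Omega * R) : R := expR (- (kap + N%:R)) * \1_(drift_event N) z.1.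
Local Notation V := drift_cutoff.

Lemma measurable_drift_event N : measurable (drift_event N).
Proof.
have -> : drift_event N = \bigcap_i (Aq i @^-1` `]-oo, N%:R]).
  by apply/seteqP; split => w /= h i; [move=> _; rewrite /= in_itv/=; exact: h|have := h i I; rewrite /= in_itv/=].
apply: bigcap_measurable => // i _; rewrite -[X in measurable X]setTI.
by have [mA _] := measurable_drift_path_ambient cX (bmeasurable_norm (bm i)) (@ler01 R); exact: mA.
Qed.

Let bV N : bmeasurable (V N).
Proof.
apply: bmeasurableM; first exact: bc.
exact: (bmeasurable_comp (bmeasurable_indic R (measurable_drift_event N)) measurable_fst).
Qed.

(** Times are at most [1] and the absolute drift increases in time, so on [drift_event N] the
    exponent never exceeds [kap + N], whatever [i]. *)
Let V_itv N i z : 0 <= V N z <= jw i z.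
Proof.
rewrite /drift_cutoff mulr_ge0 ?expR_ge0//= indicE; case: (boolP (z.1 \in drift_event N)) => zN; last first.
  by rewrite mulr0; case/andP: (jw01 i z).
rewrite mulr1 /joint /drift_weight ler_expR lerN2.
have /andP[t0 t1] := clamp_itv (@ler01 R) z.2.
have AN : Aq i z.1 <= N%:R by move/set_mem: zN; apply.
apply: lerD; first by rewrite ler_piMr.
apply: le_trans AN; rewrite -subr_ge0 drift_path_increment//.
  exact: Rintegral_ge0.
exact: bmeasurable_norm.
Qed.

Let V01 N z : 0 <= V N z <= 1.
Proof.
have /andP[v0 v1] := V_itv N 0 z; rewrite v0 (le_trans v1)//.
by case/andP: (jw01 0 z).
Qed.

Local Notation h := (frac_bump al).

(** For each [eps] one mollification with small deviation suffices: after replacing [Z] by [X] and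
    the discount by the cutoff, the left side no longer depends on it, and [eps] goes to [0]. *)
Let frac_part_le N lam : 0 < lam ->
  \int[Q]_z (V N z * Num.max (h (lam * jX z)) 0 - Num.max (- h (lam * jX z)) 0)
    <= (2 + kap + lam) / lam `^ al.
Proof.
move=> lam0.
have [M hM] : bounded_lipschitz (fun x => h (lam * x)).
  have [b hb] := frac_bump_bounded al12; have [l hl] := frac_bump_lipschitz al12.
  apply: (@bounded_lipschitzW _ _ b (l * lam)) => [x|x y]; first exact: hb.
  by rewrite (le_trans (hl _ _))// -mulrBr normrM (gtr0_norm lam0) mulrA.
apply: (@le_epsilon_mul _ _ _ (3 * M)) => eps eps0.
have [i0 hi] := dev_small eps0; have Pe := hi i0 (leqnn _).
have rep := replace (bjw i0) (fun B => @event_weight _ _ _ _ _ cX _ (bm i0) _ kap0 B) hM eps0 Pe.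
have A1 := weighted_frac_bump_le hF aX cX al12 stL (bm i0) kap0 lam0.
have rep' : \int[Q]_z (jw i0 z * h (lam * jX z)) <=
    \int[Q]_z (jw i0 z * h (lam * jZ i0 z)) + 3 * M * eps.
  by move: rep; rewrite ler_norml => /andP[+ _]; move: (\int[Q]_z _) (\int[Q]_z _) => x y; lra.
rewrite (@le_trans _ _ (\int[Q]_z (jw i0 z * h (lam * jX z))))//; last first.
  by rewrite (le_trans rep')// lerD2r.
have mlX : measurable_fun setT (fun z => lam * jX z) by exact: measurable_funM.
have bh := bmeasurable_comp (bmeasurable_frac_bump al12) mlX.
have bmax (f : Omega * R -> R) : bmeasurable f -> bmeasurable (fun z => Num.max (f z) 0).
  move=> [mf [K fK]]; split; first exact: measurable_maxr.
  exists K => z; rewrite ger0_norm ?le_max ?lexx ?orbT//.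
  by rewrite ge_max (le_trans (ler_norm _) (fK z)) (le_trans (normr_ge0 _) (fK z)).
apply: le_bRintegral.
- exact: (bmeasurableB (bmeasurableM (bV N) (bmax _ bh)) (bmax _ (bmeasurableN bh))).
- exact: (bmeasurableM (bjw i0) bh).
move=> z; have /andP[v0 v1] := V_itv N i0 z; have /andP[w0 w1] := jw01 i0 z.
by apply: cutoff_parts_le; rewrite ?v0.
Qed.

Let bdX : bmeasurable (fun z => (jX z == 0)%:R : R).
Proof.
have -> : (fun z => (jX z == 0)%:R : R) = \1_(jX @^-1` [set 0]).
  apply/funext => z; rewrite indicE; congr (nat_of_bool _)%:R.
  by apply/idP/idP => [/eqP h1|/set_mem h1]; [apply/mem_set|apply/eqP].
by apply: bmeasurable_indic; rewrite -[X in measurable X]setTI; exact: mjX.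
Qed.

(** At [lam = 2^j] the decay of [frac_bump] concentrates it on the zero set of [X], where it has the
    positive value [frac_bump al 0], while the upper bound is of order
    [2^j / 2^(al j) = r^(- 2 j)]. *)
Lemma solution_avoids_zero N : {ae Q, forall z, V N z * (jX z == 0)%:R = 0}.
Proof.
have h0 := frac_bump0_gt0 al12.
pose g j z := V N z * Num.max (h (2 ^+ j * jX z)) 0 - Num.max (- h (2 ^+ j * jX z)) 0.
pose g0 z := h 0 * (V N z * (jX z == 0)%:R).
have mh : measurable_fun setT h by case: (bmeasurable_frac_bump al12).
have mg j : measurable_fun setT (g j).
  have mhX : measurable_fun setT (fun z => h (2 ^+ j * jX z)).
    by apply: (measurableT_comp mh); exact: measurable_funM.
  apply: measurable_funB.
    by apply: measurable_funM; [case: (bV N)|exact: measurable_maxr].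
  by apply: measurable_maxr => //; exact: measurableT_comp.
have g_le j z : `|g j z| <= 2 * `|h (2 ^+ j * jX z)|.
  have /andP[v0 v1] := V01 N z; rewrite /g; move: v0 v1; move: (V N z) (h _) => v x v0 v1.
  rewrite !maxEle ler_norml; have [x0|x0] := leP 0 x.
    by rewrite (ger0_norm x0); case: ifP => x1; case: ifP => x2; apply/andP; split; nra.
  by rewrite (ltr0_norm x0); case: ifP => x1; case: ifP => x2; apply/andP; split; nra.
have cg z : g j z @[j --> \oo] --> g0 z.
  rewrite /g0; have [jX0|jX0] := eqVneq (jX z) 0.
    rewrite mulr1 /g jX0.
    under eq_fun do rewrite mulr0 (max_idPl (ltW h0)) (max_idPr (_ : - h 0 <= 0)) ?oppr_le0 ?(ltW h0)// subr0 mulrC.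
    exact: cvg_cst.
  rewrite !mulr0; have x0 : 0 < `|jX z| by rewrite normr_gt0.
  pose u := geometric (2 * (c / `|jX z|)) 2^-1.
  have u0 : u j @[j --> \oo] --> 0 by apply: cvg_geometric; rewrite ger0_norm//; lra.
  apply: (@squeeze_cvgr _ _ _ _ (fun j => - u j) u) => //; last first.
    by rewrite -oppr0; exact: cvgN.
  apply: nearW => j; rewrite -ler_norml (le_trans (g_le j z))// /u /geometric/= -mulrA ler_wpM2l//.
  rewrite exprVn -mulrA -invfM ler_pdivlMr; last by rewrite mulr_gt0// exprn_gt0.
  have := frac_decay (2 ^+ j * jX z); rewrite normrM mulrC; congr (_ * _ <= _).
  by rewrite normrM (ger0_norm (exprn_ge0 _ _))// mulrC.
have gM j z : `|g j z| <= 2 * c by rewrite (le_trans (g_le j z))// ler_wpM2l.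
have cvI := bounded_convergence (mu := Q) mg gM cg.
have bVX := bmeasurableM (bV N) bdX.
have r1 := scale_ratio_gt1 al12; have rp : 0 < r by apply: lt_trans r1.
have I0 : \int[Q]_z g0 z <= 0.
  apply: (@ler_cvg_to nat \oo _ R _ (geometric (3 + kap) (r^-1 ^+ 2)) _ _ cvI).
    apply: cvg_geometric; rewrite ger0_norm ?exprn_ge0 ?invr_ge0 ?(ltW rp)//.
    by rewrite exprn_ilt1 ?invr_ge0 ?(ltW rp)// invf_lt1.
  apply: nearW => j; have t0 : 0 < (2 : R) ^+ j by rewrite exprn_gt0.
  rewrite (le_trans (frac_part_le N t0))// /geometric/= scale_powR.
  have t1 : 1 <= (2 : R) ^+ j by rewrite exprn_ege1//; lra.
  have s0 : 0 < r ^+ j by rewrite exprn_gt0.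
  have -> : (r^-1 ^+ 2) ^+ j = (r ^+ j)^-1 * (r ^+ j)^-1 by rewrite exprAC exprVn expr2.
  rewrite exprMn -!mulrA ler_pdivrMr; last by rewrite !mulr_gt0.
  have -> : (3 + kap) * (r ^- j / r ^+ j) * (2 ^+ j * (r ^+ j * r ^+ j)) = (3 + kap) * 2 ^+ j.
    by move: s0; move: (r ^+ j) => x x0; field; rewrite gt_eqF.
  by have := kap0; nra.
have : \int[Q]_z (V N z * (jX z == 0)%:R) <= 0.
  by move: I0; rewrite /g0 bRintegralZl// pmulr_rle0.
apply: bRintegral_eq0_ae => // z.
by rewrite mulr_ge0//; case/andP: (V01 N z).
Qed.

(** For fixed [K] the mollification index goes to infinity; what survives of [multiscale_drift] is
    its truncation error, whose weighted integral is at most [r^-K]. The sums run to [K.+1] because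
    the scale [j = 0] is needed to dominate [bump]. *)
Let cutoff_bump_le N K : {ae Q, forall z, jX z <> 0} ->
  \int[Q]_z (V N z * bump (jX z)) <= 1 * r^-1 ^+ K.
Proof.
move=> X0; rewrite mul1r.
have r1 := scale_ratio_gt1 al12; have rp : 0 < r by apply: lt_trans r1.
pose ind j (z : Omega * R) : R := (`|jX z| <= 2^-1 ^+ j)%R%:R.
have bind j : bmeasurable (ind j).
  have -> : ind j = \1_((fun z => `|jX z|) @^-1` `]-oo, 2^-1 ^+ j]).
    apply/funext => z; rewrite indicE; congr (nat_of_bool _)%:R.
    by apply/idP/idP => [h1|/set_mem]; [apply/mem_set|]; rewrite /= in_itv.
  apply: bmeasurable_indic; rewrite -[X in measurable X]setTI.
  have : measurable_fun setT (fun z => `|jX z|) by exact: measurableT_comp.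
  by apply.
have half0 : (2^-1 : R) ^+ j @[j --> \oo] --> 0.
  have : geometric 1 (2^-1 : R) j @[j --> \oo] --> 0 by apply: cvg_geometric; rewrite ger0_norm//; lra.
  by apply: cvg_trans; apply: near_eq_cvg; apply: nearW => j; rewrite /geometric/= mul1r.
have ind0 : \int[Q]_z ind j z @[j --> \oo] --> \int[Q]_z ((jX z == 0)%:R : R).
  apply: (@bounded_convergence _ _ _ Q ind _ 1).
  - by move=> j; case: (bind j).
  - by move=> j z; rewrite /ind ger0_norm ?ler0n// (ler_nat _ _ 1) leq_b1.
  - move=> z; have [jX0|jX0] := eqVneq (jX z) 0.
      rewrite /ind jX0 normr0; under eq_fun do rewrite exprn_ge0 ?invr_ge0//.
      exact: cvg_cst.
    apply: cvg_near_cst; have x0 : 0 < `|jX z| by rewrite normr_gt0.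
    by apply: filterS (cvgr_lt _ half0 _ x0) => j; rewrite /ind leNgt => ->.
(* [X] spends no time at [0], so its time in the shrinking windows of [ind] tends to [0]. *)
have lim0 : \int[Q]_z ((jX z == 0)%:R : R) <= 0.
  rewrite [leRHS](_ : 0 = \int[Q]_z (0 : R)); last by rewrite Rintegral_cst// mul0r.
  apply: ae_le_bRintegral; [exact: bdX|exact: bc|].
  by apply: filterS X0 => z /eqP/negbTE ->.
pose f := multiscale (2 * r)^-1 (@bump R) K.+1.
pose G := multiscale r^-1 (@dbump R) K.+1.
pose H := multiscale r h K.+1.
have lf : bounded_lipschitz f.
  have [l hl] := @bump_lipschitz R.
  apply: bounded_lipschitz_multiscale; apply: (bounded_lipschitzW (b := 1) _ hl) => x.
  by rewrite ger0_norm ?bump_ge0 ?bump_le1.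
have lG : bounded_lipschitz G.
  have [l hl] := @dbump_lipschitz R.
  by apply: bounded_lipschitz_multiscale; apply: (bounded_lipschitzW (@dbump_le1 R) hl).
have lH : bounded_lipschitz H.
  have [l hl] := frac_bump_lipschitz al12.
  by apply: bounded_lipschitz_multiscale; apply: (bounded_lipschitzW frac_le hl).
have [Mf hf] := lf; have [MG hG] := lG; have [MH hH] := lH.
set sK := small_cst al c K.+1.
have sK0 : 0 <= sK.
  apply: addr_ge0; last by apply: sumr_ge0 => j _; rewrite mulr_ge0// exprn_ge0.
  by rewrite mulr_ge0 ?exprn_ge0 ?(ltW rp)// ltW// scale_cst_gt0.
(* [2 * sK] collects the two window errors; the others are the replacement errors [3 M eps] of the
   discounted [f] (times [kap]), of the drift-weighted [f], of [H] and of [G]. *)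
apply: (@le_epsilon_mul _ _ _ (2 * sK + 3 * kap * Mf + 3 * Mf + 3 * MH + 3 * MG)) => eps eps0.
have [i1 hi1] := dev_small eps0.
have [i2 _ hi2] := cvgr_lt _ ind0 _ (le_lt_trans lim0 eps0).
have [i3 _ hi3] := cvgr_lt _ half0 _ eps0.
pose i := maxn i1 (maxn i2 i3).
have Pe : fine (P (dev i eps)) <= eps by apply: hi1; rewrite leq_max leqnn.
have Ie : \int[Q]_z ind i z <= eps by apply/ltW/hi2; rewrite /= !leq_max leqnn orbT.
have He : (2^-1 : R) ^+ nn i <= eps.
  apply: le_trans (ltW (hi3 i _)); last by rewrite /= !leq_max leqnn !orbT.
  by rewrite ler_wiXn2l ?invr_ge0 ?nn_ge//; lra.
have bfW (p : R -> R) (W : Omega * R -> R) : bounded_lipschitz p -> measurable_fun setT W ->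
    bmeasurable (fun z => p (W z)).
  by move=> bp mW; exact: (bmeasurable_comp (bounded_lipschitz_measurable bp) mW).
have bU := bmeasurableM (bjw i) (bja i).
have baU := bmeasurable_norm bU.
(* Each term is a weight that does not involve [W] times a bounded Lipschitz function of [W], the
   form on which [replace] acts. *)
have split_dynkin (W : Omega * R -> R) : measurable_fun setT W ->
    \int[Q]_z (jw i z * (- (kap + `|ja i z|) * f (W z) + H (W z) + ja i z * G (W z))) =
    - kap * \int[Q]_z (jw i z * f (W z)) - \int[Q]_z (`|jw i z * ja i z| * f (W z))
    + \int[Q]_z (jw i z * H (W z)) + \int[Q]_z (jw i z * ja i z * G (W z)).
  move=> mW; have b1 := bmeasurableM (bjw i) (bfW _ _ lf mW).
  have b2 := bmeasurableM baU (bfW _ _ lf mW).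
  have b3 := bmeasurableM (bjw i) (bfW _ _ lH mW).
  have b4 := bmeasurableM bU (bfW _ _ lG mW).
  have b5 := bmeasurableM (bc (- kap)) b1.
  have b6 := bmeasurableB b5 b2.
  have b7 := bmeasurableD b6 b3.
  transitivity (\int[Q]_z (- kap * (jw i z * f (W z)) - `|jw i z * ja i z| * f (W z) +
      jw i z * H (W z) + jw i z * ja i z * G (W z))).
    apply: eq_Rintegral => z _; rewrite normrM (ger0_norm (_ : 0 <= jw i z)); last by case/andP: (jw01 i z).
    move: (jw i z) (ja i z) (f _) (H _) (G _) => w a x y v; move: (`|a|) => q; ring.
  rewrite bRintegralD; [|exact: b7|exact: b4].
  rewrite bRintegralD; [|exact: b6|exact: b3].
  rewrite bRintegralB; [|exact: b5|exact: b2].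
  by rewrite bRintegralZl; last exact: b1.
have d0 := multiscale_dynkin hF aX cX al12 stL (bm i) kap0 K.+1.
rewrite -/f -/H -/G (split_dynkin _ (mjZ i)) in d0.
have rw := fun B => @event_weight _ _ _ _ _ cX _ (bm i) _ kap0 B.
have rU := fun B => @event_weight_rate _ _ _ _ _ L cX _ (bm i) _ kap0 B.
have raU B : measurable B -> \int[Q]_z (\1_B z.1 * `| `|jw i z * ja i z| |) <= fine (P B).
  by move=> mB; under eq_Rintegral do rewrite normr_id; exact: rU.
have e1 := replace (bjw i) rw hf eps0 Pe.
have e2 := replace baU raU hf eps0 Pe.
have e3 := replace (bjw i) rw hH eps0 Pe.
have e4 := replace bU rU hG eps0 Pe.
(* After the replacement the test functions and the drift are evaluated at the same point [X], so
   the pointwise inequality [multiscale_drift] applies. *)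
have upper : \int[Q]_z (jw i z * (- (kap + `|ja i z|) * f (jX z) + H (jX z) + ja i z * G (jX z)))
    <= - (\int[Q]_z (V N z * bump (jX z))) + (r^-1 ^+ K + sK * eps) + sK * eps.
  have bVb := bmeasurableM (bV N) (bmeasurable_comp (@bmeasurable_bump R) mjX).
  have bP := bmeasurableM (bc (r^-1 ^+ K + sK * eps)) baU.
  have bI := bmeasurableM (bc sK) (bind i).
  apply: (@le_trans _ _ (\int[Q]_z (- (V N z * bump (jX z)) +
     (r^-1 ^+ K + sK * eps) * `|jw i z * ja i z| + sK * ind i z))).
    apply: le_bRintegral.
    - have q1 := bmeasurableN (bmeasurableD (bc kap) (bmeasurable_norm (bja i))).
      have q2 := bmeasurableD (bmeasurableM q1 (bfW _ _ lf mjX)) (bfW _ _ lH mjX).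
      have q3 := bmeasurableM (bja i) (bfW _ _ lG mjX).
      exact: (bmeasurableM (bjw i) (bmeasurableD q2 q3)).
    - exact: (bmeasurableD (bmeasurableD (bmeasurableN bVb) bP) bI).
    move=> z; have /andP[w0 w1] := jw01 i z; have vw := V_itv N i z.
    have hb := multiscale_bump_ge al12 K (jX z).
    have D := multiscale_drift al12 c0 frac_le frac_decay K.+1 hb (@m_sgn i (jX z)) (@m_sing i (jX z)).
    rewrite normrM (ger0_norm w0) -addrA.
    apply: (cutoff_drift_le vw w1 _ _ D) => //.
    - by rewrite bump_ge0.
    - by rewrite exprS ler_piMl ?exprn_ge0 ?invr_ge0 ?(ltW rp)// invf_le1// ltW.
    - by rewrite ler_wpM2l.
    - rewrite ler_wpM2l// ler_nat; case: (leP `|jX z| (2^-1 ^+ nn i)) => // hx.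
      rewrite (le_trans hx)// ler_wiXn2l ?invr_ge0 ?nn_ge//; lra.
    - by rewrite mulr_ge0.
  rewrite bRintegralD; [|exact: (bmeasurableD (bmeasurableN bVb) bP)|exact: bI].
  rewrite bRintegralD; [|exact: (bmeasurableN bVb)|exact: bP].
  rewrite bRintegralN; last exact: bVb.
  rewrite (bRintegralZl Q (r^-1 ^+ K + sK * eps) baU) (bRintegralZl Q sK (bind i)).
  apply: lerD; last by rewrite ler_wpM2l.
  rewrite lerD2l; apply: ler_piMr; last exact: (weight_rate_le1 L cX (bm i) kap0).
  by rewrite addr_ge0 ?mulr_ge0 ?(ltW eps0)// exprn_ge0// invr_ge0 ltW.
rewrite (split_dynkin _ mjX) in upper.
have kk := kap0.
move: d0 e1 e2 e3 e4 upper.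
move: (\int[Q]_z (jw i z * f (jZ i z))) (\int[Q]_z (`|_| * f (jZ i z)))
  (\int[Q]_z (jw i z * H (jZ i z))) (\int[Q]_z (jw i z * ja i z * G (jZ i z)))
  (\int[Q]_z (jw i z * f (jX z))) (\int[Q]_z (`|_| * f (jX z)))
  (\int[Q]_z (jw i z * H (jX z))) (\int[Q]_z (jw i z * ja i z * G (jX z)))
  (\int[Q]_z (V N z * bump (jX z))) => I1 I2 I3 I4 J1 J2 J3 J4 B d0.
rewrite !ler_norml => /andP[e1 _] /andP[e2 _] /andP[_ e3] /andP[_ e4] upper.
have e1' : kap * (J1 - I1) <= kap * (3 * Mf * eps) by rewrite ler_wpM2l//; lra.
lra.
Qed.

(** The number of scales tends to infinity and the truncation error decays geometrically. *)
Lemma solution_sticks N :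
  {ae Q, forall z, jX z <> 0} -> {ae Q, forall z, V N z * bump (jX z) = 0}.
Proof.
move=> X0; have r1 := scale_ratio_gt1 al12; have rp : 0 < r by apply: lt_trans r1.
apply: bRintegral_eq0_ae.
- exact: (bmeasurableM (bV N) (bmeasurable_comp (@bmeasurable_bump R) mjX)).
- by move=> z; rewrite mulr_ge0 ?bump_ge0//; case/andP: (V01 N z).
apply: (@le_geometric0 _ _ 1 r^-1).
  by rewrite invr_ge0 (ltW rp) invf_lt1.
by move=> K; exact: cutoff_bump_le.
Qed.

(** The events [drift_event N] exhaust [Omega] up to a null set and the cutoff of level [N] is
    positive on the [N]-th one. Hence almost everywhere in space-time [X] is both nonzero and zero,
    although [space_time] has mass [1]. *)
Lemma no_solution : False.
Proof.
have Vpos : {ae Q, forall z, exists N, drift_event N z.1}.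
  exact: (ae_space_time drift_bounded).
have V0 N z : drift_event N z.1 -> V N z != 0.
  by move=> zN; rewrite /drift_cutoff indicE mem_set// mulr1 gt_eqF// expR_gt0.
have X0 : {ae Q, forall z, jX z <> 0}.
  apply: filterS2 Vpos (ae_foralln solution_avoids_zero) => z [N zN] /(_ N)/eqP.
  by rewrite mulf_eq0 (negbTE (V0 _ _ zN))/= pnatr_eq0 eqb0 => /eqP.
have [B [mB B0 TB]] : {ae Q, forall z, False}.
  have h1 := ae_foralln (fun N => solution_sticks N X0).
  apply: filterS3 Vpos h1 X0 => z [N zN] /(_ N)/eqP.
  by rewrite mulf_eq0 (negbTE (V0 _ _ zN))/= => /eqP/bump_eq0.
have : Q setT = 0.
  apply/eqP; rewrite eq_le measure_ge0 andbT -[leRHS]B0.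
  by apply: le_measure; rewrite ?inE// => z _; exact: TB.
by move=> /(congr1 fine); rewrite probability_setT/= => /eqP; rewrite oner_eq0.
Qed.

End nonexistence.

Lemma no_weak_solution (R : realType) (al c : R) (al12 : 1 < al < 2)
    (C0 : 0 < 4 * scale_ratio al ^+ 2 * scale_cst al c) (phi : R -> R) :
  0 < c -> (forall x, `|frac_bump al x| <= c) -> (forall x, `|x * frac_bump al x| <= c) ->
  mollifier phi -> ~ has_weak_solution phi al 0 (drift_charge al12 C0).
Proof.
move=> c0 frac_le frac_decay hphi.
case=> d; case=> Omega; case=> P; case=> F; case=> X; case=> L.
case=> hF aX [cX stL]; case=> A; case=> cA XLA ucp [k kmono supk].
pose m i := mollified phi (drift_charge al12 C0) (k i).
have bm i : bmeasurable (m i) by exact: bmeasurable_mollified.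
(* Convergence of the drifts holds along the full sequence; this transfers it to the subsequence on
   which the absolute drift stays bounded. *)
have k_ge i : (i <= k i)%N.
  by elim: i => [//|i IH]; apply: leq_ltn_trans IH (kmono _ _ (ltnSn i)).
apply: (@no_solution _ Omega R P F X L A al hF aX cX al12 stL cA _ c c0 frac_le frac_decay k k_ge m bm).
- by apply: filterS XLA => w h t t0; rewrite (h t t0) add0r.
- by move=> i x; rewrite exprVn; exact: mollified_drift_sgn.
- by move=> i x; rewrite exprVn; exact: mollified_drift_le.
- move=> eps eps0.
  have /fine_cvg/cvgr_lt/(_ _ eps0)[N _ hN] := ucp 1 eps ler01 eps0.
  by exists N => i Ni; apply/ltW/hN => /=; exact: leq_trans (k_ge i).
- apply: filterS (supk 1 ltr01) => w supw.
  set S := ereal_sup _ in supw.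
  have Sge i : (mollified_abs_drift phi (drift_charge al12 C0) X (k i) 1 w <= S)%E.
    by apply: ereal_sup_ubound; exists i.
  have ge0 i : (0 <= mollified_abs_drift phi (drift_charge al12 C0) X (k i) 1 w)%E.
    by apply: integral_ge0 => u _; rewrite lee_fin.
  have Sfin : S \is a fin_num by rewrite ge0_fin_numE// (le_trans (ge0 0)).
  exists (Num.truncn (fine S)).+1 => i.
  apply: le_trans (ltW (truncnS_gt (fine S))).
  apply: fine_le => //; last exact: Sge.
  by rewrite ge0_fin_numE; [exact: le_lt_trans (Sge i) supw|exact: ge0].
Qed.

Theorem mainTheorem9 (R : realType) (alpha : R) (halpha : 1 < alpha < 2) :
  exists C : R, 0 < C /\
  exists mu : {charge set (measurableTypeR R) -> \bar R},
    [/\ has_density mu (singular_drift alpha C),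
        forall eta : R, alpha - 1 < eta < 1 -> finite_kato_class eta mu
      & forall phi : R -> R, mollifier phi ->
          ~ has_weak_solution phi alpha 0 mu].
Proof.
have [b hb] := frac_bump_bounded halpha; have [b' hb'] := frac_bump_decay halpha.
(* [c] majorises both bounds on the generator and the [1] keeps it positive. It is chosen before any
   mollifier, so the same [C] serves them all. *)
pose c := `|b| + `|b'| + 1.
have c0 : 0 < c by rewrite ltr_wpDl// addr_ge0.
have frac_le x : `|frac_bump alpha x| <= c.
  rewrite (le_trans (hb x))// (le_trans (ler_norm b))// /c -addrA lerDl addr_ge0//.
have frac_decay x : `|x * frac_bump alpha x| <= c.
  by rewrite (le_trans (hb' x))// (le_trans (ler_norm b'))// /c addrAC lerDr addr_ge0.
have r0 : 0 < scale_ratio alpha by apply: lt_trans (scale_ratio_gt1 halpha).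
have C0 : 0 < 4 * scale_ratio alpha ^+ 2 * scale_cst alpha c.
  by rewrite mulr_gt0 ?scale_cst_gt0// mulr_gt0// exprn_gt0.
exists (4 * scale_ratio alpha ^+ 2 * scale_cst alpha c); split => //.
exists (drift_charge halpha C0); split.
- exact: drift_charge_density.
- by move=> eta; exact: drift_kato.
- by move=> phi; exact: no_weak_solution.
Qed.
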